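(* Let $q\in(1,\infty)$, let $(X,\mathsf d)$ be a complete and separable metric space and let $\mathfrak m$ be a nonnegative Borel measure on $X$, finite on bounded sets. If $W^{1,q}(X,\mathsf d,\mathfrak m)$ is reflexive, then it is separable and bounded Lipschitz functions with bounded support are dense in it.
   Context: $B(x,r)$ is the open ball. $p=q/(q-1)$. **Relaxed slope.** $\mathrm{Lip}(f,E)$ is the Lipschitz constant of $f$ on $E$, and $\mathrm{Lip}_a(f,x):=\lim_{r\downarrow0}\mathrm{Lip}(f,B(x,r))$. $g\in L^q(X,\mathfrak m)$ is a $q$-relaxed slope of $f\in L^q(X,\mathfrak m)$ if there are $\tilde g\in L^q(X,\mathfrak m)$ with $\tilde g\le g$ $\mathfrak m$-a.e. and Lipschitz functions $f_n$ with bounded support such that $f_n\to f$ in $L^q(X,\mathfrak m)$ and $\mathrm{Lip}_a(f_n,\cdot)\rightharpoonup\tilde g$ weakly in $L^q(X,\mathfrak m)$. **Weak upper gradient.** $AC^p([0,1],X)$ is the set of absolutely continuous curves $\gamma$ with $\int_0^1|\dot\gamma_t|^p\,dt<\infty$, $|\dot\gamma_t|$ being the metric speed; $e_t(\gamma)=\gamma_t$. A $p$-test plan is a Borel probability measure $\pi$ on $C([0,1],X)$ concentrated on $AC^p([0,1],X)$ with $\int\int_0^1|\dot\gamma_t|^p\,dt\,d\pi(\gamma)<\infty$ and $(e_t)_\sharp\pi\le C(\pi)\mathfrak m$ for all $t\in[0,1]$, for some constant $C(\pi)$. A set of curves is $q$-negligible if it is contained in a $\pi$-negligible set for every $p$-test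 plan $\pi$; ''for $q$-a.e. curve'' means outside a $q$-negligible set. A Borel $g:X\to[0,\infty]$ is a $q$-weak upper gradient of $f$ if $|f(\gamma_1)-f(\gamma_0)|\le\int_0^1g(\gamma_t)|\dot\gamma_t|\,dt<\infty$ for $q$-a.e. $\gamma$. The minimal $q$-weak upper gradient $|\nabla f|_{w,q}$ is the $q$-weak upper gradient (unique up to $\mathfrak m$-negligible sets) with $|\nabla f|_{w,q}\le g$ $\mathfrak m$-a.e. for every $q$-weak upper gradient $g$ of $f$. (Every $f\in L^q$ with a $q$-relaxed slope has a $q$-weak upper gradient.) **Sobolev space.** $W^{1,q}(X,\mathsf d,\mathfrak m)$ is the space of $u\in L^q(X,\mathfrak m)$ having a $q$-relaxed slope, with norm $\bigl(\|u\|_q^q+\int_X|\nabla u|_{w,q}^q\,d\mathfrak m\bigr)^{1/q}$. *)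

(* Defs.v *)
From HB Require Import structures.
From mathcomp Require Import all_boot all_order all_algebra.
From mathcomp Require Import all_classical all_reals all_analysis.
From mathcomp Require Import measurable_realfun.

Set Implicit Arguments.
Unset Strict Implicit.
Unset Printing Implicit Defensive.

Import Order.TTheory GRing.Theory Num.Theory.
Import numFieldNormedType.Exports.

Local Open Scope classical_set_scope.
Local Open Scope ring_scope.

(* A normed space is given by a set [W] of vectors of an ambient module [V] and
   a map [N] which is a seminorm on [W]; the normed space meant is the quotient
   of [W] by [N u = 0].  Bounded functionals vanish on the null vectors, so
   nothing below sees the difference between a vector and its class. *)
Section seminormed_space.
Context {R : realType} {V : lmodType R}.
Implicit Types (W D : set V) (N : V -> \bar R) (l : V -> R).

Definition linear_on W l :=
  forall (a : R) u v, W u -> W v -> l (a *: u + v) = a * l u + l v.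

Definition opnorm W N l : \bar R :=
  ereal_sup [set `|l u|%:E | u in W `&` [set u | (N u <= 1)%E]].

(* Two functionals which agree on [W] are at [opnorm]-distance 0. *)
Definition dual W N : set (V -> R) :=
  [set l | linear_on W l /\ (opnorm W N l < +oo)%E].

Definition norm_cvg N (u : nat -> V) (v : V) :=
  N (u n - v) @[n --> \oo] --> 0%E.

Definition weak_cvg W N (u : nat -> V) (v : V) :=
  [/\ forall n, W (u n), W v
    & forall l, dual W N l -> l (u n) @[n --> \oo] --> l v].

Definition dense_subset W N D :=
  D `<=` W /\
  forall u, W u -> forall e : R, 0 < e -> exists2 v, D v & (N (u - v)%R < e%:E)%E.

Definition is_separable W N := exists2 D, countable D & dense_subset W N D.

End seminormed_space.

(* Surjectivity of the canonical map into the bidual. *)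
Definition is_reflexive {R : realType} {V : lmodType R}
    (W : set V) (N : V -> \bar R) :=
  forall Phi : (V -> R) -> R, dual (dual W N) (opnorm W N) Phi ->
    exists2 u, W u & forall l, dual W N l -> Phi l = l u.

#[short(type="completeMetricType")]
HB.structure Definition CompleteMetric (R : numDomainType) :=
  {X of Metric R X & Complete X}.

Notation borel T := (g_sigma_algebraType (@open T)).

Definition separable_space (T : topologicalType) :=
  exists2 D : set T, countable D & dense D.

Section metric_notions.
Context {R : realType} {X : completeMetricType R}.
Implicit Types (A : set X) (f : X -> R).

Definition metric_bounded A :=
  exists M : R, forall x y, A x -> A y -> mdist x y <= M.

Definition finite_on_bounded (m : set X -> \bar R) :=
  forall A : set (borel X), measurable A -> metric_bounded A -> (m A < +oo)%E.

Definition lipschitz_const_on A f (L : R) :=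
  0 <= L /\ forall x y, A x -> A y -> `|f x - f y| <= L * mdist x y.

Definition is_lipschitz f := exists L, lipschitz_const_on setT f L.

Definition bounded_support f := metric_bounded [set x | f x != 0].

(* The least Lipschitz constant, [+oo] if there is none. *)
Definition Lip f A : \bar R :=
  ereal_inf [set L%:E | L in lipschitz_const_on A f].

Definition Lip_a f (x : X) : \bar R := lim (Lip f (ball x r) @[r --> 0^'+]).

End metric_notions.

(* C([0,1], X): a continuous curve on [0,1] is represented by its extension to
   the real line that is constant on ]-oo, 0] and on [1, +oo[. *)
Record curve {R : realType} (X : completeMetricType R) := Curve {
  curve_fun :> R -> X ;
  curve_continuous : continuous curve_fun ;
  curve_clamp : forall t, curve_fun t = curve_fun (Num.max 0 (Num.min 1 t)) }.

Section curve_space.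
Context {R : realType} (X : completeMetricType R).

Definition cst_curve (x : X) : curve X :=
  @Curve _ X (fun=> x) (@cst_continuous _ _ x) (fun=> erefl).

HB.instance Definition _ := gen_eqMixin (curve X).
HB.instance Definition _ := gen_choiceMixin (curve X).
HB.instance Definition _ := isPointed.Build (curve X) (cst_curve point).

(* The topology of the sup distance. *)
Definition curve_uniform (c : curve X) : {uniform` `[(0 : R), 1] -> X} := c.

HB.instance Definition _ :=
  Topological.copy (curve X) (initial_topology curve_uniform).

End curve_space.

Section weak_upper_gradient.
Context {R : realType} {X : completeMetricType R}.
Implicit Types (c : curve X) (p q : R).
Local Notation leb := (@lebesgue_measure R).
Local Notation I01 := (`[(0 : R), (1 : R)]%classic).

(* [lim] is 0 where the limit does not exist, which for an absolutely continuous
   curve happens only on a null set of times. *)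
Definition metric_speed c (t : R) : \bar R :=
  lim ((mdist (c t) (c (t + h)) / `|h|)%:E @[h --> 0^']).

(* AC([0,1], X) as is usual for curves in metric spaces: the increments are
   dominated by the integral of an L^1 function. *)
Definition absolutely_continuous_curve c :=
  exists2 g : R -> R, leb.-integrable I01 (EFin \o g) &
    forall s t, 0 <= s -> s <= t -> t <= 1 ->
      ((mdist (c s) (c t))%:E <= \int[leb]_(r in `[s, t]) (g r)%:E)%E.

Definition AC p : set (curve X) :=
  [set c | absolutely_continuous_curve c /\
    (\int[leb]_(t in I01) (metric_speed c t `^ p) < +oo)%E].

Definition eval_curve (t : R) (c : borel (curve X)) : borel X := c t.

Variable m : {measure set (borel X) -> \bar R}.

Definition test_plan p (pi : probability (borel (curve X)) R) :=
  [/\ pi.-negligible (~` AC p),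
      (\int[pi]_c \int[leb]_(t in I01) (metric_speed c t `^ p) < +oo)%E &
      exists C : R, forall t, 0 <= t <= 1 ->
        forall B : set (borel X), measurable B ->
          (pushforward pi (eval_curve t) B <= C%:E * m B)%E].

Definition conjugate_exponent q : R := q / (q - 1).

Definition curve_negligible q (G : set (curve X)) :=
  forall pi, test_plan (conjugate_exponent q) pi -> pi.-negligible G.

Definition for_ae_curve q (P : curve X -> Prop) :=
  exists2 G, curve_negligible q G & forall c, ~ G c -> P c.

Definition weak_upper_gradient q (f : X -> R) (g : X -> \bar R) :=
  [/\ measurable_fun setT (g : borel X -> \bar R),
      forall x, (0 <= g x)%E &
      for_ae_curve q (fun c =>
        (`|f (c 1%R) - f (c 0%R)|%:E
            <= \int[leb]_(t in I01) (g (c t) * metric_speed c t) < +oo)%E)].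

Definition minimal_weak_upper_gradient q (f : X -> R) (g : X -> \bar R) :=
  weak_upper_gradient q f g /\
  forall g', weak_upper_gradient q f g' -> {ae m, forall x, (g x <= g' x)%E}.

(* A representative; [+oo] if [f] has no weak upper gradient. *)
Definition min_wug q (f : X -> R) : X -> \bar R :=
  xget (cst +oo%E) (minimal_weak_upper_gradient q f).

End weak_upper_gradient.

Section sobolev.
Context {R : realType} {X : completeMetricType R}.
Variables (m : {measure set (borel X) -> \bar R}) (q : R).
Implicit Types f g : X -> R.

Definition Lq : set (X -> R) := [set f | (f : borel X -> R) \in Lfun m q%:E].

Definition Lq_norm f : \bar R := 'N[m]_(q%:E)[EFin \o f]%E.

Definition relaxed_slope f g :=
  [/\ Lq f, Lq g &
    exists2 g' : X -> R, Lq g' /\ {ae m, forall x, g' x <= g x} &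
      exists2 u : nat -> X -> R,
        forall n, is_lipschitz (u n) /\ bounded_support (u n) &
        norm_cvg Lq_norm u f /\
        (* [Lip_a] is finite on Lipschitz functions *)
        weak_cvg Lq Lq_norm (fun n x => fine (Lip_a (u n) x)) g'].

Definition sobolev : set (X -> R) :=
  [set f | Lq f /\ exists g, relaxed_slope f g].

Definition sobolev_norm f : \bar R :=
  ((Lq_norm f `^ q + \int[m]_x (min_wug m q f x `^ q)) `^ q^-1)%E.

Definition bounded_lipschitz_bs : set (X -> R) :=
  [set f | [/\ exists M : R, forall x, `|f x| <= M,
               is_lipschitz f & bounded_support f]].

End sobolev.

(* Main.v *)
(* By Mazur's lemma the weak convergence in the definition of a relaxed slope
   becomes strong: an element [f] of the Sobolev space is an [L^q] limit of
   Lipschitz functions [v_n] with bounded support having slope majorants [k_n]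
   that converge in [L^q].  By Fuglede's lemma [k_n] controls the minimal weak
   upper gradient of [v_n], so [v_n] is bounded in the Sobolev norm.  If [f] were
   at positive distance from a convex set [C] containing the [v_n], Hahn-Banach
   would separate it from [C]; but by reflexivity the limit of [l (v_n)] along an
   ultrafilter is [l u] for some [u], and [u] is [f] up to a null vector because
   the [L^q] norm is dominated by the Sobolev norm.  Taking for [C] the bounded
   Lipschitz functions with bounded support gives the density; taking the closure
   of the rational combinations of truncated McShane extensions of rational data
   on a countable dense set gives the separability.  The minimal weak upper
   gradient exists because weak upper gradients are stable under minima; this is
   proved by stopping test plans at the ends of subintervals of [0, 1]. *)
Require Import Defs.
From HB Require Import structures.
From mathcomp Require Import all_boot all_order all_algebra.
From mathcomp Require Import all_classical all_reals all_analysis.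
From mathcomp Require Import measurable_realfun.
From mathcomp Require Import ring lra.

Set Implicit Arguments.
Unset Strict Implicit.
Unset Printing Implicit Defensive.

Import Order.TTheory GRing.Theory Num.Theory.
Import numFieldNormedType.Exports.

Local Open Scope classical_set_scope.
Local Open Scope ring_scope.

(** * Hahn-Banach and reflexivity *)

(** A relaxed slope is a weak limit of functions [Lip_a (u n)], and [Lip_a] is only subadditive, so
    slopes of convex combinations are not convex combinations of slopes. Mazur's step is therefore
    phrased with majorants: pairs of a Lipschitz function and an [L^q] majorant of its slope are
    stable under linear combinations, with absolute values on the coefficients of the majorant.
    Estimates are made on [approx_space], the functions approximable by such pairs, where linearity
    is immediate; reflexivity is invoked only on [sobolev]. Two obstacles shape the part on curves.
    [metric_speed] is a limit over all small steps, whose joint measurability in curve and time is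
    not evident, so integrals are compared almost everywhere without measurability and moved to the
    sequential [mspeed]. And a weak upper gradient controls [f] along almost every curve only at
    countably many times, so the minimum of two of them cannot be handled by differentiating [f]
    along the curve; increments over fine partitions are compared instead. *)

Section hahn_banach.
Context {R : realType} {V : lmodType R}.
Implicit Types (W C : set V) (p n l : V -> R).

Definition linear_subspace W :=
  W 0 /\ forall (a : R) u v, W u -> W v -> W (a *: u + v).

(** One inequality for positive factors is enough: applying it with [t^-1] gives the converse. *)
Definition sublinear_on W p :=
  (forall u v, W u -> W v -> p (u + v) <= p u + p v) /\
  (forall (t : R) u, 0 < t -> W u -> p (t *: u) <= t * p u).

Definition seminorm_on W n :=
  (forall u v, W u -> W v -> n (u + v) <= n u + n v) /\
  (forall (a : R) u, W u -> n (a *: u) = `|a| * n u).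

Definition convex_on C := forall (t : R) u v, 0 <= t -> t <= 1 -> C u -> C v ->
  C (t *: u + (1 - t) *: v).

Section subspace.
Variables (W : set V) (HW : linear_subspace W).

Lemma subspace0 : W 0. Proof. exact: HW.1. Qed.

Lemma subspaceZ a u : W u -> W (a *: u).
Proof. by move=> Wu; rewrite -[_ *: _]addr0; apply: HW.2 => //; exact: HW.1. Qed.

Lemma subspaceD u v : W u -> W v -> W (u + v).
Proof. by move=> Wu Wv; rewrite -[u]scale1r; exact: HW.2. Qed.

Lemma subspaceN u : W u -> W (- u).
Proof. by move=> Wu; rewrite -scaleN1r; exact: subspaceZ. Qed.

Lemma subspaceB u v : W u -> W v -> W (u - v).
Proof. by move=> Wu Wv; apply: subspaceD => //; exact: subspaceN. Qed.

Lemma sublinear0 p : sublinear_on W p -> p 0 = 0.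
Proof.
move=> [_ ph]; have := ph 2 0 ltac:(lra) subspace0.
have := ph 2^-1 0 ltac:(lra) subspace0; rewrite !scaler0; lra.
Qed.

Lemma sublinearN p u : sublinear_on W p -> W u -> - p (- u) <= p u.
Proof.
move=> hp Wu; have := hp.1 u (- u) Wu (subspaceN Wu).
rewrite subrr (sublinear0 hp); lra.
Qed.

Lemma seminorm_ge0 n u : seminorm_on W n -> W u -> 0 <= n u.
Proof.
move=> [nD nZ] Wu; have := nD u (- u) Wu (subspaceN Wu).
rewrite subrr -{1}(scale0r u) nZ// -scaleN1r nZ// normrN1 normr0; lra.
Qed.

Lemma seminormN n u : seminorm_on W n -> W u -> n (- u) = n u.
Proof. by move=> [_ nZ] Wu; rewrite -scaleN1r nZ// normrN1 mul1r. Qed.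

Lemma seminorm_sub n u v w : seminorm_on W n -> W u -> W v -> W w ->
  n (u - w) <= n (u - v) + n (v - w).
Proof.
move=> sn Wu Wv Ww; rewrite -(subrKA v).
by apply: sn.1; exact: subspaceB.
Qed.

Lemma linear_onB l u v : linear_on W l -> W u -> W v -> l (u - v) = l u - l v.
Proof.
move=> ll Wu Wv; have := ll (-1) v u Wv Wu.
by rewrite scaleN1r mulN1r addrC => ->; rewrite addrC.
Qed.

Lemma linear_on0 l : linear_on W l -> l 0 = 0.
Proof.
by move=> ll; rewrite -(subrr 0) (linear_onB ll) ?subrr//; exact: subspace0.
Qed.

Lemma linear_onZ l a u : linear_on W l -> W u -> l (a *: u) = a * l u.
Proof.
move=> ll Wu; have := ll a u 0 Wu subspace0.
by rewrite !addr0 (linear_on0 ll) addr0.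
Qed.

(* The perturbation [q_y x = inf_(t >= 0) q (x + t y) - t q y] of a sublinear
   [q] is sublinear and below [q]; for a minimal [q] it equals [q], which makes
   [q] additive. *)
Let perturb (q : V -> R) (y x : V) : R :=
  inf [set q (x + t *: y) - t * q y | t in [set t | 0 <= t]].

Let perturb_lb q y x t : sublinear_on W q -> W x -> W y -> 0 <= t ->
  - q (- x) <= q (x + t *: y) - t * q y.
Proof.
move=> hq Wx Wy t0.
have qt : q (t *: y) = t * q y.
  move: t0; rewrite le_eqVlt => /predU1P[<-|t0].
    by rewrite scale0r (sublinear0 hq) mul0r.
  apply/eqP; rewrite eq_le hq.2//=.
  have ti : 0 < t^-1 by rewrite invr_gt0.
  have := hq.2 t^-1 (t *: y) ti (subspaceZ _ Wy).
  by rewrite scalerA mulVf ?gt_eqF// scale1r -(ler_pM2l t0) mulrA mulfV ?gt_eqF// mul1r.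
have := hq.1 (x + t *: y) (- x) (subspaceD Wx (subspaceZ _ Wy)) (subspaceN Wx).
by rewrite addrAC subrr add0r qt; lra.
Qed.

Let perturb_le q y x t : sublinear_on W q -> W x -> W y -> 0 <= t ->
  perturb q y x <= q (x + t *: y) - t * q y.
Proof.
move=> hq Wx Wy t0; apply: ge_inf; last by exists t.
by exists (- q (- x)) => _ [s s0 <-]; exact: perturb_lb.
Qed.

Let le_perturb q y x c : 
  (forall t, 0 <= t -> c <= q (x + t *: y) - t * q y) -> c <= perturb q y x.
Proof.
move=> h; apply: lb_le_inf; first by exists (q (x + 0 *: y) - 0 * q y), 0 => /=.
by move=> _ [t t0 <-]; exact: h.
Qed.

Let perturb_sublinear q y : sublinear_on W q -> W y ->
  sublinear_on W (perturb q y).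
Proof.
move=> hq Wy; split.
- move=> u v Wu Wv; rewrite -lerBlDr; apply: le_perturb => t t0.
  rewrite lerBlDr -lerBlDl; apply: le_perturb => s s0.
  rewrite lerBlDl.
  apply: (le_trans (perturb_le hq (subspaceD Wu Wv) Wy (addr_ge0 t0 s0))).
  have := hq.1 (u + t *: y) (v + s *: y) (subspaceD Wu (subspaceZ _ Wy)) (subspaceD Wv (subspaceZ _ Wy)).
  rewrite addrACA -scalerDl; lra.
- move=> t u t0 Wu; rewrite mulrC -ler_pdivrMr//; apply: le_perturb => s s0.
  rewrite ler_pdivrMr//.
  apply: (le_trans (perturb_le hq (subspaceZ _ Wu) Wy (mulr_ge0 (ltW t0) s0))).
  have := hq.2 t (u + s *: y) t0 (subspaceD Wu (subspaceZ _ Wy)).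
  by rewrite scalerDr scalerA; lra.
Qed.

Lemma minimal_sublinear_linear q : sublinear_on W q ->
  (forall q', sublinear_on W q' -> (forall u, W u -> q' u <= q u) ->
    forall u, W u -> q u <= q' u) ->
  linear_on W q.
Proof.
move=> hq qmin.
have qD u v : W u -> W v -> q (u + v) = q u + q v.
  move=> Wu Wv; apply/eqP; rewrite eq_le hq.1//=.
  have := qmin _ (perturb_sublinear hq Wv).
  have H : forall u0, W u0 -> perturb q v u0 <= q u0.
    move=> w Ww; have := perturb_le hq Ww Wv (lexx 0).
    by rewrite scale0r addr0 mul0r subr0.
  (* Minimality gives [q u <= perturb q v u], and the parameter 1 in the infimum turns this into
     superadditivity. *)
  move=> /(_ H u Wu) => h; have := le_trans h (perturb_le hq Wu Wv ler01).
  by rewrite scale1r mul1r lerBrDr.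
have qN u : W u -> q (- u) = - q u.
  move=> Wu; have := qD u (- u) Wu (subspaceN Wu).
  by rewrite subrr (sublinear0 hq); lra.
have qpos t u : 0 < t -> W u -> q (t *: u) = t * q u.
  move=> t0 Wu; apply/eqP; rewrite eq_le hq.2//=.
  have ti : 0 < t^-1 by rewrite invr_gt0.
  have := hq.2 t^-1 (t *: u) ti (subspaceZ _ Wu).
  by rewrite scalerA mulVf ?gt_eqF// scale1r -(ler_pM2l t0) mulrA mulfV ?gt_eqF// mul1r.
move=> a u v Wu Wv; rewrite qD//; last exact: subspaceZ.
congr (_ + _); have [a0|a0|->] := ltgtP a 0.
- rewrite -[a]opprK scaleNr qN; last exact: subspaceZ.
  by rewrite qpos ?oppr_gt0// !mulNr.
- exact: qpos.
- by rewrite scale0r mul0r (sublinear0 hq).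
Qed.

(** No functional is extended here. Zorn's lemma yields a minimal element among the sublinear
    functions below [p], and minimality forces linearity. The order [le] is reversed so that minimal
    functions are its maximal elements. *)
Theorem hahn_banach p : sublinear_on W p ->
  exists2 l, linear_on W l & forall u, W u -> l u <= p u.
Proof.
move=> hp.
pose T := {q : V -> R | sublinear_on W q /\ forall u, W u -> q u <= p u}.
pose le (q1 q2 : T) := `[< forall u, W u -> sval q2 u <= sval q1 u >].
have p_in : sublinear_on W p /\ forall u, W u -> p u <= p u by split.
pose t0 : T := exist _ p p_in.
have lexx' t : le t t by apply/asboolP.
have letr r s t : le r s -> le s t -> le r t.
  move=> /asboolP rs /asboolP st; apply/asboolP => u Wu.
  exact: le_trans (st _ Wu) (rs _ Wu).
have chain A : total_on A le -> exists t, forall s, A s -> le s t.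
  move=> Atot; have [[s0 As0]|A0] := pselect (exists s, A s); last first.
    by exists t0 => s As; exfalso; apply: A0; exists s.
  pose m u := inf [set sval s u | s in A].
  have mlb u : W u -> has_lbound [set sval s u | s in A].
    move=> Wu; exists (- p (- u)) => _ [s As <-].
    apply: le_trans (sublinearN (svalP s).1 Wu).
    by rewrite lerN2; apply: (svalP s).2; exact: subspaceN.
  have m_le s u : A s -> W u -> m u <= sval s u.
    by move=> As Wu; apply: ge_inf; [exact: mlb|exists s].
  have le_m c u : (forall s, A s -> c <= sval s u) -> c <= m u.
    move=> h; apply: lb_le_inf; first by exists (sval s0 u), s0.
    by move=> _ [s As <-]; exact: h.
  have m_in : sublinear_on W m /\ forall u, W u -> m u <= p u.
    split; last first.
      by move=> u Wu; apply: le_trans (m_le _ _ As0 Wu) _; exact: (svalP s0).2.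
    split.
      move=> u v Wu Wv; have Wuv := subspaceD Wu Wv.
      rewrite -lerBlDr; apply: (le_m) => s As.
      rewrite lerBlDr -lerBlDl; apply: (le_m) => r Ar; rewrite lerBlDl.
      (* The smaller of the two chain members bounds [m (u + v)]; by its own subadditivity it stays
         below [sval s u + sval r v]. *)
      have [/asboolP sr|/asboolP rs] := Atot s r As Ar.
        apply: (le_trans (m_le r _ Ar Wuv)).
        apply: (le_trans ((svalP r).1.1 _ _ Wu Wv)).
        by rewrite lerD2r; exact: sr.
      apply: (le_trans (m_le s _ As Wuv)).
      apply: (le_trans ((svalP s).1.1 _ _ Wu Wv)).
      by rewrite lerD2l; exact: rs.
    move=> t u t_gt0 Wu; rewrite mulrC -ler_pdivrMr//; apply: (le_m) => s As.
    rewrite ler_pdivrMr// mulrC.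
    apply: (le_trans (m_le s _ As (subspaceZ _ Wu))).
    exact: (svalP s).1.2.
  exists (exist _ m m_in) => s As; apply/asboolP => u Wu /=; exact: m_le.
have [q qmin] := ZL_preorder t0 lexx' letr chain.
have [hq qp] := svalP q.
exists (sval q) => //; apply: minimal_sublinear_linear => // q' hq' q'q.
have q'_in : sublinear_on W q' /\ forall u, W u -> q' u <= p u.
  by split => // u Wu; exact: le_trans (q'q _ Wu) (qp _ Wu).
have : le q (exist _ q' q'_in) by apply/asboolP.
by move=> /qmin /asboolP.
Qed.

(* The separating functional is dominated by the sublinear functional
   [u |-> inf_(t >= 0, c in C) n (u + t c) - t d]. *)
Lemma convex_separation n C d : seminorm_on W n -> C `<=` W -> convex_on C ->
  C !=set0 -> (forall c, C c -> d <= n c) ->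
  exists l, [/\ linear_on W l, forall u, W u -> `|l u| <= n u &
    forall c, C c -> d <= l c].
Proof.
move=> sn CW Ccvx [c0 Cc0] Cd.
pose S u := [set n (u + tc.1 *: tc.2) - tc.1 * d |
  tc in [set tc : R * V | 0 <= tc.1 /\ C tc.2]].
pose p u := inf (S u).
have Slb u : W u -> forall t c, 0 <= t -> C c -> - n u <= n (u + t *: c) - t * d.
  move=> Wu t c t0 Cc; have Wtc : W (t *: c) by apply: subspaceZ; exact: CW.
  have := sn.1 (u + t *: c) (- u) (subspaceD Wu Wtc) (subspaceN Wu).
  rewrite addrAC subrr add0r sn.2 ?ger0_norm//; last exact: CW.
  rewrite (seminormN sn Wu).
  have : t * d <= t * n c by rewrite ler_wpM2l// Cd.
  lra.
have p_le u t c : W u -> 0 <= t -> C c -> p u <= n (u + t *: c) - t * d.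
  move=> Wu t0 Cc; apply: ge_inf; last by exists (t, c).
  by exists (- n u) => _ [[s e] /= [s0 Ce] <-]; exact: Slb.
have le_p a u : (forall t c, 0 <= t -> C c -> a <= n (u + t *: c) - t * d) -> a <= p u.
  move=> h; apply: lb_le_inf; last by move=> _ [[s e] /= [s0 Ce] <-]; exact: h.
  by exists (n (u + 0 *: c0) - 0 * d), (0, c0).
have hp : sublinear_on W p.
  split.
    move=> u v Wu Wv; rewrite -lerBlDr; apply: (le_p) => t c t0 Cc.
    rewrite lerBlDr -lerBlDl; apply: (le_p) => s e s0 Ce; rewrite lerBlDl.
    have [ts0|ts0] := eqVneq (t + s) 0.
      have [t00 s00] : t = 0 /\ s = 0 by split; lra.
      subst t s; rewrite !scale0r !mul0r !subr0 !addr0.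
      apply: (le_trans (p_le _ 0 c0 (subspaceD Wu Wv) (lexx 0) Cc0)).
      by rewrite scale0r mul0r subr0 addr0; apply: (sn.1).
    have ts_gt0 : 0 < t + s by rewrite lt_neqAle eq_sym ts0 addr_ge0.
    (* The vectors [t *: c] and [s *: e] merge into [(t + s) *: w], and convexity puts [w] in [C].
       The weights need a nonzero [t + s], hence the separate case above. *)
    pose w := (t / (t + s)) *: c + (1 - t / (t + s)) *: e.
    have Cw : C w.
      apply: Ccvx => //; first by rewrite divr_ge0// ltW.
      by rewrite ler_pdivrMr// mul1r lerDl.
    apply: (le_trans (p_le _ (t + s) w (subspaceD Wu Wv) (ltW ts_gt0) Cw)).
    have -> : u + v + (t + s) *: w = (u + t *: c) + (v + s *: e).
      rewrite addrACA; congr (_ + _); rewrite /w scalerDr !scalerA.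
      congr (_ *: _ + _ *: _); by field.
    have := sn.1 (u + t *: c) (v + s *: e)
      (subspaceD Wu (subspaceZ _ (CW _ Cc))) (subspaceD Wv (subspaceZ _ (CW _ Ce))).
    lra.
  move=> t u t0 Wu; rewrite mulrC -ler_pdivrMr//; apply: (le_p) => s c s0 Cc.
  rewrite ler_pdivrMr//.
  apply: (le_trans (p_le _ (t * s) c (subspaceZ _ Wu) (mulr_ge0 (ltW t0) s0) Cc)).
  rewrite -scalerA -scalerDr sn.2; last by exact: subspaceD (subspaceZ _ (CW _ Cc)).
  by rewrite gtr0_norm//; lra.
have [l ll lp] := hahn_banach hp.
have ln u : W u -> l u <= n u.
  move=> Wu; apply: (le_trans (lp _ Wu)).
  apply: (le_trans (p_le _ 0 c0 Wu (lexx 0) Cc0)).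
  by rewrite scale0r mul0r subr0 addr0.
have lN u : W u -> l (- u) = - l u.
  by move=> Wu; rewrite -[- u]scaleN1r (linear_onZ _ ll Wu) mulN1r.
exists l; split => //.
  move=> u Wu; rewrite ler_norml ln// andbT.
  have := ln (- u) (subspaceN Wu); rewrite (seminormN sn Wu) lN//; lra.
move=> c Cc; have Wc := CW _ Cc.
(* At [- c], the choice of [c] itself with weight 1 cancels the seminorm, so that
   [p (- c) <= - d]. *)
have := lp (- c) (subspaceN Wc); rewrite lN// => h.
have := le_trans h (p_le (- c) 1 c (subspaceN Wc) ler01 Cc).
rewrite scale1r addNr mul1r -{1}(scale0r c) sn.2// normr0 mul0r; lra.
Qed.

End subspace.

End hahn_banach.

(** * Reflexivity and energy closures of convex sets *)

Section reflexive_closure.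
Context {R : realType} {V : lmodType R}.
Variables (W W' : set V) (N : V -> \bar R) (n n0 : V -> R) (K : R).
Hypotheses (HW : W `<=` W') (HW' : linear_subspace W')
  (sn : seminorm_on W' n) (sn0 : seminorm_on W' n0) (K0 : 0 < K)
  (n0n : forall u, W' u -> n0 u <= n u)
  (n0_eq0 : forall u, W' u -> n0 u = 0 -> n u = 0)
  (Nn : forall u, W' u -> (N u <= (K * n u)%:E)%E)
  (nN : forall u, W' u -> ((n u)%:E <= K%:E * N u)%E)
  (WZ : forall a u, W u -> W (a *: u)).

Lemma dual_of_le_seminorm l : linear_on W' l ->
  (forall u, W' u -> `|l u| <= n u) -> dual W N l.
Proof.
move=> ll ln; split.
  by move=> a u v Wu Wv; apply: ll; exact: HW.
apply: (@le_lt_trans _ _ K%:E); last exact: ltry.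
apply: ge_ereal_sup => _ [u [Wu Nu] <-].
apply: (@le_trans _ _ (n u)%:E); first by rewrite lee_fin ln//; exact: HW.
apply: (le_trans (nN (HW Wu))).
by rewrite -[leRHS]mule1 lee_pmul2l ?lte_fin.
Qed.

(** [W] is the space assumed reflexive, [W'] a larger one on which [n], comparable to [N] up to the
    factor [K], is a seminorm. An ultrafilter limit replaces the extraction of a weakly convergent
    subsequence, which would call for the Eberlein-Smulian theorem. *)
Lemma reflexive_bounded_closure (v : nat -> V) (f : V) (C : set V) (M : R) :
  is_reflexive W N ->
  (forall k, W (v k)) -> (forall k, n (v k) <= M) -> W' f ->
  n0 (v k - f) @[k --> \oo] --> 0 ->
  C `<=` W' -> convex_on C -> (forall k, C (v k)) ->
  forall e, 0 < e -> exists2 c, C c & n (f - c) < e.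
Proof.
move=> refl Wv vM W'f vf CW Ccvx Cv e e0; apply: contrapT => /forall2NP noc.
have W'v k : W' (v k) by exact: HW.
(* Translating by [- f] turns a distance of at least [e] from [f] into the bound [e <= n] on a
   convex set, the form required by the separation. *)
pose C' := [set c - f | c in C].
have C'W : C' `<=` W' by move=> _ [c Cc <-]; apply: subspaceB => //; exact: CW.
have C'cvx : convex_on C'.
  move=> t _ _ t0 t1 [c Cc <-] [d Cd <-]; exists (t *: c + (1 - t) *: d).
    exact: Ccvx.
  rewrite !scalerBr addrACA -opprD -scalerDl; congr (_ - _).
  by rewrite (addrC t) subrK scale1r.
have C'e c : C' c -> e <= n c.
  move=> [d Cd <-]; have [//|/negP] := noc d.
  by rewrite -leNgt -opprB (seminormN sn)//; apply: subspaceB => //; exact: CW.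
have [l [ll ln le_l]] := convex_separation HW' sn C'W C'cvx
  (ex_intro _ _ (ex_intro2 _ _ _ (Cv 0%N) erefl)) C'e.
have [U [UU nbU]] := ultraFilterLemma (F := \oo) _.
have M0 : 0 <= M by apply: le_trans (vM 0%N); exact: seminorm_ge0 sn _.
(* [K * M] bounds [N (v k)]; the added 1 makes the constant positive, so that [v k] can be rescaled
   into the unit ball of [N]. *)
pose c0 := K * (M + 1).
have c0_gt0 : 0 < c0 by rewrite mulr_gt0//; lra.
have bnd lam : dual W N lam -> forall k, `|lam (v k)| <= c0 * fine (opnorm W N lam).
  move=> [llam olam] k; pose w := c0^-1 *: v k.
  have Ww : W w by exact: WZ.
  have Nw : (N w <= 1)%E.
    apply: (le_trans (Nn (HW Ww))); rewrite sn.2// lee_fin.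
    rewrite gtr0_norm ?invr_gt0//; have M1 : 0 < M + 1 by lra.
    have -> : K * (c0^-1 * n (v k)) = n (v k) / (M + 1).
      by rewrite /c0; field; rewrite ?gt_eqF.
    by rewrite ler_pdivrMr// mul1r; apply: le_trans (vM k) _; lra.
  have : (`|lam w|%:E <= opnorm W N lam)%E by apply: ereal_sup_ubound; exists w.
  have -> : v k = c0 *: w by rewrite scalerA mulfV ?gt_eqF// scale1r.
  have -> : lam (c0 *: w) = c0 * lam w.
    have Z0 : W 0 by rewrite -(scale0r w); exact: WZ.
    have e0' : lam 0 = 0.
      by have := llam 1 0 0 Z0 Z0; rewrite scaler0 addr0; lra.
    by have := llam c0 w 0 Ww Z0; rewrite addr0 e0' addr0.
  rewrite normrM gtr0_norm// ler_pM2l//.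
  move=> h; rewrite -lee_fin fineK//.
  rewrite fin_numE; apply/andP; split; last by rewrite lt_eqF.
  by apply/eqP => E; move: h; rewrite E.
have UF : ProperFilter U by exact: ultra_proper.
have cvgU lam : dual W N lam -> cvg (lam (v k) @[k --> U]).
  (* The values lie in a compact interval, and an ultrafilter converges to any of its cluster
     points. *)
  move=> dl; set B := c0 * fine (opnorm W N lam).
  have cB : compact `[- B, B]%classic by exact: segment_compact.
  have [|y [_ clu]] := cB ((lam \o v) @ U) _.
    apply: (@filterE _ U UF) => k /=; rewrite in_itv/= -ler_norml.
    exact: (bnd lam dl k).
  apply/cvg_ex; exists y => D nD.
  have [//|nD'] := in_ultra_setVsetC ((lam \o v) @^-1` D) UU.
  by have [z []] := clu (~` D) D nD' nD.
pose Phi lam : R := lim (lam (v k) @[k --> U]).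
have linPhi : linear_on (dual W N) Phi.
  move=> a l1 l2 d1 d2; apply/cvg_lim => //.
  apply: cvgD; last exact: cvgU.
  by apply: cvgMr; exact: cvgU.
have dPhi : dual (dual W N) (opnorm W N) Phi.
  split => //; apply: (@le_lt_trans _ _ c0%:E); last exact: ltry.
  apply: ge_ereal_sup => _ [lam [dlam /= lam1] <-]; rewrite lee_fin.
  have : `|lam (v k)| @[k --> U] --> `|Phi lam|.
    by apply: cvg_norm; exact: cvgU.
  move=> /cvgr_to_le; apply.
  apply: (@filterE _ U UF) => k; apply: (le_trans (bnd _ dlam k)).
  rewrite -[leRHS]mulr1 ler_pM2l//.
  move: lam1; case: (opnorm W N lam) => [r| |]//=; lra.
have [u Wu Phiu] := refl Phi dPhi.
have W'u := HW Wu.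
have W'uf : W' (u - f) by exact: subspaceB.
(* If [n0 (u - f)] were positive, a functional dominated by [n0] would separate [u - f] from 0. Its
   values at [v k] tend to its value at [f], while reflexivity makes the ultrafilter limit equal to
   its value at [u]. *)
have uf0 : n0 (u - f) = 0.
  apply/eqP/negPn/negP => uf_neq0.
  have uf_gt0 : 0 < n0 (u - f) by rewrite lt_neqAle eq_sym uf_neq0 (seminorm_ge0 HW' sn0).
  have [| | | |l0 [ll0 l0n l0uf]] := convex_separation (C := [set u - f]) (d := n0 (u - f)) HW' sn0.
  - by move=> _ ->.
  - by move=> t _ _ _ _ -> ->; rewrite /= -scalerDl (addrC t) subrK scale1r.
  - by exists (u - f).
  - by move=> _ ->.
  have dl0 : dual W N l0.
    by apply: dual_of_le_seminorm => // w Ww; apply: le_trans (l0n _ Ww) (n0n Ww).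
  have : l0 (v k - f) @[k --> \oo] --> 0.
    apply/cvgr0Pnorm_lt => d d0.
    near=> k; apply: le_lt_trans (l0n _ (subspaceB HW' (W'v k) W'f)) _.
    have -> : n0 (v k - f) = `|n0 (v k - f)|.
      by rewrite ger0_norm//; apply: (seminorm_ge0 HW' sn0); exact: subspaceB.
    near: k; move/cvgr0Pnorm_lt: vf; exact.
  move=> l0v; have l0U : l0 (v k) @[k --> U] --> l0 f.
    have -> : (fun k => l0 (v k)) = (fun k => l0 (v k - f) + l0 f).
      by apply/funext => k; rewrite (linear_onB ll0)// subrK.
    rewrite -[X in _ --> X]add0r; apply: cvgD; last exact: cvg_cst.
    by move=> D /l0v; exact: nbU.
  have := Phiu _ dl0; rewrite /Phi (cvg_lim _ l0U)// => l0fu.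
  have := l0uf _ erefl; rewrite (linear_onB ll0)// -l0fu subrr.
  by rewrite leNgt uf_gt0.
have luf : l u = l f.
  apply/eqP; rewrite -subr_eq0 -(linear_onB ll)// -normr_eq0 eq_le normr_ge0 andbT.
  by rewrite -(n0_eq0 W'uf uf0); exact: ln.
have dl := dual_of_le_seminorm ll ln.
(* The separation bound passes to the ultrafilter limit, where it contradicts [l u = l f]. *)
have : e + l f <= Phi l.
  apply: limr_ge; first exact: cvgU.
  apply: (@filterE _ U UF) => k; rewrite -lerBrDr -(linear_onB ll)//; apply: le_l.
  by exists (v k).
rewrite (Phiu _ dl) luf; lra.
Unshelve. all: by end_near. Qed.

End reflexive_closure.

(** * Curves *)

Section clamp.
Context {R : realType}.
Implicit Types t : R.

Definition clamp01 t : R := Num.max 0 (Num.min 1 t).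

Lemma clamp01_ge0 t : 0 <= clamp01 t. Proof. by rewrite le_max lexx. Qed.

Lemma clamp01_le1 t : clamp01 t <= 1.
Proof. by rewrite ge_max ler01 ge_min lexx. Qed.

Lemma clamp01_id t : 0 <= t -> t <= 1 -> clamp01 t = t.
Proof. by move=> t0 t1; rewrite /clamp01 min_r// max_r. Qed.

Lemma le_clamp01 : {homo clamp01 : s t / s <= t}.
Proof.
move=> s t st; rewrite /clamp01 ge_max !le_max lexx/=.
by apply/orP; right; rewrite le_min !ge_min lexx st orbT.
Qed.

Lemma continuous_clamp01 : continuous clamp01.
Proof.
move=> t; apply: continuous_max; first exact: cvg_cst.
by apply: continuous_min; [exact: cvg_cst|exact: cvg_id].
Qed.

Lemma clamp01_itvoc a b : `]a, b]%classic `&` `]0, 1]%classic =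
  `](clamp01 a), (clamp01 b)]%classic.
Proof.
apply/seteqP; split => x; rewrite /= !in_itv/= /clamp01.
- move=> [/andP[ax xb] /andP[x0 x1]].
  by rewrite gt_max x0 gt_min ax orbT/= le_max le_min x1 xb orbT.
- rewrite gt_max gt_min le_max le_min => /andP[/andP[x0 +] +].
  rewrite leNgt x0/= => + /andP[x1 xb].
  by rewrite ltNge x1/= => ->; rewrite xb.
Qed.

End clamp.

Section density_measure.
Context d (T : measurableType d) {R : realType} (mu : {measure set T -> \bar R}).
Variables (f : T -> \bar R) (mf : measurable_fun setT f) (f0 : forall x, (0 <= f x)%E).

(** The proofs of measurability and nonnegativity are arguments so that the term itself can carry
    the structure of a measure. *)
Definition density_measure & measurable_fun setT f & (forall x, (0 <= f x)%E) :=
  fun A => (\int[mu]_(x in A) f x)%E.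

Let den := density_measure mf f0.

Let den0 : den set0 = 0%E. Proof. exact: integral_set0. Qed.

Let den_ge0 A : (0 <= den A)%E. Proof. exact: integral_ge0. Qed.

Let den_sigma_additive : semi_sigma_additive den.
Proof. exact: semi_sigma_additive_nng_induced. Qed.

HB.instance Definition _ := isMeasure.Build _ _ _ (density_measure mf f0)
  den0 den_ge0 den_sigma_additive.

End density_measure.

(** * Absolutely continuous real functions: density and derivative *)

Section absolutely_continuous_fun.
Context {R : realType}.
Local Notation leb := (@lebesgue_measure R).
Variables (phi g : R -> R).
Hypotheses (gint : leb.-integrable `[0, 1] (EFin \o g))
  (phig : forall s t, 0 <= s -> s <= t -> t <= 1 ->
    (`|phi t - phi s|%:E <= \int[leb]_(x in `[s, t]) (g x)%:E)%E).

Let G : R -> R := (fun x => `|g x|) \_ `]0, 1].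

Let G0 x : 0 <= G x. Proof. by rewrite /G patchE; case: ifP. Qed.

Let Gint : leb.-integrable setT (EFin \o G).
Proof.
rewrite /G -restrict_EFin -integrable_mkcond//.
apply: (@integrableS _ _ _ leb `[0, 1]%classic) => //.
  exact: subset_itv_oc_cc.
exact: integrable_norm.
Qed.

(** [G] vanishes outside ]0, 1]; starting at -1 keeps 0 in the interior of the interval on which the
    primitive is known to be continuous. *)
Let H (t : R) : R := \int[leb]_(x in `[-1, t]) G x.

Let HB s t : -1 <= s -> s <= t -> H t - H s = \int[leb]_(x in `]s, t]) G x.
Proof.
move=> s1 st; rewrite /H Rintegral_itvB ?bnd_simp//.
exact: integrableS Gint.
Qed.

Let phiH s t : 0 <= s -> s <= t -> t <= 1 -> `|phi t - phi s| <= H t - H s.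
Proof.
move=> s0 st t1; rewrite HB//; last lra.
rewrite -lee_fin; apply: (le_trans (phig s0 st t1)).
have sub : `]s, t]%classic `<=` `[0, 1]%classic.
  by move=> x; rewrite /= !in_itv/= => /andP[? ?]; apply/andP; split; lra.
have sub' : `[s, t]%classic `<=` `[0, 1]%classic.
  by move=> x; rewrite /= !in_itv/= => /andP[? ?]; apply/andP; split; lra.
have gst : leb.-integrable `]s, t] (EFin \o g) by exact: integrableS gint.
rewrite /Rintegral fineK; last first.
  by apply: integrable_fin_num => //; exact: integrableS Gint.
rewrite -(@integral_itv_obnd_cbnd _ s (BRight t) (EFin \o g)); last first.
  exact: measurable_int gst.
apply: le_integral => //.
  by apply: integrableS Gint.
move=> x xst; rewrite /= lee_fin /G patchE ifT ?ler_norm//.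
  rewrite inE; move: xst; rewrite inE /= !in_itv/= => /andP[? ?].
  by apply/andP; split; lra.
Qed.

Let cH : continuous (H \o clamp01).
Proof.
move=> t; apply: continuous_comp; first exact: continuous_clamp01.
have Gint' : leb.-integrable `[-1, 2] (EFin \o G) by exact: integrableS Gint.
have := parameterized_integral_continuous (ltac:(lra) : -1 <= 2 :> R) Gint'.
move=> /continuous_within_itvP => /(_ ltac:(lra)) [+ _ _]; apply.
rewrite in_itv/=; have := clamp01_ge0 t; have := clamp01_le1 t.
by move=> ? ?; apply/andP; split; lra.
Qed.

Let cphi : continuous (phi \o clamp01).
Proof.
move=> t; apply/cvgrPdist_le => /= e e0.
have /cvgrPdist_le/(_ e e0) := @cH t; apply: filterS => s /=; apply: le_trans.
have [st|/ltW ts] := leP s t.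
  apply: (le_trans (phiH (clamp01_ge0 s) (le_clamp01 st) (clamp01_le1 t))).
  exact: ler_norm.
rewrite distrC [leRHS]distrC.
apply: (le_trans (phiH (clamp01_ge0 t) (le_clamp01 ts) (clamp01_le1 s))).
exact: ler_norm.
Qed.

(** [H] dominates the increments of [phi], so [phi + H] and [H - phi] are both nondecreasing. Their
    sum is [2 H], whence the Stieltjes measure of [f1] is at most the measure of density [2 G] and
    is absolutely continuous. *)
Let f1 t := phi (clamp01 t) + H (clamp01 t).
Let f2 t := H (clamp01 t) - phi (clamp01 t).
Let f3 t := f1 t + f2 t.

Let phiH' s t : s <= t ->
  `|phi (clamp01 t) - phi (clamp01 s)| <= H (clamp01 t) - H (clamp01 s).
Proof.
by move=> st; apply: phiH; [exact: clamp01_ge0|exact: le_clamp01|exact: clamp01_le1].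
Qed.

Let nd1 : {homo f1 : s t / s <= t}.
Proof. by move=> s t /phiH'; rewrite ler_norml /f1; lra. Qed.

Let nd2 : {homo f2 : s t / s <= t}.
Proof. by move=> s t /phiH'; rewrite ler_norml /f2; lra. Qed.

Let nd3 : {homo f3 : s t / s <= t}.
Proof. by move=> s t st; rewrite /f3 lerD ?nd1 ?nd2. Qed.

Let c1 : continuous f1.
Proof. by move=> t; apply: cvgD; [exact: cphi|exact: cH]. Qed.

Let c2 : continuous f2.
Proof. by move=> t; apply: cvgB; [exact: cH|exact: cphi]. Qed.

Let c3 : continuous f3.
Proof. by move=> t; apply: cvgD; [exact: c1|exact: c2]. Qed.

#[local] HB.instance Definition _ := isCumulative.Build R _ R f1 nd1 (right_continuousW c1).
#[local] HB.instance Definition _ := isCumulative.Build R _ R f2 nd2 (right_continuousW c2).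
#[local] HB.instance Definition _ := isCumulative.Build R _ R f3 nd3 (right_continuousW c3).

Let nu1 := lebesgue_stieltjes_measure f1.
Let nu2 := lebesgue_stieltjes_measure f2.
Let nu3 := lebesgue_stieltjes_measure f3.

Let lsE (f : cumulative R R) a b : a <= b ->
  lebesgue_stieltjes_measure f `]a, b] = (f b - f a)%:E.
Proof.
move=> ab; rewrite /lebesgue_stieltjes_measure /measure_extension measurable_mu_extE/=; last exact: is_ocitv.
by rewrite wlength_itv_bnd.
Qed.

Let ls0 (f : cumulative R R) a b : b <= a ->
  lebesgue_stieltjes_measure f `]a, b] = 0%E.
Proof. by move=> ba; rewrite set_itv_ge ?measure0// bnd_simp -leNgt. Qed.

Let mG2 : measurable_fun setT (fun x => (2 * G x)%:E).
Proof.
apply/measurable_EFinP; apply: measurable_funM => //.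
by apply/measurable_EFinP; exact: measurable_int Gint.
Qed.

Let G2_ge0 x : (0 <= (2 * G x)%:E)%E.
Proof. by rewrite lee_fin mulr_ge0. Qed.

Let mu := density_measure leb mG2 G2_ge0.

(** A Stieltjes measure is determined by half-open intervals; clamping the ends of such an interval
    cuts it to its part in ]0, 1], where [G] lives. *)
Let nu3_mu A : measurable A -> nu3 A = mu A.
Proof.
move=> mA; apply: lebesgue_stieltjes_measure_unique => //.
move=> _ [[a b] _ <-] /=.
have [ab|ba] := leP a b; last first.
  by rewrite ls0 ?ltW// /density_measure set_itv_ge ?integral_set0// bnd_simp -leNgt ltW.
rewrite lsE// /density_measure.
have -> : f3 b - f3 a = 2 * (H (clamp01 b) - H (clamp01 a)).
  by rewrite /f3 /f1 /f2; ring.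
rewrite HB; [|have := clamp01_ge0 a; lra|exact: le_clamp01].
rewrite -clamp01_itvoc EFinM.
have -> : (fun x : R => (2 * G x)%:E) = (fun x => 2%:E * (EFin \o G) x)%E by [].
rewrite integralZl//; last exact: integrableS Gint.
rewrite /Rintegral fineK; last first.
  apply: integrable_fin_num; first exact: measurableI.
  by apply: integrableS Gint => //; exact: measurableI.
congr (_ * _)%E; rewrite integral_mkcondr; apply: eq_integral => x _ /=.
by rewrite patchE; case: ifPn => // xn; rewrite /G patchE (negbTE xn).
Qed.

Let nu3_add A : measurable A -> nu3 A = (nu1 A + nu2 A)%E.
Proof.
move=> mA; rewrite -measure_addE.
apply: lebesgue_stieltjes_measure_unique => //.
move=> _ [[a b] _ <-]; rewrite [RHS]measure_addE /=.
have [ab|ba] := leP a b; last by rewrite /nu1 /nu2 !ls0 ?adde0// ltW.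
by rewrite /nu1 /nu2 !lsE// -EFinD /= /f3 opprD addrACA.
Qed.

Let nu1_le A : measurable A -> (nu1 A <= mu A)%E.
Proof. by move=> mA; rewrite -nu3_mu// nu3_add// leeDl. Qed.

Let nu1_fin : fin_num_fun nu1.
Proof.
apply: lty_fin_num_fun; apply: (le_lt_trans (nu1_le measurableT)).
rewrite /mu /density_measure.
have -> : (fun x : R => (2 * G x)%:E) = (fun x => 2%:E * (EFin \o G) x)%E by [].
rewrite integralZl// lte_mul_pinfty//; apply: integrable_lty => //.
Qed.

#[local] HB.instance Definition _ := Measure.on nu1.
#[local] HB.instance Definition _ := @Measure_isFinite.Build _ _ _ nu1 nu1_fin.

Let nu1_dom : nu1 `<< leb.
Proof.
move=> A A0 B mB BA.
apply/eqP; rewrite eq_le measure_ge0 andbT; apply: (le_trans (nu1_le mB)).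
rewrite /mu /density_measure null_set_integral//; first exact: measurable_funTS.
exact: A0.
Qed.

(** Radon-Nikodym gives the Stieltjes measure of [f1] a density; subtracting [G] gives a density for
    the increments of [phi], and Lebesgue differentiation of its primitive gives the derivative. *)
Lemma ac_fun_representation : exists rho : R -> R,
  [/\ leb.-integrable setT (EFin \o rho),
    forall s t, 0 <= s -> s <= t -> t <= 1 ->
      phi t - phi s = \int[leb]_(x in `]s, t]) rho x &
    {ae leb, forall x, 0 < x < 1 ->
      h^-1 * (phi (h + x) - phi x) @[h --> 0^'] --> rho x}].
Proof.
pose f := Radon_Nikodym_SigmaFinite.f nu1 leb.
have ffin x : f x \is a fin_num by exact: Radon_Nikodym_SigmaFinite.f_fin_num.
have fint : leb.-integrable setT (EFin \o (fine \o f)).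
  apply: eq_integrable (Radon_Nikodym_SigmaFinite.f_integrable nu1_dom) => //.
  by move=> x _ /=; rewrite fineK.
pose rho (x : R) : R := fine (f x) - G x.
have rhoint : leb.-integrable setT (EFin \o rho) 
  by exact: (integrableB measurableT fint Gint).
have rhoE s t : 0 <= s -> s <= t -> t <= 1 ->
    phi t - phi s = \int[leb]_(x in `]s, t]) rho x.
  move=> s0 st t1; rewrite RintegralB//; [|exact: integrableS fint|exact: integrableS Gint].
  rewrite -HB//; last lra.
  have : nu1 `]s, t]%classic = (f1 t - f1 s)%:E by exact: lsE.
  rewrite (Radon_Nikodym_SigmaFinite.f_integral nu1_dom)// => f1E.
  have -> : \int[leb]_(x in `]s, t]) (fine (f x)) = f1 t - f1 s.
    rewrite /Rintegral -[RHS]/(fine (f1 t - f1 s)%:E) -f1E; congr fine.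
    by apply: eq_integral => x _; rewrite fineK.
  by rewrite /f1 !clamp01_id//; lra.
exists rho; split => //.
pose F x := \int[leb]_(t in [set` `]-oo, x]]) rho t.
have FB s t : s <= t -> F t - F s = \int[leb]_(x in `]s, t]) rho x.
  by move=> st; rewrite /F Rintegral_itvB ?bnd_simp//; exact: integrableS rhoint.
have phiF s t : 0 <= s -> s <= 1 -> 0 <= t -> t <= 1 -> phi t - phi s = F t - F s.
  move=> s0 s1 t0 t1; have [st|/ltW ts] := leP s t; first by rewrite FB// rhoE.
  by apply: oppr_inj; rewrite !opprB rhoE// FB.
have := @FTC1Ny _ rho.
have rhoy y : leb.-integrable `]-oo, y] (EFin \o rho) by exact: integrableS rhoint.
move=> /(_ rhoy).
move=> /(_ (open_integrable_locally openT rhoint)).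
apply: filterS; first exact: (ae_filter_ringOfSetsType leb).
move=> x [dF Fx] /andP[x0 x1].
have : h^-1 *: ((F \o shift x) (h *: 1) - F x) @[h --> 0^'] --> rho x.
  by rewrite -Fx derive1E.
apply: cvg_trans; apply: near_eq_cvg.
(* For smaller steps [h + x] stays in [0, 1], where [phi] and the primitive [F] have the same
   increments. *)
have xd : 0 < Num.min x (1 - x) by rewrite lt_min x0; lra.
near=> h.
have : `|h| < Num.min x (1 - x) by near: h; exact: dnbhs0_lt.
rewrite lt_min !ltr_norml => /andP[/andP[? ?] /andP[? ?]].
by rewrite /= [h *: 1]mulr1 phiF//; lra.
Unshelve. all: by end_near. Qed.

End absolutely_continuous_fun.

Section ae_mono.
Context d (T : measurableType d) {R : realType} (mu : {measure set T -> \bar R}).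
Implicit Types P Q S U : T -> Prop.

Lemma ae_mono P Q : (forall x, P x -> Q x) ->
  {ae mu, forall x, P x} -> {ae mu, forall x, Q x}.
Proof. by move=> PQ; apply: filterS. Qed.

Lemma ae_mono2 P Q S : (forall x, P x -> Q x -> S x) ->
  {ae mu, forall x, P x} -> {ae mu, forall x, Q x} -> {ae mu, forall x, S x}.
Proof. by move=> PQS; apply: filterS2. Qed.

Lemma ae_mono3 P Q S U : (forall x, P x -> Q x -> S x -> U x) ->
  {ae mu, forall x, P x} -> {ae mu, forall x, Q x} -> {ae mu, forall x, S x} ->
  {ae mu, forall x, U x}.
Proof. by move=> PQS; apply: filterS3. Qed.

End ae_mono.

Section ge0_integral_nonmeasurable.
Context d (T : measurableType d) {R : realType} (mu : {measure set T -> \bar R}).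
Local Open Scope ereal_scope.
Import HBNNSimple.

(* No measurability: the integral of a nonnegative function is the supremum of
   the integrals of the simple functions below it. *)
Lemma ge0_le_integral_ae (D : set T) (f g : T -> \bar R) : measurable D ->
  (forall x, 0 <= f x) -> (forall x, 0 <= g x) ->
  {ae mu, forall x, D x -> f x <= g x} ->
  \int[mu]_(x in D) f x <= \int[mu]_(x in D) g x.
Proof.
move=> mD f0 g0 [N [mN N0 fgN]].
rewrite !ge0_integralE//; apply: ge_ereal_sup => _ [h hf <-].
have mCN : measurable (~` N) by exact: measurableC.
rewrite -integralT_nnsfun.
(* Setting [h] to 0 on the exceptional null set keeps its integral and makes it a simple function
   below [g] everywhere. *)
have -> : \int[mu]_x (h x)%:E = \int[mu]_x (proj_nnsfun h mCN x)%:E.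
  apply: ge0_ae_eq_integral => //.
  - exact/measurable_EFinP.
  - exact/measurable_EFinP.
  - by move=> x _; rewrite lee_fin.
  - by move=> x _; rewrite lee_fin.
  - exists N; split => // x /= hx; apply: contrapT => Nx; apply: hx => _.
    by rewrite /= mindicE mem_set// mulr1.
rewrite integralT_nnsfun; apply: ereal_sup_ubound; exists (proj_nnsfun h mCN) => //= x.
rewrite mindicE; have [xN|xN] := pselect (N x).
  by rewrite memNset ?mulr0 ?erestrict_ge0//; exact.
rewrite mem_set// mulr1; apply: (le_trans (hf x)).
rewrite !patchE; case: ifPn => // Dx.
apply: contrapT => /negP fg; apply: xN; apply: fgN => /=.
by apply/not_implyP; split; [rewrite inE in Dx|exact/negP].
Qed.

Lemma ge0_eq_integral_ae (D : set T) (f g : T -> \bar R) : measurable D ->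
  (forall x, 0 <= f x) -> (forall x, 0 <= g x) ->
  {ae mu, forall x, D x -> f x = g x} ->
  \int[mu]_(x in D) f x = \int[mu]_(x in D) g x.
Proof.
move=> mD f0 g0 fg; apply/eqP; rewrite eq_le; apply/andP; split;
  apply: ge0_le_integral_ae => //; apply: filterS fg => x h Dx;
  by rewrite h.
Qed.

End ge0_integral_nonmeasurable.

Section primitive.
Context {R : realType}.
Local Notation leb := (@lebesgue_measure R).

Lemma primitive_differentiable (f : R -> R) :
  leb.-integrable setT (EFin \o f) ->
  {ae leb, forall x, h^-1 * (\int[leb]_(t in `]-oo, h + x]) f t -
    \int[leb]_(t in `]-oo, x]) f t) @[h --> 0^'] --> f x}.
Proof.
move=> fint; have fy y : leb.-integrable `]-oo, y] (EFin \o f) by exact: integrableS fint.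
have := FTC1Ny fy (open_integrable_locally openT fint).
apply: filterS; first exact: (ae_filter_ringOfSetsType leb).
move=> x [dF Fx]; rewrite -Fx derive1E.
apply: cvg_trans dF; apply: near_eq_cvg; apply: nearW => h /=.
by rewrite [h *: 1]mulr1.
Qed.

Lemma primitiveB (f : R -> R) s t : leb.-integrable setT (EFin \o f) -> s <= t ->
  \int[leb]_(x in `]-oo, t]) f x - \int[leb]_(x in `]-oo, s]) f x =
  \int[leb]_(x in `]s, t]) f x.
Proof.
by move=> fint st; rewrite Rintegral_itvB ?bnd_simp//; exact: integrableS fint.
Qed.

End primitive.

(** * Metric derivative of an absolutely continuous curve *)

Section metric_derivative.
Context {R : realType} {X : completeMetricType R}.
Local Notation leb := (@lebesgue_measure R).

Lemma ler_mdistB (x y z : X) : `|mdist x z - mdist y z| <= mdist x y.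
Proof.
rewrite ler_norml; have := metric_triangle x y z; have := metric_triangle y x z.
rewrite (metric_sym y x); lra.
Qed.

Lemma dense_seq : separable_space X ->
  exists x_ : nat -> X, forall x (e : R), 0 < e -> exists n, mdist x (x_ n) < e.
Proof.
move=> [D cD dD].
have [z Dz] : D !=set0.
  by have [|z [_ Dz]] := dD setT _ openT; [exists point|exists z].
have [f Df] : exists f : nat -> X, D `<=` range f.
  have /pcard_surjP[f fs] := cD; exists f.
  move=> y /fs [n _ <-]; by exists n.
exists f => x e e0.
have [|y [xy Dy]] := dD (ball x e)^° _ (@open_interior _ _).
  by exists x; exact: nbhsx_ballx.
have [n _ fn] := Df _ Dy; exists n; rewrite fn.
by move/interior_subset: xy; rewrite ballEmdist.
Qed.

(** The distances [phi n] from the curve to the points of a dense sequence are real absolutely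
    continuous functions, and the speed is the supremum of the moduli of their derivatives. Each
    [phi n] bounds the difference quotient from below by the triangle inequality; density of the
    points makes the integral of the supremum bound it from above. *)
Lemma metric_derivative (c : curve X) : separable_space X ->
  absolutely_continuous_curve c ->
  exists m : R -> R, [/\ leb.-integrable setT (EFin \o m), forall t, 0 <= m t,
    forall s t, 0 <= s -> s <= t -> t <= 1 ->
      mdist (c s) (c t) <= \int[leb]_(x in `]s, t]) m x &
    {ae leb, forall t, 0 < t < 1 ->
      mdist (c t) (c (t + h)) / `|h| @[h --> 0^'] --> m t}].
Proof.
move=> sepX [g gint cg].
have [x_ x_dense] := dense_seq sepX.
pose g' x := `|g x|.
have g'int : leb.-integrable `[0, 1] (EFin \o g') by exact: integrable_norm.
pose phi n t := mdist (c t) (x_ n).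
have phi_c n s t : `|phi n t - phi n s| <= mdist (c s) (c t).
  by rewrite metric_sym; exact: ler_mdistB.
have phig n s t : 0 <= s -> s <= t -> t <= 1 ->
    (`|phi n t - phi n s|%:E <= \int[leb]_(x in `[s, t]) (g x)%:E)%E.
  move=> s0 st t1; apply: le_trans (cg s t s0 st t1).
  by rewrite lee_fin.
have /choice [rho rhoP] n := ac_fun_representation gint (phig n).
pose G := (fun x => `|g x|) \_ `[0, 1].
have Gint : leb.-integrable setT (EFin \o G).
  by rewrite /G -restrict_EFin -integrable_mkcond.
have G0 x : 0 <= G x by rewrite /G patchE; case: ifP.
pose FG x := \int[leb]_(t in `]-oo, x]) G t.
have ltr1 : (0 < 1 :> R) by [].
have phiFG n s t : 0 <= s -> s <= 1 -> 0 <= t -> t <= 1 -> `|phi n t - phi n s| <= `|FG t - FG s|.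
  wlog st : s t / s <= t => [hw s0 s1 t0 t1|s0 s1 t0 t1].
    have [/hw|/ltW ts] := leP s t; first exact.
    by rewrite distrC [leRHS]distrC; apply: hw.
  rewrite /FG primitiveB// [leRHS]ger0_norm; last exact: Rintegral_ge0.
  rewrite -lee_fin; apply: (le_trans (phig n s t s0 st t1)).
  have sub : `[s, t]%classic `<=` `[0, 1]%classic.
    by move=> x; rewrite /= !in_itv/= => /andP[? ?]; apply/andP; split; lra.
  have gst : leb.-integrable `[s, t] (EFin \o g) by exact: integrableS gint.
  have Gst : leb.-integrable `[s, t] (EFin \o G) by exact: integrableS Gint.
  rewrite Rintegral_itv_obnd_cbnd; last exact: integrableS Gint.
  rewrite /Rintegral fineK; last by apply: integrable_fin_num => //.
  apply: le_integral => // x xst; rewrite lee_fin /G patchE ifT ?ler_norm//.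
  by rewrite inE; apply: sub; rewrite inE in xst.
pose m' t : \bar R := esups (fun n => `|rho n t|%:E) 0.
have rho_m' n t : (`|rho n t|%:E <= m' t)%E by apply: ereal_sup_ubound; exists n.
(* The minimum with [G] and the restriction to ]0, 1[ make [m] finite and integrable outright; that
   it equals the supremum [m'] almost everywhere is shown afterwards. *)
pose m : R -> R := (fun t => Num.min (fine (m' t)) (G t)) \_ `]0, 1[.
have m0 t : 0 <= m t.
  rewrite /m patchE; case: ifP => // _; rewrite le_min G0 andbT fine_ge0//.
  exact: le_trans (rho_m' 0%N t).
have mG t : m t <= G t by rewrite /m patchE; case: ifP => // _; rewrite ge_min lexx orbT.
have mm' : measurable_fun setT m'.
  apply: measurable_fun_esups => n; apply/measurable_EFinP.
  apply: measurableT_comp => //; have [rint _ _] := rhoP n.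
  by apply/measurable_EFinP; exact: measurable_int rint.
have mm : measurable_fun setT m.
  apply/(measurable_restrictT _ _).1 => //; apply: measurable_funTS.
  apply: measurable_minr; last by apply/measurable_EFinP; exact: measurable_int Gint.
  exact: measurableT_comp.
have mint : leb.-integrable setT (EFin \o m).
  apply: le_integrable Gint => //; first exact/measurable_EFinP.
  by move=> t _ /=; rewrite lee_fin !ger0_norm.
(* The difference quotients of [phi n] are bounded by those of the primitive [FG], so the
   derivatives compare wherever all of them exist. *)
have rhoG : {ae leb, forall t, 0 < t < 1 -> forall n, `|rho n t| <= G t}.
  have : {ae leb, forall t, forall n, 0 < t < 1 ->
      h^-1 * (phi n (h + t) - phi n t) @[h --> 0^'] --> rho n t}.
    by apply: ae_foralln => n; have [] := rhoP n.
  have := primitive_differentiable Gint.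
  apply: filterS2; first exact: (ae_filter_ringOfSetsType leb).
  move=> t FGt phit t01 n.
  have A : `|h^-1 * (phi n (h + t) - phi n t)| @[h --> 0^'] --> `|rho n t|.
    by apply: cvg_norm; exact: phit.
  have B : `|h^-1 * (FG (h + t) - FG t)| @[h --> 0^'] --> `|G t|.
    by apply: cvg_norm; exact: FGt.
  rewrite -[leRHS]ger0_norm//; apply: (ler_cvg_to A B).
  have td : 0 < Num.min t (1 - t) by rewrite lt_min; lra.
  near=> h; rewrite !normrM ler_wpM2l//.
  have : `|h| < Num.min t (1 - t) by near: h; exact: dnbhs0_lt.
  by rewrite lt_min !ltr_norml => /andP[/andP[? ?] /andP[? ?]]; apply: phiFG; lra.
have m'm : {ae leb, forall t, 0 < t < 1 -> m' t = (m t)%:E}.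
  apply: ae_mono rhoG => t h t01.
  have m'G : (m' t <= (G t)%:E)%E by apply: ge_ereal_sup => _ [n _ <-]; rewrite lee_fin h.
  have m'fin : m' t \is a fin_num.
    rewrite ge0_fin_numE; first exact: le_lt_trans m'G (ltry _).
    exact: le_trans (rho_m' 0%N t).
  rewrite /m patchE mem_set/= ?in_itv//= min_l ?fineK// -lee_fin fineK//.
pose FM x := \int[leb]_(t in `]-oo, x]) m t.
have phiFM n s t : 0 <= s -> s <= t -> t <= 1 -> `|phi n t - phi n s| <= FM t - FM s.
  move=> s0 st t1; have [rint rE _] := rhoP n.
  rewrite rE// primitiveB//.
  have rst : leb.-integrable `]s, t] (EFin \o rho n) by exact: integrableS rint.
  apply: (le_trans (le_normr_Rintegral _ rst)) => //.
  rewrite /Rintegral fine_le//.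
  - by apply: integrable_fin_num => //; exact: integrable_norm.
  - by apply: integrable_fin_num => //; exact: integrableS mint.
  apply: ge0_le_integral_ae => //.
  have ae1 : {ae leb, forall x, x != 1 :> R}.
    exists [set 1]; split => //; first by rewrite lebesgue_measure_set1.
    by move=> x /= /negP; rewrite negbK => /eqP.
  apply: ae_mono2 ae1 m'm => x x1 m'x; rewrite /= in_itv/= => /andP[sx xt].
  rewrite -m'x; first exact: rho_m'.
  by rewrite (le_lt_trans s0 sx)/= lt_neqAle x1 (le_trans xt t1).
have cFM s t : 0 <= s -> s <= t -> t <= 1 -> mdist (c s) (c t) <= FM t - FM s.
  move=> s0 st t1; apply/ler_addgt0Pl => e e0.
  (* With the point within [e / 2] of [c t], the decrease [phi n s - phi n t] falls short of the
     distance from [c s] to [c t] by at most twice [phi n t], hence by less than [e]. *)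
  have [n xn] := x_dense (c t) (e / 2) ltac:(lra).
  have := phiFM n s t s0 st t1; rewrite ler_norml => /andP[+ _].
  have := metric_triangle (c s) (x_ n) (c t).
  rewrite (metric_sym (x_ n)) /phi; lra.
have cFM' s t : 0 <= s -> s <= 1 -> 0 <= t -> t <= 1 -> mdist (c s) (c t) <= `|FM t - FM s|.
  move=> s0 s1 t0 t1; have [st|/ltW ts] := leP s t.
    by apply: (le_trans (cFM s t s0 st t1)); exact: ler_norm.
  by rewrite metric_sym distrC; apply: (le_trans (cFM t s t0 ts s1)); exact: ler_norm.
exists m; split => //.
  by move=> s t s0 st t1; rewrite -primitiveB//; exact: cFM.
have phid : {ae leb, forall t, forall n, 0 < t < 1 ->
    h^-1 * (phi n (h + t) - phi n t) @[h --> 0^'] --> rho n t}.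
  by apply: ae_foralln => n; have [] := rhoP n.
have := primitive_differentiable mint.
apply: ae_mono3 phid m'm => t phit m't FMt t01; apply/cvgrPdist_le => e e0.
(* One [phi n] whose derivative nearly attains the supremum suffices: the metric quotient is
   squeezed between its quotient and that of the primitive [FM]. *)
have [n rn] : exists n, m t - e / 2 < `|rho n t|.
  apply: contrapT => /forallNP nr.
  have : (m' t <= (m t - e / 2)%:E)%E.
    by apply: ge_ereal_sup => _ [n _ <-]; rewrite lee_fin leNgt; exact/negP.
  rewrite m't// lee_fin; lra.
have A : `|h^-1 * (phi n (h + t) - phi n t)| @[h --> 0^'] --> `|rho n t|.
  by apply: cvg_norm; exact: phit.
have B : `|h^-1 * (FM (h + t) - FM t)| @[h --> 0^'] --> `|m t|.
  by apply: cvg_norm; exact: FMt.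
move/cvgrPdist_le : A => /(_ (e / 2) ltac:(lra)) A.
move/cvgrPdist_le : B => /(_ e e0) B.
have td : 0 < Num.min t (1 - t) by rewrite lt_min; lra.
near=> h.
have : `|h| < Num.min t (1 - t) by near: h; exact: dnbhs0_lt.
rewrite lt_min !ltr_norml => /andP[/andP[? ?] /andP[? ?]].
have h0 : 0 < `|h| by rewrite normr_gt0; near: h; exact: nbhs_dnbhs_neq.
have : `| `|rho n t| - `|h^-1 * (phi n (h + t) - phi n t)| | <= e / 2 by near: h.
have : `| `|m t| - `|h^-1 * (FM (h + t) - FM t)| | <= e by near: h.
rewrite !normrM normrV ?unitfE -?normr_gt0// (ger0_norm (m0 t)).
have /(ler_wpM2l (ltac:(rewrite invr_ge0 ltW//) : 0 <= `|h|^-1)) := phi_c n t (h + t).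
have /(ler_wpM2l (ltac:(rewrite invr_ge0 ltW//) : 0 <= `|h|^-1)) :=
  cFM' t (h + t) ltac:(lra) ltac:(lra) ltac:(lra) ltac:(lra).
rewrite (addrC t) !ler_norml (mulrC (mdist _ _)).
set a := _ * `|FM _ - _|; set b := _ * mdist _ _; set d := _ * `|phi _ _ - _|.
move=> ab db /andP[? ?] /andP[? ?]; apply/andP; split; lra.
Unshelve. all: by end_near. Qed.

End metric_derivative.

(** * Measurability on the space of curves *)

Section borel_measurability.
Context {R : realType}.

Lemma borel_measurable_open (T : ptopologicalType) (A : set T) :
  open A -> measurable (A : set (borel T)).
Proof. by move=> oA; exact: sub_sigma_algebra. Qed.

Lemma borel_continuous_measurable (T U : ptopologicalType) (f : T -> U) :
  continuous f -> measurable_fun setT (f : borel T -> borel U).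
Proof.
move=> /continuousP cf; apply: (@measurability _ _ (borel T) (borel U) setT f open erefl) => _ [B oB <-].
by rewrite setTI; apply: borel_measurable_open; exact: cf.
Qed.

Lemma borel_continuous_measurable_real (T : ptopologicalType) (f : T -> R) :
  continuous f -> measurable_fun setT (f : borel T -> R).
Proof.
move=> /continuousP cf; apply: (measurability _ (RGenOpens.measurableE R)).
move=> _ [_ [a [b ->] <-]].
by rewrite setTI; apply: borel_measurable_open; apply: cf; exact: interval_open.
Qed.

(** Rounding the time down to the grid of mesh [n.+1%:R^-1] leaves countably many measurable pieces,
    one for each grid point, and continuity in time recovers [F] as the mesh tends to 0. *)
Lemma caratheodory_measurable d (T : measurableType d) (F : T -> R -> R) :
  (forall t, measurable_fun setT (F ^~ t)) -> (forall x, continuous (F x)) ->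
  measurable_fun setT (fun z : T * measurableTypeR R => F z.1 z.2).
Proof.
move=> mF cF.
pose r n (t : R) : R := (Num.floor (n.+1%:R * t))%:~R / n.+1%:R.
apply: (@measurable_fun_cvg _ _ _ setT
  (fun n (z : T * measurableTypeR R) => F z.1 (r n z.2))); last first.
  move=> [x t] _ /=.
  suff rt : r n t @[n --> \oo] --> (t : R) by exact: (cvg_comp _ _ rt (cF x t)).
  apply/cvgrPdist_le => e e0; near=> n.
  have n0 : 0 < n.+1%:R :> R by rewrite ltr0n.
  have ne : n.+1%:R^-1 <= e by apply: ltW; near: n; exact: near_infty_natSinv_lt (PosNum e0).
  have /andP[fl fu] := floor_itv (n.+1%:R * t).
  rewrite intrD1 in fu.
  apply: le_trans ne; rewrite /r ger0_norm.
    by rewrite lerBlDr -[X in X + _]mul1r -mulrDl ler_pdivlMr// mulrC addrC ltW.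
  by rewrite subr_ge0 ler_pdivrMr// (mulrC (t : R)).
move=> n _ Y mY; rewrite setTI.
have n0 : 0 < n.+1%:R :> R by rewrite ltr0n.
pose D (k : int) : set (T * measurableTypeR R) :=
  ((F ^~ (k%:~R / n.+1%:R)) @^-1` Y) `*`
  [set` `[k%:~R / n.+1%:R, (k%:~R + 1) / n.+1%:R[].
rewrite (_ : _ @^-1` _ = \bigcup_k D k).
  apply: countable_bigcupT_measurable; first exact: countableP.
  move=> k; apply: measurableX => //.
  by rewrite -[X in measurable X]setTI; exact: mF.
apply/seteqP; split=> -[x t] /=.
  move=> Yx; exists (Num.floor (n.+1%:R * t)) => //; split => //=.
  have /andP[fl fu] := floor_itv (n.+1%:R * t).
  rewrite intrD1 in fu.
  by rewrite in_itv/= ler_pdivrMr// ltr_pdivlMr// (mulrC (t : R)) fl fu.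
move=> [k _ [/= Yx]]; rewrite in_itv/= ler_pdivrMr// ltr_pdivlMr// => /andP[kl ku].
suff -> : r n t = k%:~R / n.+1%:R by [].
rewrite /r; congr (_%:~R / _); apply: floor_def.
by rewrite (mulrC _ (t : R)) kl intrD1 ku.
Unshelve. all: by end_near. Qed.

End borel_measurability.

Section curve_measurability.
Context {R : realType} {X : completeMetricType R}.
Local Notation leb := (@lebesgue_measure R).
Local Notation I01 := (`[(0 : R), (1 : R)]%classic).

Lemma curve_clamp01 (c : curve X) t : c t = c (clamp01 t).
Proof. exact: curve_clamp. Qed.

(** The topology of curves sees only the times in [0, 1], so the time of evaluation is clamped
    first. *)
Lemma continuous_eval (t : R) : continuous (fun c : curve X => c t).
Proof.
rewrite (_ : (fun c => _) = (fun c : curve X => c (clamp01 t))); last first.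
  by apply/funext => c; rewrite curve_clamp01.
have t01 : I01 (clamp01 t) by rewrite /= in_itv/= clamp01_ge0 clamp01_le1.
move=> c P; rewrite -[in X in X -> _]nbhs_entourageE => -[E entE EP].
have : nbhs (curve_uniform c) [set h : {uniform` I01 -> X} | P (h (clamp01 t))].
  apply/uniform_nbhs; exists E; split => // h Eh.
  by apply: EP; apply/xsectionP; exact: Eh.
by move/(@initial_continuous _ _ (@curve_uniform R X)).
Qed.

Lemma measurable_eval (t : R) :
  measurable_fun setT (eval_curve t : borel (curve X) -> borel X).
Proof. by apply: borel_continuous_measurable; exact: continuous_eval. Qed.

Lemma continuous_mdist (T : topologicalType) (f g : T -> X) :
  continuous f -> continuous g -> continuous (fun x => mdist (f x) (g x)).
Proof.
move=> cf cg x; apply/cvgrPdist_le => e e0.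
have e2 : 0 < e / 2 by lra.
have A : \forall y \near x, mdist (f x) (f y) <= e / 2.
  exact: (metricType_numDomainType.cvgr_dist_le (cf x) e2).
have B : \forall y \near x, mdist (g x) (g y) <= e / 2.
  exact: (metricType_numDomainType.cvgr_dist_le (cg x) e2).
apply: filterS2 A B => y fxy gxy.
have := ler_mdistB (f x) (f y) (g x); have := ler_mdistB (g x) (g y) (f y).
rewrite !(metric_sym _ (f y)) !ler_norml => /andP[? ?] /andP[? ?]; rewrite (metric_sym (f x)) in fxy.
by apply/andP; split; lra.
Qed.

(* Agrees with the metric speed almost everywhere along an absolutely continuous
   curve, and, unlike it, is measurable in [(c, t)] by construction. *)
Definition mspeed (c : curve X) (t : R) : \bar R :=
  limn_esup (fun n => (mdist (c t) (c (t + n.+1%:R^-1)) / n.+1%:R^-1)%:E).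

Lemma mspeed_ge0 c t : (0 <= mspeed c t)%E.
Proof.
rewrite /mspeed limn_esup_lim; apply: lime_ge.
  exact: is_cvg_esups.
apply: nearW => n; apply: le_ereal_sup_tmp.
exists (mdist (c t) (c (t + n.+1%:R^-1)) / n.+1%:R^-1)%:E; first by exists n => /=.
by rewrite lee_fin divr_ge0// mdist_ge0.
Qed.

Lemma measurable_mspeed : measurable_fun setT
  (fun z : borel (curve X) * measurableTypeR R => mspeed z.1 z.2).
Proof.
apply: measurable_fun_limn_esup => n; apply/measurable_EFinP.
apply: measurable_funM => //.
apply: (@caratheodory_measurable _ _ _ (fun (c : borel (curve X)) t =>
  mdist ((c : curve X) t) ((c : curve X) (t + n.+1%:R^-1)))).
  move=> t; apply: borel_continuous_measurable_real.
  by apply: continuous_mdist; exact: continuous_eval.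
move=> c; apply: continuous_mdist; first exact: curve_continuous.
move=> t; apply: (@continuous_comp _ _ _ (fun x : R => x + n.+1%:R^-1) (c : curve X)).
  by apply: cvgD; [exact: cvg_id|exact: cvg_cst].
exact: curve_continuous.
Qed.

Lemma metric_speed_ge0 (c : curve X) t : (0 <= metric_speed c t)%E.
Proof.
rewrite /metric_speed; set F := fun h => _.
have [cF|ncF] := pselect (cvg (F h @[h --> 0^'])); last by rewrite dvgP.
apply: lime_ge => //; apply: nearW => h.
by rewrite lee_fin divr_ge0// mdist_ge0.
Qed.

(** A limit over all small steps is inherited by the particular steps [n.+1%:R^-1], where the limsup
    is then a limit. *)
Lemma metric_speedE (c : curve X) t (v : R) :
  mdist (c t) (c (t + h)) / `|h| @[h --> 0^'] --> v ->
  metric_speed c t = v%:E /\ mspeed c t = v%:E.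
Proof.
move=> cv; split; first by apply/cvg_lim => //; apply: cvg_EFin; [exact: nearW|exact: cv].
have H : (mdist (c t) (c (t + n.+1%:R^-1)) / n.+1%:R^-1)%:E @[n --> \oo] --> v%:E.
  apply: cvg_EFin; first exact: nearW.
  have H0 : n.+1%:R^-1 @[n --> \oo] --> (0 : R)^'.
    move=> P /= [e e0 eP]; change (\forall n \near \oo, P (n.+1%:R^-1)).
    near=> n; apply: eP; rewrite /= ?gt_eqF//.
    rewrite sub0r normrN ger0_norm//.
    by near: n; exact: near_infty_natSinv_lt (PosNum e0).
  have := cvg_comp _ _ H0 cv.
  apply: cvg_trans; apply: near_eq_cvg; apply: nearW => n /=.
  by rewrite ger0_norm.
rewrite /mspeed is_cvg_limn_esupE; first exact/cvg_lim.
by apply/cvg_ex; exists v%:E.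
Unshelve. all: by end_near. Qed.

Lemma metric_speed_ae (c : curve X) : separable_space X ->
  absolutely_continuous_curve c ->
  exists m : R -> R, [/\ leb.-integrable setT (EFin \o m), forall t, 0 <= m t,
    forall s t, 0 <= s -> s <= t -> t <= 1 ->
      mdist (c s) (c t) <= \int[leb]_(x in `]s, t]) m x &
    {ae leb, forall t, I01 t ->
      metric_speed c t = (m t)%:E /\ mspeed c t = (m t)%:E}].
Proof.
move=> sepX cac; have [m [mint m0 md mlim]] := metric_derivative sepX cac.
exists m; split => //.
have ae1 : {ae leb, forall x, x != 1 :> R}.
  exists [set 1]; split => //; first by rewrite lebesgue_measure_set1.
  by move=> x /= /negP; rewrite negbK => /eqP.
have ae0 : {ae leb, forall x, x != 0 :> R}.
  exists [set 0]; split => //; first by rewrite lebesgue_measure_set1.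
  by move=> x /= /negP; rewrite negbK => /eqP.
apply: ae_mono3 ae1 ae0 mlim => t t1 t0 tlim; rewrite /= in_itv/= => /andP[le0t let1].
by apply/metric_speedE/tlim; rewrite !lt_neqAle eq_sym t0 t1 le0t.
Qed.

(* Stopping at the ends of [s, t] keeps the time marginals of a test plan under
   control, as it replaces the time [r] by a time in [s, t]. *)
Definition stop_time (s t r : R) : R := Num.max s (Num.min t r).

Lemma continuous_stop_time s t : continuous (stop_time s t).
Proof.
move=> r; apply: continuous_max; first exact: cvg_cst.
by apply: continuous_min; [exact: cvg_cst|exact: cvg_id].
Qed.

Section stop_curve.
Variables (s t : R) (s0 : 0 <= s) (st : s <= t) (t1 : t <= 1).

Lemma stop_time_itv r : s <= stop_time s t r <= t.
Proof. by rewrite /stop_time le_max lexx ge_max st ge_min lexx. Qed.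

Lemma stop_time_id r : s <= r -> r <= t -> stop_time s t r = r.
Proof. by move=> sr rt; rewrite /stop_time (min_idPr rt) (max_idPr sr). Qed.

Lemma stop_time_le r : r <= s -> stop_time s t r = s.
Proof.
move=> rs; rewrite /stop_time (min_idPr (le_trans rs st)).
by rewrite (max_idPl rs).
Qed.

Lemma stop_time_ge r : t <= r -> stop_time s t r = t.
Proof. by move=> tr; rewrite /stop_time (min_idPl tr) (max_idPr st). Qed.

Lemma le_stop_time : {homo stop_time s t : r r' / r <= r'}.
Proof.
move=> r r' rr'; rewrite /stop_time ge_max !le_max lexx/=.
by apply/orP; right; rewrite le_min !ge_min lexx rr' orbT.
Qed.

Lemma stop_time_clamp r : stop_time s t r = stop_time s t (clamp01 r).
Proof.
have [r0|r0] := leP r 0.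
  rewrite /clamp01 (min_idPr (le_trans r0 ler01)) (max_idPl r0).
  by rewrite !stop_time_le// (le_trans r0).
have [r1|/ltW r1] := leP r 1; first by rewrite clamp01_id// ltW.
rewrite /clamp01 (min_idPl r1) (max_idPr ler01).
by rewrite !stop_time_ge// (le_trans t1).
Qed.

Definition stop_curve (c : curve X) : curve X :=
  @Curve _ X (c \o stop_time s t)
    (fun r => continuous_comp (@continuous_stop_time s t r)
       (@curve_continuous _ _ c (stop_time s t r)))
    (fun r => f_equal c (stop_time_clamp r)).

(** Stopping composes with a time change with values in [s, t], inside [0, 1], so two uniformly
    close curves stay uniformly close. *)
Lemma continuous_stop_curve : continuous stop_curve.
Proof.
apply: continuous_comp_initial => c P /uniform_nbhs [E [entE EP]].
have : nbhs (curve_uniform c) [set h : {uniform` I01 -> X} |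
    forall y, I01 y -> E (c y, h y)].
  by apply/uniform_nbhs; exists E; split => // h.
move/(@initial_continuous _ _ (@curve_uniform R X)) => cE.
apply: (@filterS _ (nbhs c) _ _ _ _ cE) => c' cc'.
apply: EP => y y01; apply: cc'.
have /andP[sy yt] := stop_time_itv y.
by rewrite /= in_itv/= (le_trans s0 sy) (le_trans yt t1).
Qed.

Lemma measurable_stop_curve :
  measurable_fun setT (stop_curve : borel (curve X) -> borel (curve X)).
Proof. by apply: borel_continuous_measurable; exact: continuous_stop_curve. Qed.

Lemma stop_curve_speed_in (c : curve X) r : s < r -> r < t ->
  metric_speed (stop_curve c) r = metric_speed c r.
Proof.
move=> sr rt; rewrite /metric_speed.
have H : \forall h \near (0 : R)^', (mdist (stop_curve c r) (stop_curve c (r + h)) / `|h|)%:E =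
    (mdist (c r) (c (r + h)) / `|h|)%:E.
  have rd : 0 < Num.min (r - s) (t - r) by rewrite lt_min !subr_gt0 sr.
  near=> h.
  have : `|h| < Num.min (r - s) (t - r) by near: h; exact: dnbhs0_lt.
  rewrite lt_min !ltr_norml => /andP[/andP[? ?] /andP[? ?]].
  by rewrite /= !stop_time_id//; lra.
congr (lim _); apply/seteqP; split; apply: near_eq_cvg => //.
by apply: filterS H => h ->.
Unshelve. all: by end_near. Qed.

Lemma stop_curve_speed_out (c : curve X) r : r < s \/ t < r ->
  metric_speed (stop_curve c) r = 0%E.
Proof.
move=> h; apply/cvg_lim => //; apply: cvg_near_cst.
have [d d0 dr] : exists2 d, 0 < d & forall h, `|h| < d -> stop_time s t (r + h) = stop_time s t r.
  case: h => [rs|tr].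
    exists (s - r); first by rewrite subr_gt0.
    by move=> h; rewrite ltr_norml => /andP[? ?]; rewrite !stop_time_le//; lra.
  exists (r - t); first by rewrite subr_gt0.
  by move=> h'; rewrite ltr_norml => /andP[? ?]; rewrite !stop_time_ge//; lra.
near=> k; rewrite /= dr ?mdistxx ?mul0r//.
by near: k; exact: dnbhs0_lt.
Unshelve. all: by end_near. Qed.

Lemma stop_curve_ac (c : curve X) : absolutely_continuous_curve c ->
  absolutely_continuous_curve (stop_curve c).
Proof.
(* The stopped times span a smaller interval than [a, b], and [g] may be negative on the difference,
   so its modulus is needed for the domination. *)
move=> [g gint cg]; pose g' x := `|g x|.
have g'int : leb.-integrable I01 (EFin \o g') by exact: integrable_norm.
exists g' => // a b a0 ab b1 /=.
have [bs|sb] := leP b s.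
  rewrite !stop_time_le ?mdistxx//; last exact: le_trans bs.
  by apply: integral_ge0 => x _; rewrite lee_fin /g'.
have [ta|at_] := leP t a.
  rewrite !stop_time_ge ?mdistxx//; last exact: le_trans ab.
  by apply: integral_ge0 => x _; rewrite lee_fin /g'.
have aa : a <= stop_time s t a.
  by rewrite /stop_time (min_idPr (ltW at_)) le_max lexx orbT.
have bb : stop_time s t b <= b.
  by rewrite /stop_time ge_max (ltW sb) ge_min lexx orbT.
have /andP[sa ta] := stop_time_itv a; have /andP[sb' tb] := stop_time_itv b.
apply: (le_trans (cg _ _ (le_trans s0 sa) (le_stop_time ab) (le_trans tb t1))).
have sub : `[stop_time s t a, stop_time s t b] `<=` I01.
  by move=> x; rewrite /= !in_itv/= => /andP[? ?]; apply/andP; split; lra.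
have sub2 : `[stop_time s t a, stop_time s t b] `<=` `[a, b].
  by move=> x; rewrite /= !in_itv/= => /andP[? ?]; apply/andP; split; lra.
have sub3 : `[a, b] `<=` I01.
  by move=> x; rewrite /= !in_itv/= => /andP[? ?]; apply/andP; split; lra.
apply: (@le_trans _ _ (\int[leb]_(x in `[stop_time s t a, stop_time s t b]) (g' x)%:E)%E).
  apply: le_integral => //.
  - exact: integrableS gint.
  - exact: integrableS g'int.
  - by move=> x _; rewrite lee_fin ler_norm.
apply: ge0_subset_integral => //.
- have : leb.-integrable `[a, b] (EFin \o g') by exact: integrableS g'int.
  exact: measurable_int.
- by move=> x _; rewrite lee_fin /g'.
Qed.

End stop_curve.

End curve_measurability.

(** * Increments dominated by two integrals at once *)

Section partition_min.
Context {R : realType}.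
Local Notation leb := (@lebesgue_measure R).
Local Notation I01 := (`[(0 : R), (1 : R)]%classic).

Lemma unit_segment_unif_continuous (f : R -> R) : continuous f ->
  forall e, 0 < e -> exists2 d, 0 < d &
    forall x y, 0 <= x <= 1 -> `|y - x| < d -> `|f y - f x| < e.
Proof.
move=> cf e e0.
have := (@segment_compact R 0 1); rewrite compact_near_coveringP.
move=> /(_ R (0 : R)^'+ (fun d x => forall y, `|y - x| < d -> `|f y - f x| < e) _).
have cov : forall x : R, `[0, 1]%classic x -> \forall x' \near x & d \near (0 : R)^'+,
    forall y, `|y - x'| < d -> `|f y - f x'| < e.
  move=> x _.
  have /cvgrPdist_lt/(_ (e / 2) ltac:(lra)) := cf x.
  move=> [r /= r0 fr].
  exists (ball x (r / 2), [set d | d < r / 2]).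
    split; first by apply: nbhsx_ballx; rewrite /=; lra.
    by apply: nbhs_right_lt; lra.
  move=> [x' d] /= [xx' dr] y yx'.
  have h1 : `|f x - f x'| < e / 2.
    apply: fr; rewrite /ball_/=; move: xx'; rewrite /ball/=; lra.
  have h2 : `|f x - f y| < e / 2.
    apply: fr; rewrite /ball_/=; move: xx' yx'; rewrite /ball/= !ltr_norml.
    by move=> /andP[? ?] /andP[? ?]; apply/andP; split; lra.
  by move: h1 h2; rewrite !ltr_norml => /andP[? ?] /andP[? ?]; apply/andP; split; lra.
move=> /(_ cov) H.
have : \forall d \near (0 : R)^'+, 0 < d /\ `[0, 1]%classic `<=` (fun x => forall y, `|y - x| < d -> `|f y - f x| < e).
  by apply: filterS2 H (nbhs_right_gt 0) => d.
move=> /filter_ex [d [d0 dP]]; exists d => // x y x01; apply: dP.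
by rewrite /= in_itv.
Qed.

(** Here [u] and [v] stand for values of [h1] and [h2], [p] for the continuous approximation of
    their difference, [r] for the error of that approximation and [s] for the tolerated
    oscillation. *)
Let le_min_pos_part (u v p s r : R) : u - v - p <= r -> 0 <= r -> p <= s ->
  0 <= s -> u <= Num.min u v + s + r.
Proof. by case: (leP u v); lra. Qed.

Let le_min_neg_part (u v p s r : R) : - r <= u - v - p -> 0 <= r -> 0 <= p ->
  0 <= s -> v <= Num.min u v + s + r.
Proof. by case: (leP u v); lra. Qed.

(* [h1 - h2] is [L^1]-close to a continuous function, so on each interval of a
   fine partition one of [h1], [h2] is below the other up to a small error. *)
Lemma increment_le_integral_min (h1 h2 F : R -> R) :
  leb.-integrable I01 (EFin \o h1) -> leb.-integrable I01 (EFin \o h2) ->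
  (forall N i, (i <= N)%N ->
    `|F (i.+1%:R / N.+1%:R) - F (i%:R / N.+1%:R)| <=
    Num.min (\int[leb]_(x in `[i%:R / N.+1%:R, i.+1%:R / N.+1%:R]) h1 x)
      (\int[leb]_(x in `[i%:R / N.+1%:R, i.+1%:R / N.+1%:R]) h2 x)) ->
  `|F 1 - F 0| <= \int[leb]_(x in I01) Num.min (h1 x) (h2 x).
Proof.
move=> h1int h2int Fh; apply/ler_addgt0Pl => e e0.
pose delta x := h1 x - h2 x.
have mI : measurable (I01 : set (measurableTypeR R)) by [].
have dint : leb.-integrable I01 (EFin \o delta) by exact: (integrableB mI h1int h2int).
have muI : (leb I01 < +oo)%E by rewrite lebesgue_measure_itv/= lte_fin ltr01 -EFinD ltry.
have [phi_ [cphi iphi phil]] := approximation_continuous_integrable mI muI dint.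
(* The budget [e] is halved: one half for the [L^1] error of [phi], the other for its oscillation on
   the intervals of the partition. *)
have [phi [cp ip pe]] : exists phi : R -> R, [/\ continuous phi,
    leb.-integrable I01 (EFin \o phi) &
    (\int[leb]_(x in I01) `|delta x - phi x|%:E <= (e / 2)%:E)%E].
  have /fine_cvgP[fn /cvgrPdist_le/(_ (e / 2) ltac:(lra)) ph] := phil.
  have [n [/= fnn]] := filter_ex (filterI fn ph).
  rewrite sub0r normrN => phn; exists (phi_ n); split => //.
  rewrite -(fineK fnn) lee_fin; apply: le_trans phn.
  exact: ler_norm.
have [d d0 dP] := unit_segment_unif_continuous cp (ltac:(lra) : 0 < e / 2).
have [N Nd] : exists N : nat, N.+1%:R^-1 < d.
  by have [N _ /(_ N (leqnn N)) Nd] := near_infty_natSinv_lt (PosNum d0); exists N.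
have N0 : 0 < N.+1%:R :> R by rewrite ltr0n.
pose err x := `|delta x - phi x|.
have errint : leb.-integrable I01 (EFin \o err).
  exact: (integrable_norm (integrableB mI dint ip)).
pose mn x := Num.min (h1 x) (h2 x).
have mnint : leb.-integrable I01 (EFin \o mn).
  have mh1 : measurable_fun I01 h1 by apply/measurable_EFinP; exact: measurable_int h1int.
  have mh2 : measurable_fun I01 h2 by apply/measurable_EFinP; exact: measurable_int h2int.
  have := integrableD mI (integrable_norm h1int) (integrable_norm h2int).
  apply: le_integrable => //.
    by apply/measurable_EFinP; exact: measurable_minr.
  move=> x _ /=; rewrite lee_fin /mn [leRHS]ger0_norm ?addr_ge0//.
  by rewrite /Num.min; case: ifP => _; rewrite ?lerDl ?lerDr.
pose w x := mn x + e / 2 + err x.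
have cint : leb.-integrable I01 (EFin \o cst (e / 2)).
  apply/integrableP; split; first exact/measurable_EFinP/measurable_cst.
  by rewrite /= integral_cst// lte_mul_pinfty.
have wint : leb.-integrable I01 (EFin \o w).
  exact: (integrableD mI (integrableD mI mnint cint) errint).
have step i : (i <= N)%N -> `|F (i.+1%:R / N.+1%:R) - F (i%:R / N.+1%:R)| <=
    \int[leb]_(x in `[i%:R / N.+1%:R, i.+1%:R / N.+1%:R]) w x.
  move=> iN; apply: (le_trans (Fh N i iN)).
  set a := i%:R / N.+1%:R; set b := i.+1%:R / N.+1%:R.
  have ab : b - a = N.+1%:R^-1 by rewrite /a /b -mulrBl -natr1 addrAC subrr add0r mul1r.
  have a0 : 0 <= a by rewrite divr_ge0.
  have b1 : b <= 1 by rewrite ler_pdivrMr// mul1r ler_nat.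
  have abd : b - a < d by rewrite ab.
  clearbody a b; clear ab.
  have sub : `[a, b]%classic `<=` I01.
    by move=> x; rewrite /= !in_itv/= => /andP[? ?]; apply/andP; split; lra.
  have osc x y : `[a, b]%classic x -> `[a, b]%classic y -> `|phi y - phi x| < e / 2.
    rewrite /= !in_itv/= => /andP[? ?] /andP[? ?]; apply: dP; first by apply/andP; split; lra.
    by rewrite ltr_norml; apply/andP; split; lra.
  have errP x : - err x <= delta x - phi x <= err x by rewrite -ler_norml.
  have mab : measurable (`[a, b]%classic : set (measurableTypeR R)) by [].
  (* Either [phi <= e / 2] on the whole interval, and [h1] is almost the minimum there, or [phi]
     exceeds [e / 2] at some [z]; the small oscillation then keeps it nonnegative, and [h2] is
     almost the minimum. *)
  have [ple|/existsNP[z /not_implyP[zab /negP pz]]] :=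
    pselect (forall x, `[a, b]%classic x -> phi x <= e / 2).
    rewrite ge_min; apply/orP; left; apply: le_Rintegral => //.
    - by apply: integrableS h1int.
    - by apply: integrableS wint.
    move=> x xab; have /andP[_ er] := errP x.
    by apply: le_min_pos_part er (normr_ge0 _) (ple _ xab) _; rewrite divr_ge0// ltW.
  rewrite -ltNge in pz.
  rewrite ge_min; apply/orP; right; apply: le_Rintegral => //.
  - by apply: integrableS h2int.
  - by apply: integrableS wint.
  move=> x xab; have /andP[er _] := errP x.
  apply: le_min_neg_part er (normr_ge0 _) _ _; last by rewrite divr_ge0// ltW.
  have := osc _ _ zab xab; rewrite ltr_norml => /andP[px _].
  by have := ltrD px pz; rewrite addNr subrK => /ltW.
have tot i : (i <= N.+1)%N ->
    `|F (i%:R / N.+1%:R) - F 0| <= \int[leb]_(x in `[0, i%:R / N.+1%:R]) w x.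
  elim: i => [_|i ih iN].
    by rewrite mul0r subrr normr0 set_itv1 Rintegral_set1.
  set a := i%:R / N.+1%:R in ih *; set b := i.+1%:R / N.+1%:R.
  have ab : a <= b by rewrite ler_pM2r ?invr_gt0// ler_nat.
  have a0 : 0 <= a by rewrite divr_ge0.
  have b1 : b <= 1 by rewrite ler_pdivrMr// mul1r ler_nat.
  have w0b : leb.-integrable `[0, b] (EFin \o w).
    by apply: integrableS wint => //; apply: subset_itvl; rewrite bnd_simp.
  have wab : leb.-integrable `]a, b] (EFin \o w).
    apply: integrableS w0b => // x; rewrite /= !in_itv/= => /andP[? ?].
    by apply/andP; split; lra.
  have := @Rintegral_itvB _ w (BLeft 0) (BRight b) a w0b.
  rewrite !bnd_simp => /(_ a0 ab).
  rewrite (Rintegral_itv_obnd_cbnd wab) => wE.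
  have := step i iN; have := ih (ltnW iN).
  rewrite -/a -/b -wE => ha hb.
  rewrite -(subrKA (F a)); apply: (le_trans (ler_normD _ _)); lra.
have := tot N.+1 (leqnn _); rewrite divff ?gt_eqF// => h; apply: (le_trans h).
rewrite /w RintegralD//; last exact: (integrableD mI mnint cint).
rewrite RintegralD//.
rewrite Rintegral_cst//.
have -> : fine (leb I01) = 1 by rewrite lebesgue_measure_itv/= lte_fin ltr01 oppr0 addr0.
have : \int[leb]_(x in I01) err x <= e / 2.
  rewrite /Rintegral -[leRHS]/(fine (e / 2)%:E); apply: fine_le => //.
  exact: integrable_fin_num.
lra.
Qed.

End partition_min.

(** * Asymptotic Lipschitz constants *)

Section asymptotic_lipschitz.
Context {R : realType} {X : completeMetricType R}.
Implicit Types (u v : X -> R) (x y : X).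

Lemma lipschitz_const_sub (A B : set X) u L : A `<=` B ->
  lipschitz_const_on B u L -> lipschitz_const_on A u L.
Proof. by move=> AB [L0 uL]; split => // x y /AB Bx /AB; exact: uL. Qed.

Lemma Lip_a_cvg u x :
  Lip u (ball x r) @[r --> (0 : R)^'+] -->
  ereal_inf [set Lip u (ball x r) | r in [set r | 0 < r]].
Proof.
have := @nondecreasing_at_right_cvge _ (fun r => Lip u (ball x r)) 0 +oo%O.
rewrite set_itvoy; apply => //.
move=> r s _ _ rs; apply: ereal_inf_le_tmp => _ [L uL <-].
exists L => //; apply: lipschitz_const_sub uL; exact: le_ball.
Qed.

Lemma Lip_aE u x :
  Lip_a u x = ereal_inf [set Lip u (ball x r) | r in [set r | 0 < r]].
Proof. by apply/cvg_lim => //; exact: Lip_a_cvg. Qed.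

Lemma Lip_a_lt u x (l : \bar R) : (Lip_a u x < l)%E <->
  exists r L : R, [/\ 0 < r, (L%:E < l)%E & lipschitz_const_on (ball x r) u L].
Proof.
rewrite Lip_aE; split.
  move=> /ereal_inf_lt[_ [r r0 <-]] /ereal_inf_lt[_ [L uL <-]] Ll.
  by exists r, L.
move=> [r [L [r0 Ll uL]]]; apply: le_lt_trans Ll.
apply: (@le_trans _ _ (Lip u (ball x r))).
  by apply: ereal_inf_lbound; exists r.
by apply: ereal_inf_lbound; exists L.
Qed.

Lemma Lip_a_le u x r L : 0 < r -> lipschitz_const_on (ball x r) u L ->
  (Lip_a u x <= L%:E)%E.
Proof.
move=> r0 uL; rewrite Lip_aE.
apply: (@le_trans _ _ (Lip u (ball x r))).
  by apply: ereal_inf_lbound; exists r.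
by apply: ereal_inf_lbound; exists L.
Qed.

Lemma Lip_a_ge0 u x : (0 <= Lip_a u x)%E.
Proof.
rewrite Lip_aE; apply: le_ereal_inf_tmp => _ [r r0 <-].
by apply: le_ereal_inf_tmp => _ [L [L0 _] <-]; rewrite lee_fin.
Qed.

Lemma Lip_a_lipschitz u x L : lipschitz_const_on setT u L -> (Lip_a u x <= L%:E)%E.
Proof.
by move=> uL; apply: (@Lip_a_le _ _ 1) => //; exact: lipschitz_const_sub uL.
Qed.

Lemma Lip_a_fin_num u x : is_lipschitz u -> Lip_a u x \is a fin_num.
Proof.
move=> [L uL]; rewrite ge0_fin_numE ?Lip_a_ge0//.
exact: le_lt_trans (Lip_a_lipschitz x uL) (ltry _).
Qed.

Lemma Lip_a_approx u x e : is_lipschitz u -> 0 < e ->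
  exists r L : R, [/\ 0 < r, L < fine (Lip_a u x) + e & lipschitz_const_on (ball x r) u L].
Proof.
move=> lu e0; have /Lip_a_lt[r [L [r0 Ll uL]]] : (Lip_a u x < (fine (Lip_a u x) + e)%:E)%E.
  by rewrite -{1}(fineK (Lip_a_fin_num x lu)) lte_fin ltrDl.
by exists r, L.
Qed.

Lemma Lip_aD u v x : is_lipschitz u -> is_lipschitz v ->
  (Lip_a (fun y => (u y + v y)%R) x <= Lip_a u x + Lip_a v x)%E.
Proof.
move=> lu lv; rewrite -(fineK (Lip_a_fin_num x lu)) -(fineK (Lip_a_fin_num x lv)).
rewrite -EFinD; apply/lee_addgt0Pr => e e0.
have e2 : 0 < e / 2 by lra.
have [r [L [r0 Lu [L0 uL]]]] := Lip_a_approx x lu e2.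
have [s [M [s0 Mv [M0 vM]]]] := Lip_a_approx x lv e2.
apply: (@le_trans _ _ (L + M)%:E); last by rewrite -EFinD lee_fin; lra.
apply: (@Lip_a_le _ _ (Num.min r s)); first by rewrite lt_min r0.
split; first exact: addr_ge0.
move=> y z; rewrite !ballEmdist/= !lt_min => /andP[yr ys] /andP[zr zs].
rewrite mulrDl opprD addrACA; apply: (le_trans (ler_normD _ _)); apply: lerD.
  by apply: uL; rewrite ballEmdist.
by apply: vM; rewrite ballEmdist.
Qed.

Lemma Lip_aZ a u x : is_lipschitz u ->
  (Lip_a (fun y => (a * u y)%R) x <= `|a|%:E * Lip_a u x)%E.
Proof.
move=> lu; rewrite -(fineK (Lip_a_fin_num x lu)).
rewrite -EFinM; apply/lee_addgt0Pr => e e0.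
(* The added 1 covers the case [a = 0]. *)
have a1 : 0 < `|a| + 1 by have := normr_ge0 a; lra.
have [r [L [r0 Lu [L0 uL]]]] := Lip_a_approx x lu (divr_gt0 e0 a1).
apply: (@le_trans _ _ (`|a| * L)%:E).
  apply: (@Lip_a_le _ _ r) => //; split; first exact: mulr_ge0.
  by move=> y z yr zr; rewrite -mulrBr normrM -mulrA ler_wpM2l// uL.
rewrite -EFinD lee_fin; apply: (@le_trans _ _ (`|a| * (fine (Lip_a u x) + e / (`|a| + 1)))).
  by rewrite ler_wpM2l// ltW.
by rewrite mulrDr lerD2l mulrCA ger_pMr// ler_pdivrMr// mul1r lerDl.
Qed.

(** Upper semicontinuity, from which Borel measurability follows: a Lipschitz constant on a ball
    remains valid on balls of half the radius around nearby points. *)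
Lemma open_Lip_a_lt u (l : \bar R) : open [set x | (Lip_a u x < l)%E].
Proof.
rewrite openE => x /= /Lip_a_lt[r [L [r0 Ll uL]]].
rewrite /interior -nbhs_ballE; exists (r / 2); first by rewrite /=; lra.
move=> y xy; apply/Lip_a_lt; exists (r / 2), L; split => //; first lra.
apply: lipschitz_const_sub uL => z yz.
by rewrite [r]splitr; exact: ball_triangle xy yz.
Qed.

Lemma measurable_Lip_a u : measurable_fun setT (Lip_a u : borel X -> \bar R).
Proof.
apply: (measurability _ (ErealGenInftyO.measurableE R)) => _ [_ [l ->] <-].
rewrite setTI; apply: borel_measurable_open.
have -> : Lip_a u @^-1` `]-oo, l%:E[ = [set x | (Lip_a u x < l%:E)%E].
  by apply/seteqP; split => x /=; rewrite in_itv.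
exact: open_Lip_a_lt.
Qed.

Lemma lipschitz_continuous u : is_lipschitz u -> continuous u.
Proof.
move=> [L [L0 uL]] x; apply/cvgrPdist_le => e e0.
have L1 : 0 < L + 1 by lra.
have : nbhs x (ball x (e / (L + 1))) by apply: nbhsx_ballx; rewrite divr_gt0.
rewrite ballEmdist.
apply: filterS => y /=; rewrite ltr_pdivlMr// => xy.
apply: (le_trans (uL x y I I)); apply: le_trans (ltW xy).
by rewrite mulrC ler_wpM2l ?mdist_ge0//; lra.
Qed.

Lemma measurable_lipschitz u : is_lipschitz u -> measurable_fun setT (u : borel X -> R).
Proof. by move=> /lipschitz_continuous; exact: borel_continuous_measurable_real. Qed.

Local Notation leb := (@lebesgue_measure R).
Local Notation I01 := (`[(0 : R), (1 : R)]%classic).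

(** At almost every time the derivative of [u] along the curve is at most a local Lipschitz constant
    times the speed, since by continuity the curve stays for a while in the ball of that constant. A
    general majorant [k] is allowed because convex combinations of slopes only majorise the
    slope. *)
Lemma Lip_a_upper_gradient (c : curve X) u (k : X -> \bar R) :
  separable_space X -> absolutely_continuous_curve c -> is_lipschitz u ->
  (forall x, (Lip_a u x <= k x)%E) ->
  (`|u (c 1) - u (c 0)|%:E <= \int[leb]_(t in I01) (k (c t) * metric_speed c t))%E.
Proof.
move=> sepX cac lipu uk; have [L [L0 uL]] := lipu.
have [m [mint m0 _ mlim]] := metric_derivative sepX cac.
have [g gint cg] := cac.
pose phi t := u (c t).
have Lgint : leb.-integrable I01 (EFin \o (fun t => L * g t)).
  exact: (integrableZl _ _ gint).
have phig s t : 0 <= s -> s <= t -> t <= 1 ->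
    (`|phi t - phi s|%:E <= \int[leb]_(x in `[s, t]) (L * g x)%:E)%E.
  move=> s0 st t1.
  apply: (@le_trans _ _ (L%:E * (mdist (c s) (c t))%:E)%E).
    by rewrite -EFinM lee_fin metric_sym; exact: uL.
  under eq_integral do rewrite EFinM.
  rewrite integralZl//.
    by apply: lee_wpmul2l; [rewrite lee_fin|exact: cg].
  apply: integrableS gint => //.
  by move=> x; rewrite /= !in_itv/= => /andP[? ?]; apply/andP; split; lra.
have [rho [rint rE rlim]] := ac_fun_representation Lgint phig.
rewrite -/(phi 1) -/(phi 0) rE//.
have rint1 : leb.-integrable `]0, 1] (EFin \o rho) by exact: integrableS rint.
apply: (@le_trans _ _ (\int[leb]_(x in `]0%R, 1%R]) `|rho x|%:E)%E).
  rewrite -[leRHS]fineK; first by rewrite lee_fin; exact: le_normr_Rintegral.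
  by apply: integrable_fin_num => //; exact: integrable_norm.
rewrite (@integral_itv_obnd_cbnd _ 0 (BRight 1) (fun t => `|rho t|%:E)); last first.
  by apply/measurable_EFinP; apply: measurableT_comp => //; apply/measurable_EFinP; exact: measurable_int rint1.
apply: ge0_le_integral_ae => //.
  by move=> x; rewrite mule_ge0 ?metric_speed_ge0//; exact: le_trans (Lip_a_ge0 _ _) (uk _).
have ae1 : {ae leb, forall t, t != 1 :> R}.
  exists [set 1]; split => //; first by rewrite lebesgue_measure_set1.
  by move=> x /= /negP; rewrite negbK => /eqP.
have ae0 : {ae leb, forall t, t != 0 :> R}.
  exists [set 0]; split => //; first by rewrite lebesgue_measure_set1.
  by move=> x /= /negP; rewrite negbK => /eqP.
have ae01 := ae_mono2 (fun t a b => conj a b) ae0 ae1.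
apply: ae_mono3 ae01 mlim rlim => t [t0 t1] mt rt; rewrite /= in_itv/= => /andP[le0t let1].
have t01 : 0 < t < 1 by rewrite !lt_neqAle eq_sym t0 t1 le0t.
have [-> _] := metric_speedE (mt t01).
apply: (@le_trans _ _ (Lip_a u (c t) * (m t)%:E)%E); last first.
  by apply: lee_wpmul2r; rewrite ?lee_fin.
have ufin := Lip_a_fin_num (c t) lipu.
rewrite -(fineK ufin) -EFinM lee_fin; apply/ler_addgt0Pl => e e0.
have m1 : 0 < m t + 1 by have := m0 t; lra.
have [r [L' [r0 L'l uL']]] := Lip_a_approx (c t) lipu (divr_gt0 e0 m1).
have rL' : `|rho t| <= L' * m t.
  have A : `|h^-1 * (phi (h + t) - phi t)| @[h --> 0^'] --> `|rho t|.
    by apply: cvg_norm; exact: rt.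
  have B : L' * (mdist (c t) (c (t + h)) / `|h|) @[h --> 0^'] --> L' * m t.
    by apply: cvgMr; exact: mt.
  apply: (ler_cvg_to A B).
  have ct : \forall h \near (0 : R)^', mdist (c t) (c (t + h)) < r.
    have : mdist (c t) (c (t + h)) @[h --> 0] --> mdist (c t) (c (t + 0)).
      have := @continuous_mdist R X R (cst (c t)) (fun h => c (t + h)).
      move=> /(_ _ _ 0) H; apply: H; first by move=> h; exact: cvg_cst.
      move=> h; apply: (@continuous_comp _ _ _ (fun x : R => t + x) c).
        by apply: cvgD; [exact: cvg_cst|exact: cvg_id].
      exact: curve_continuous.
    rewrite addr0 mdistxx => /cvgrPdist_lt/(_ r r0) H.
    apply: cvg_within; apply: filterS H => h /=.
    by rewrite sub0r normrN ger0_norm ?mdist_ge0.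
  near=> h; have h0 : h != 0 by near: h; exact: nbhs_dnbhs_neq.
  rewrite normrM normrV ?unitfE// mulrA mulrC.
  rewrite ler_wpM2r ?invr_ge0// /phi distrC (addrC h).
  apply: uL'.2; rewrite ballEmdist/= ?mdistxx//.
  by near: h.
apply: (le_trans rL'); apply: (@le_trans _ _ ((fine (Lip_a u (c t)) + e / (m t + 1)) * m t)).
  by rewrite ler_wpM2r// ltW.
rewrite mulrDl addrC lerD2r -mulrA -[leRHS]mulr1 (ler_wpM2l (ltW e0))//.
by rewrite mulrC ler_pdivrMr// mul1r lerDl.
Unshelve. all: by end_near. Qed.

End asymptotic_lipschitz.

(** * Test plans and weak upper gradients *)

Section pushforward_bounds.
Context d1 d2 (T1 : measurableType d1) (T2 : measurableType d2) {R : realType}.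
Variables (phi : T1 -> T2) (mphi : measurable_fun setT phi).
Let mphi_mixin := isMeasurableFun.Build _ _ _ _ _ mphi.
Let mphi_pack : {mfun _ >-> _} := HB.pack phi mphi_mixin.
Local Open Scope ereal_scope.

Lemma le_integral_pushforward (mu : {measure set T1 -> \bar R})
    (nu : {measure set T2 -> \bar R}) (C : R) (F : T2 -> \bar R) :
  (0 <= C)%R ->
  (forall B, measurable B -> pushforward mu phi B <= C%:E * nu B) ->
  measurable_fun setT F -> (forall y, 0 <= F y) ->
  \int[mu]_x F (phi x) <= C%:E * \int[nu]_y F y.
Proof.
move=> C0 phiC mF F0.
have := @ge0_integral_pushforward _ _ _ _ _ _ mphi mu setT F measurableT mF (fun y _ => F0 y).
rewrite preimage_setT => <-.
rewrite -(ge0_integral_mscale nu measurableT (NngNum C0) mF)//.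
apply: (@ge0_le_measure_integral _ _ _ (pushforward mu mphi_pack)) => //.
Qed.

Lemma ae_pushforward (mu : {measure set T1 -> \bar R}) (P : T2 -> Prop) :
  (pushforward mu phi).-negligible (~` [set y | P y]) -> {ae mu, forall x, P (phi x)}.
Proof.
move=> [N [mN N0 PN]]; exists (phi @^-1` N); split => //.
  by rewrite -[X in measurable X]setTI; exact: mphi.
by move=> x /= nP; exact: PN.
Qed.

End pushforward_bounds.

Section conjugate.
Context {R : realType}.
Implicit Types q : R.

Lemma conjugate_exponent_gt1 q : 1 < q -> 1 < conjugate_exponent q.
Proof.
by move=> q1; rewrite /conjugate_exponent ltr_pdivlMr ?subr_gt0// mul1r; lra.
Qed.

Lemma conjugate_exponentP q : 1 < q -> q^-1 + (conjugate_exponent q)^-1 = 1.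
Proof.
move=> q1; rewrite /conjugate_exponent; field.
by rewrite !gt_eqF ?subr_gt0//; lra.
Qed.

Lemma young_poweR q (a b : \bar R) : 1 < q -> (0 <= a)%E -> (0 <= b)%E ->
  (a * b <= a `^ q + b `^ (conjugate_exponent q))%E.
Proof.
move=> q1; have p1 := conjugate_exponent_gt1 q1; have pq := conjugate_exponentP q1.
set p := conjugate_exponent q in p1 pq *.
have q0 : 0 < q by lra.
have p0 : 0 < p by lra.
move: a b => [a| |] [b| |]//; rewrite ?lee_fin => a0 b0.
- apply: (le_trans (conjugate_powR a0 b0 q0 p0 pq)); apply: lerD.
    by rewrite ler_pdivrMr// ler_peMr ?powR_ge0// ltW.
  by rewrite ler_pdivrMr// ler_peMr ?powR_ge0// ltW.
- by rewrite [X in (_ <= _ + X)%E]eqy_poweR// addey ?leey// gt_eqF// (lt_le_trans _ (poweR_ge0 _ _))// ltNy0.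
- by rewrite [X in (_ <= X + _)%E]eqy_poweR// addye ?leey// gt_eqF// (lt_le_trans _ (poweR_ge0 _ _))// ltNy0.
- by rewrite [X in (_ <= X + _)%E]eqy_poweR// addye ?leey// gt_eqF// (lt_le_trans _ (poweR_ge0 _ _))// ltNy0.
Qed.

(** A large [lam] makes the term of the exponent [conjugate_exponent q] as small as desired; this is
    how the energy of a plan is absorbed later. *)
Lemma young_poweR_scaled q (lam : R) (a b : \bar R) : 1 < q -> 0 < lam ->
  (0 <= a)%E -> (0 <= b)%E ->
  (a * b <= (lam `^ q)%:E * a `^ q +
    (lam^-1 `^ (conjugate_exponent q))%:E * b `^ (conjugate_exponent q))%E.
Proof.
move=> q1 lam0 a0 b0.
have -> : (a * b = (lam%:E * a) * (lam^-1%:E * b))%E.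
  by rewrite muleACA -EFinM mulfV ?gt_eqF// mul1e.
have l0 : (0 <= lam%:E)%E by rewrite lee_fin ltW.
have li0 : (0 <= lam^-1%:E)%E by rewrite lee_fin invr_ge0 ltW.
rewrite -!poweR_EFin -!poweRM//.
by apply: young_poweR => //; exact: mule_ge0.
Qed.

End conjugate.

Section test_plan_theory.
Context {R : realType} {X : completeMetricType R}.
Variables (m : {measure set (borel X) -> \bar R}) (p : R).
Hypothesis (sepX : separable_space X).
Local Notation leb := (@lebesgue_measure R).
Local Notation I01 := (`[(0 : R), (1 : R)]%classic).
Local Open Scope ereal_scope.

Let dist_to (A : set X) (x : X) : R := inf [set mdist x y | y in A].

Let dist_to_lb (A : set X) x : has_lbound [set mdist x y | y in A].
Proof. by exists 0%R => _ [y _ <-]; exact: mdist_ge0. Qed.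

Let dist_to_le (A : set X) x y : A y -> (dist_to A x <= mdist x y)%R.
Proof. by move=> Ay; apply: ge_inf; [exact: dist_to_lb|exists y]. Qed.

Let le_dist_to (A : set X) x r : A !=set0 -> (forall y, A y -> r <= mdist x y)%R ->
  (r <= dist_to A x)%R.
Proof.
move=> [z Az] h; apply: lb_le_inf; first by exists (mdist x z), z.
by move=> _ [y Ay <-]; exact: h.
Qed.

Let dist_to_lipschitz (A : set X) : A !=set0 -> is_lipschitz (dist_to A).
Proof.
move=> A0; exists 1%R; split => //.
have H x y : (dist_to A x - mdist x y <= dist_to A y)%R.
  apply: le_dist_to => // z Az; have := dist_to_le x Az.
  have := metric_triangle x y z; lra.
move=> x y _ _; rewrite mul1r ler_norml; have := H x y; have := H y x.
by rewrite (metric_sym y x) => ? ?; apply/andP; split; lra.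
Qed.

(** An open set is where the distance to its complement is positive, which reduces the claim to a
    real function continuous in time. The whole space is treated apart, the infimum over an empty
    complement being meaningless. *)
Lemma measurable_eval_joint : measurable_fun setT
  ((fun z => (z.1 : curve X) z.2) : borel (curve X) * measurableTypeR R -> borel X).
Proof.
apply: (@measurability _ _ _ (borel X) setT _ open erefl) => _ [U oU <-]; rewrite setTI.
have [U0|/set0P U0] := eqVneq (~` U) set0.
  have -> : U = setT by rewrite -(setCK U) U0 setC0.
  by rewrite preimage_setT.
have -> : (fun z : borel (curve X) * measurableTypeR R => (z.1 : curve X) z.2) @^-1` U =
    (fun z => dist_to (~` U) ((z.1 : curve X) z.2)) @^-1` `]0%R, +oo[.
  apply/seteqP; split => -[c t] /=; rewrite in_itv/= andbT.
    move=> Uct; have : nbhs ((c : curve X) t) U by exact: open_nbhs_nbhs.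
    rewrite -nbhs_ballE => -[r /= r0 rU]; apply: (lt_le_trans r0).
    apply: le_dist_to => // y nUy; rewrite leNgt; apply/negP => yr; apply: nUy.
    by apply: rU; rewrite ballEmdist.
  move=> d0; apply: contrapT => nU; have := @dist_to_le (~` U) ((c : curve X) t) _ nU.
  by rewrite mdistxx leNgt d0.
have cd := lipschitz_continuous (dist_to_lipschitz U0).
have mF := @caratheodory_measurable R _ _
  (fun (c : borel (curve X)) t => dist_to (~` U) ((c : curve X) t)).
rewrite -[X in measurable X]setTI; apply: mF => //.
  move=> t; apply: borel_continuous_measurable_real => c.
  apply: (@continuous_comp _ _ _ (fun c : curve X => c t)); last exact: cd.
  exact: continuous_eval.
move=> c t; apply: (@continuous_comp _ _ _ (c : curve X)); last exact: cd.
exact: curve_continuous.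
Qed.

Variable (pi : probability (borel (curve X)) R).
Hypothesis (hpi : test_plan m p pi).

Lemma test_plan_AC : {ae pi, forall c, Defs.AC p c}.
Proof. by have [H _ _] := hpi. Qed.

Lemma test_plan_eval : exists2 C : R, (0 <= C)%R & forall t, (0 <= t <= 1)%R ->
  forall F : X -> \bar R, measurable_fun setT (F : borel X -> \bar R) ->
    (forall x, 0 <= F x) ->
    \int[pi]_c F ((c : curve X) t) <= C%:E * \int[m]_x F x.
Proof.
have [_ _ [C HC]] := hpi; exists (Num.max 0%R C); first by rewrite le_max lexx.
move=> t t01 F mF F0.
apply: (@le_integral_pushforward _ _ _ _ _ _ (measurable_eval t)) => //.
  by rewrite le_max lexx.
move=> B mB; apply: (le_trans (HC t t01 B mB)).
by apply: lee_wpmul2r => //; rewrite lee_fin le_max lexx orbT.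
Qed.

Lemma metric_speed_integral (c : curve X) r :
  absolutely_continuous_curve c ->
  \int[leb]_(t in I01) (metric_speed c t `^ r) = \int[leb]_(t in I01) (mspeed c t `^ r).
Proof.
move=> cac; have [v [_ _ _ vE]] := metric_speed_ae sepX cac.
apply: ge0_eq_integral_ae => //.
- by move=> t; exact: poweR_ge0.
- by move=> t; exact: poweR_ge0.
by apply: ae_mono vE => t tE /tE[-> ->].
Qed.

Lemma line_integralE (c : curve X) (F : X -> \bar R) :
  absolutely_continuous_curve c -> (forall x, 0 <= F x) ->
  \int[leb]_(t in I01) (F (c t) * metric_speed c t) =
  \int[leb]_(t in I01) (F (c t) * mspeed c t).
Proof.
move=> cac F0; have [v [_ _ _ vE]] := metric_speed_ae sepX cac.
apply: ge0_eq_integral_ae => //.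
- by move=> t; rewrite mule_ge0 ?metric_speed_ge0.
- by move=> t; rewrite mule_ge0 ?mspeed_ge0.
by apply: ae_mono vE => t tE /tE[-> ->].
Qed.

Lemma test_plan_energy :
  \int[pi]_c \int[leb]_(t in I01) (mspeed c t `^ p) < +oo.
Proof.
have [_ E _] := hpi; apply: le_lt_trans E; apply: ge0_le_integral_ae => //.
- by move=> c; apply: integral_ge0 => t _; exact: poweR_ge0.
- by move=> c; apply: integral_ge0 => t _; exact: poweR_ge0.
by apply: ae_mono test_plan_AC => c [cac _] _; rewrite metric_speed_integral.
Qed.

Section joint.
Variables (f : borel (curve X) * measurableTypeR R -> \bar R).
Hypotheses (mf : measurable_fun setT f) (f0 : forall z, 0 <= f z).

Let f' (z : borel (curve X) * measurableTypeR R) := f z * (\1_I01 z.2)%:E.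

Let f'0 z : 0 <= f' z.
Proof. by rewrite mule_ge0. Qed.

Let mf' : measurable_fun setT f'.
Proof.
apply: emeasurable_funM => //; apply/measurable_EFinP.
apply: (@measurableT_comp _ _ _ _ _ _ (\1_I01 : measurableTypeR R -> R)) => //.
Qed.

Let f'E c : \int[leb]_(t in I01) f (c, t) = \int[leb]_t f' (c, t).
Proof. by rewrite integral_mkcond epatch_indic. Qed.

Lemma measurable_joint_integral :
  measurable_fun setT (fun c => \int[leb]_(t in I01) f (c, t)).
Proof.
rewrite (_ : (fun c => _) = fubini_F leb f'); last exact/funext.
exact: measurable_fun_fubini_tonelli_F.
Qed.

Lemma joint_tonelli : \int[pi]_c \int[leb]_(t in I01) f (c, t) =
  \int[leb]_(t in I01) \int[pi]_c f (c, t).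
Proof.
under eq_integral do rewrite f'E.
rewrite (fubini_tonelli f')// [RHS]integral_mkcond epatch_indic.
apply: eq_integral => t _; rewrite /f' /= -ge0_integralZr//.
by apply: measurableT_comp mf _; exact: pair2_measurable.
Qed.

End joint.

Section line_integral.
Variable F : X -> \bar R.
Hypotheses (mF : measurable_fun setT (F : borel X -> \bar R)) (F0 : forall x, 0 <= F x).

(** Written with [mspeed], hence measurable in the curve; [line_integralE] goes back to the metric
    speed on absolutely continuous curves. *)
Definition line_integral (c : curve X) := \int[leb]_(t in I01) (F (c t) * mspeed c t).

Let mFj : measurable_fun setT
  (fun z : borel (curve X) * measurableTypeR R => F ((z.1 : curve X) z.2)).
Proof. by apply: measurableT_comp mF _; exact: measurable_eval_joint. Qed.

Lemma measurable_line_integral :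
  measurable_fun setT (line_integral : borel (curve X) -> \bar R).
Proof.
apply: (measurable_joint_integral (f := fun z => F ((z.1 : curve X) z.2) * mspeed z.1 z.2)).
  by apply: emeasurable_funM => //; exact: measurable_mspeed.
by move=> z; rewrite mule_ge0// mspeed_ge0.
Qed.

Lemma line_integral_ge0 c : 0 <= line_integral c.
Proof. by apply: integral_ge0 => t _; rewrite mule_ge0// mspeed_ge0. Qed.

Lemma measurable_curve_time (c : curve X) (F' : X -> \bar R) :
  measurable_fun setT (F' : borel X -> \bar R) ->
  measurable_fun setT (fun t : measurableTypeR R => F' (c t)).
Proof.
move=> mF'; apply: measurableT_comp mF' _.
apply: (measurableT_comp measurable_eval_joint (g := fun t : measurableTypeR R => ((c : borel (curve X)), t))).
exact: pair1_measurable.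
Qed.

Lemma measurable_mspeed_time (c : curve X) :
  measurable_fun setT (fun t : measurableTypeR R => mspeed c t).
Proof.
apply: (measurableT_comp measurable_mspeed (g := fun t : measurableTypeR R => ((c : borel (curve X)), t))).
exact: pair1_measurable.
Qed.

End line_integral.

(* Young's inequality with a free parameter replaces Hoelder's inequality on
   the product of the curve space and the unit interval. *)
Lemma plan_line_integral q : (1 < q)%R -> p = conjugate_exponent q ->
  exists2 C : R, (0 <= C)%R & forall F : X -> \bar R,
    measurable_fun setT (F : borel X -> \bar R) -> (forall x, 0 <= F x) ->
    forall lam, (0 < lam)%R ->
    \int[pi]_c line_integral F c <= (C * lam `^ q)%:E * \int[m]_x (F x `^ q) +
    (lam^-1 `^ p)%:E * \int[pi]_c \int[leb]_(t in I01) (mspeed c t `^ p).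
Proof.
move=> q1 pE; have [C C0 HC] := test_plan_eval; exists C => // F mF F0 lam lam0.
have mFq : measurable_fun setT ((fun x => F x `^ q) : borel X -> \bar R).
  exact: (measurableT_comp (measurable_poweR q) mF).
have mFj : measurable_fun setT
    (fun z : borel (curve X) * measurableTypeR R => F ((z.1 : curve X) z.2) `^ q).
  exact: (measurableT_comp mFq measurable_eval_joint).
have mMj : measurable_fun setT
    (fun z : borel (curve X) * measurableTypeR R => mspeed z.1 z.2 `^ p).
  exact: (measurableT_comp (measurable_poweR p) measurable_mspeed).
have mFc (c : curve X) : measurable_fun I01 (fun t : measurableTypeR R => F ((c : curve X) t) `^ q).
  by apply: measurable_funTS; exact: (measurable_curve_time c mFq).
have mMc (c : curve X) : measurable_fun I01 (fun t : measurableTypeR R => mspeed c t `^ p).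
  apply: measurable_funTS.
  exact: (measurableT_comp (measurable_poweR p) (measurable_mspeed_time c)).
have L0 : 0 <= (lam `^ q)%:E by rewrite lee_fin powR_ge0.
have L1 : 0 <= (lam^-1 `^ p)%:E by rewrite lee_fin powR_ge0.
have pw r (a : \bar R) : 0 <= a `^ r by exact: poweR_ge0.
apply: (@le_trans _ _ (\int[pi]_c ((lam `^ q)%:E * \int[leb]_(t in I01) (F (c t) `^ q) +
   (lam^-1 `^ p)%:E * \int[leb]_(t in I01) (mspeed c t `^ p)))).
  apply: ge0_le_integral_ae => //.
  - by move=> c; exact: line_integral_ge0.
  - by move=> c; rewrite adde_ge0// mule_ge0// integral_ge0.
  apply: nearW => c _.
  apply: (@le_trans _ _ (\int[leb]_(t in I01) ((lam `^ q)%:E * F ((c : curve X) t) `^ q +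
      (lam^-1 `^ p)%:E * mspeed c t `^ p))); last first.
    rewrite ge0_integralD//; last 4 first.
    - by move=> t _; rewrite mule_ge0.
    - by apply: measurable_funeM; exact: mFc.
    - by move=> t _; rewrite mule_ge0.
    - by apply: measurable_funeM; exact: mMc.
    by rewrite ge0_integralZl ?ge0_integralZl//; [exact: mMc|exact: mFc].
  apply: ge0_le_integral_ae => //.
  - by move=> t; rewrite mule_ge0// mspeed_ge0.
  - by move=> t; rewrite adde_ge0// mule_ge0.
  apply: nearW => t _; rewrite pE; apply: young_poweR_scaled => //.
  exact: mspeed_ge0.
have mI1 := measurable_joint_integral mFj (fun z => pw q _).
have mI2 := measurable_joint_integral mMj (fun z => pw p _).
rewrite ge0_integralD//; last 4 first.
- by move=> c _; rewrite mule_ge0// integral_ge0.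
- by apply: measurable_funeM; exact: mI1.
- by move=> c _; rewrite mule_ge0// integral_ge0.
- by apply: measurable_funeM; exact: mI2.
rewrite ge0_integralZl//; last by move=> c _; exact: integral_ge0.
rewrite ge0_integralZl//; last by move=> c _; exact: integral_ge0.
apply: leeD => //; rewrite mulrC EFinM -muleA; apply: lee_wpmul2l => //.
(* After exchanging the integrals, each time marginal is at most [C] times [m], and the times have
   total length 1. *)
rewrite (joint_tonelli mFj)//.
apply: (@le_trans _ _ (\int[leb]_(t in I01) (C%:E * \int[m]_x (F x `^ q)))).
  apply: ge0_le_integral_ae => //.
  - by move=> t; exact: integral_ge0.
  - by move=> t; rewrite mule_ge0// ?lee_fin// integral_ge0.
  apply: nearW => t; rewrite /= in_itv/= => t01.
  exact: (HC t t01 (fun x => F x `^ q)).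
have : 0 <= C%:E * \int[m]_x (F x `^ q) by rewrite mule_ge0// ?lee_fin// integral_ge0.
move: (C%:E * _) => [r| |]// _; last exact: leey.
have leb1 : leb I01 = 1 by rewrite lebesgue_measure_itv/= lte_fin ltr01 oppr0 adde0.
by apply: (@le_trans _ _ (r%:E * leb I01)); [rewrite integral_cst|rewrite leb1 mule1].
Qed.

End test_plan_theory.

(** * Measurability of [AC] and stopped test plans *)

Section stopped_plans.
Context {R : realType} {X : completeMetricType R}.
Hypothesis (sepX : separable_space X).
Local Notation leb := (@lebesgue_measure R).
Local Notation I01 := (`[(0 : R), (1 : R)]%classic).
Local Open Scope ereal_scope.

Lemma mdist_le_mspeed (c : curve X) s t : absolutely_continuous_curve c ->
  (0 <= s)%R -> (s <= t)%R -> (t <= 1)%R ->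
  (mdist (c s) (c t))%:E <= \int[leb]_(r in `[s, t]) mspeed c r.
Proof.
move=> acc s0 st t1; have [m [mint m0 mb mae]] := metric_speed_ae sepX acc.
have -> : \int[leb]_(r in `[s, t]) mspeed c r = \int[leb]_(r in `[s, t]) (m r)%:E.
  apply: ge0_eq_integral_ae => //.
  - by move=> x; exact: mspeed_ge0.
  - apply: ae_mono mae => r mr; rewrite /= in_itv/= => /andP[sr rt].
    have r01 : I01 r by rewrite /= in_itv/= (le_trans s0 sr) (le_trans rt t1).
    by have [] := mr r01.
have mi A : measurable A -> leb.-integrable A (EFin \o m).
  by move=> mA; apply: integrableS mint.
apply: (@le_trans _ _ (\int[leb]_(r in `]s, t]) (m r)%:E)).
  have := mb s t s0 st t1; rewrite -lee_fin /Rintegral fineK//.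
  by apply: integrable_fin_num => //; exact: mi.
apply: ge0_subset_integral => //.
- by have /integrableP[] := mi `[s, t]%classic ltac:(by []).
- by move=> x _; rewrite lee_fin.
- by move=> x /=; rewrite !in_itv/= => /andP[/ltW -> ->].
Qed.

(** Rational times suffice: real times are approached from inside, where the integral can only be
    smaller and the distance is nearly the same by continuity. *)
Lemma mspeed_absolutely_continuous (c : curve X) :
  \int[leb]_(r in I01) mspeed c r < +oo ->
  (forall a b : rat,
    (0 <= ratr a :> R)%R -> (ratr a <= ratr b :> R)%R -> (ratr b <= 1 :> R)%R ->
    (mdist (c (ratr a)) (c (ratr b)))%:E <=
      \int[leb]_(r in `[ratr a, ratr b]) mspeed c r) ->
  absolutely_continuous_curve c.
Proof.
move=> mfin H.
have mm : measurable_fun I01 (mspeed c).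
  exact: measurable_funTS (measurable_mspeed_time c).
have mint : leb.-integrable I01 (mspeed c).
  apply/integrableP; split => //.
  by under eq_integral do rewrite gee0_abs ?mspeed_ge0//.
have fae : {ae leb, forall r, I01 r -> mspeed c r \is a fin_num}.
  by apply: integrable_ae.
have finI A : measurable A -> A `<=` I01 ->
    \int[leb]_(r in A) (fine (mspeed c r))%:E = \int[leb]_(r in A) mspeed c r.
  move=> mA AI; apply: ge0_eq_integral_ae => //.
  - by move=> x; rewrite lee_fin fine_ge0// mspeed_ge0.
  - by move=> x; exact: mspeed_ge0.
  - by apply: ae_mono fae => r fr Ar; rewrite fineK// fr//; exact: AI.
have sub s t : (0 <= s)%R -> (t <= 1)%R -> `[s, t]%classic `<=` I01.
  by move=> s0 t1 x /=; rewrite !in_itv/= => /andP[sx xt]; rewrite (le_trans s0)//(le_trans xt).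
exists (fine \o mspeed c).
  apply/integrableP; split.
    by apply/measurable_EFinP; apply: measurableT_comp.
  under eq_integral do rewrite /= ger0_norm ?fine_ge0 ?mspeed_ge0//.
  by rewrite finI.
move=> s t s0 st t1; rewrite /= finI//; last exact: sub.
have := st; rewrite le_eqVlt => /predU1P[<-|{}st].
  by rewrite mdistxx integral_ge0// => x _; exact: mspeed_ge0.
rewrite leNgt; apply/negP => lt_I.
pose I := \int[leb]_(r in `[s, t]) mspeed c r.
have Ifin : I \is a fin_num.
  rewrite ge0_fin_numE; last by apply: integral_ge0 => x _; exact: mspeed_ge0.
  apply: le_lt_trans mfin; apply: ge0_subset_integral => //; last exact: sub.
  by move=> x _; exact: mspeed_ge0.
have near_curve u (e : R) : (0 < e)%R -> exists2 d : R, (0 < d)%R &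
    forall a, (`|u - a| < d)%R -> (mdist (c u) (c a) < e)%R.
  move=> e0; have := @curve_continuous _ _ c u _ (nbhsx_ballx (c u) e e0).
  move=> [d /= d0 dP]; exists d => // a ua; have := dP a ua.
  by rewrite /= ballEmdist.
pose d := (mdist (c s) (c t) - fine I)%R.
have d0 : (0 < d)%R by rewrite /d subr_gt0 -lte_fin fineK.
have [d1 d10 d1P] := near_curve s (d / 2)%R ltac:(lra).
have [d2 d20 d2P] := near_curve t (d / 2)%R ltac:(lra).
(* The midpoint of s and t keeps the rational [a] below the rational [b]. *)
have [a /itvP aP] : exists a : rat, (ratr a : R) \in `]s, (Num.min (s + d1) ((s + t) / 2))%R[.
  by apply: rat_in_itvoo; rewrite lt_min; apply/andP; split; lra.
have [b /itvP bP] : exists b : rat, (ratr b : R) \in `](Num.max (t - d2) ((s + t) / 2))%R, t[.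
  by apply: rat_in_itvoo; rewrite gt_max; apply/andP; split; lra.
have sa : (s < ratr a)%R by rewrite aP.
have bt : (ratr b < t)%R by rewrite bP.
have : (ratr a < Num.min (s + d1) ((s + t) / 2))%R by rewrite aP.
rewrite lt_min => /andP[a1 a2].
have : (Num.max (t - d2) ((s + t) / 2) < ratr b)%R by rewrite bP.
rewrite gt_max => /andP[b1 b2].
have : (mdist (c (ratr a)) (c (ratr b)))%:E <= I.
  apply: le_trans (H a b _ _ _) _; [lra|lra|lra|].
  apply: ge0_subset_integral => //.
  - exact: measurable_funTS (measurable_mspeed_time c).
  - by move=> x _; exact: mspeed_ge0.
  - by move=> x; rewrite /= !in_itv/= => /andP[? ?]; apply/andP; split; lra.
rewrite -[I]fineK// lee_fin => abI.
have m1 : (mdist (c s) (c (ratr a)) < d / 2)%R.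
  by apply: d1P; rewrite ltr_norml; apply/andP; split; lra.
have m2 : (mdist (c (ratr b)) (c t) < d / 2)%R.
  by rewrite metric_sym; apply: d2P; rewrite ltr_norml; apply/andP; split; lra.
have := metric_triangle (c s) (c (ratr a)) (c t).
have := metric_triangle (c (ratr a)) (c (ratr b)) (c t).
rewrite /d in m1 m2; lra.
Qed.

Lemma measurable_line_integral_on (F : X -> \bar R) (s t : R) :
  measurable_fun setT (F : borel X -> \bar R) -> (forall x, 0 <= F x) ->
  (0 <= s)%R -> (t <= 1)%R ->
  measurable_fun setT ((fun c : curve X =>
    \int[leb]_(r in `[s, t]) (F (c r) * mspeed c r)) : borel (curve X) -> \bar R).
Proof.
move=> mF F0 s0 t1.
pose f (z : borel (curve X) * measurableTypeR R) :=
  F ((z.1 : curve X) z.2) * mspeed z.1 z.2 * (\1_`[s, t] z.2)%:E.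
have f0 z : 0 <= f z.
  by rewrite /f mule_ge0// ?mule_ge0// ?mspeed_ge0// lee_fin.
have mf : measurable_fun setT f.
  apply: emeasurable_funM.
    apply: emeasurable_funM; last exact: measurable_mspeed.
    exact: measurableT_comp mF measurable_eval_joint.
  apply/measurable_EFinP.
    apply: (@measurableT_comp _ _ _ _ _ _ (\1_`[s, t] : measurableTypeR R -> R)) => //.
have := measurable_joint_integral mf f0.
congr measurable_fun; apply/funext => c.
rewrite [LHS](_ : _ = \int[leb]_(r in I01) (((fun r => F (c r) * mspeed c r) \_ `[s, t]) r)).
  rewrite -integral_mkcondr setIidr// => x /=.
  by rewrite !in_itv/= => /andP[sx xt]; rewrite (le_trans s0)//(le_trans xt).
by apply: eq_integral => r _; rewrite epatch_indic.
Qed.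

(** Replaces the existence of a dominating function by countably many inequalities between
    measurable functions of the curve: the speed itself dominates. *)
Lemma AC_mspeedP p (c : curve X) : (1 <= p)%R -> Defs.AC p c <->
  (forall ab : rat * rat, (0 <= ratr ab.1 :> R)%R -> (ratr ab.1 <= ratr ab.2 :> R)%R ->
    (ratr ab.2 <= 1 :> R)%R ->
    (mdist (c (ratr ab.1)) (c (ratr ab.2)))%:E <=
      \int[leb]_(r in `[ratr ab.1, ratr ab.2]) mspeed c r) /\
  \int[leb]_(t in I01) (mspeed c t `^ p) < +oo.
Proof.
move=> p1; split.
  move=> [acc cfin]; split; last by rewrite -metric_speed_integral.
  by move=> [a b] a0 ab b1; exact: mdist_le_mspeed.
move=> [H cfin].
have acc : absolutely_continuous_curve c.
  apply: mspeed_absolutely_continuous; last by move=> a b; exact: (H (a, b)).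
  (* As [1 <= p], a number is at most 1 plus its [p]-th power, so finite energy on a set of finite
     length gives an integrable speed. *)
  apply: (@le_lt_trans _ _ (\int[leb]_(t in I01) (1 + mspeed c t `^ p))).
    apply: ge0_le_integral_ae => //.
    - by move=> x; exact: mspeed_ge0.
    - by move=> x; rewrite adde_ge0// poweR_ge0.
    - apply: aeW => t _; have := mspeed_ge0 c t.
      case: (mspeed c t) => [r| |]//.
        rewrite lee_fin => r0; rewrite poweR_EFin -EFinD lee_fin.
        have [r1|r1] := leP r 1%R; first by rewrite (le_trans r1)// lerDl powR_ge0.
        have := ler_powR (ltW r1) p1; rewrite powRr1//; lra.
      by move=> _; rewrite poweRyr ?gt_eqF ?(lt_le_trans ltr01)//.
  rewrite ge0_integralD//.
  - rewrite lte_add_pinfty// (_ : \int[leb]_(_ in I01) 1 = leb I01).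
      by rewrite lebesgue_measure_itv/= lte_fin ltr01 -EFinD ltry.
    by rewrite integral_cst// mul1e.
  - by move=> t _; exact: poweR_ge0.
  - apply: measurable_funTS.
    exact: (measurableT_comp (measurable_poweR p) (measurable_mspeed_time c)).
by split=> //; rewrite metric_speed_integral.
Qed.

(** A pushforward plan is known only through preimages of measurable sets, so measurability is what
    allows a stopped plan to be concentrated on [AC p]. *)
Lemma measurable_AC p : (1 <= p)%R -> measurable (Defs.AC p : set (borel (curve X))).
Proof.
move=> p1.
pose A (ab : rat * rat) : set (borel (curve X)) := [set c |
  [/\ (0 <= ratr ab.1 :> R)%R, (ratr ab.1 <= ratr ab.2 :> R)%R & (ratr ab.2 <= 1 :> R)%R] ->
    (mdist ((c : curve X) (ratr ab.1)) ((c : curve X) (ratr ab.2)))%:E <=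
      \int[leb]_(r in `[ratr ab.1, ratr ab.2]) mspeed c r].
rewrite (_ : Defs.AC p = (\bigcap_ab A ab) `&`
    [set c : borel (curve X) | \int[leb]_(t in I01) (mspeed c t `^ p) < +oo]); last first.
  apply/seteqP; split => c.
    by move=> /(AC_mspeedP c p1)[H ?]; split => // ab _ [? ? ?]; exact: H.
  by move=> [H ?]; apply/AC_mspeedP => //; split => // ab a0 ab' b1; apply: (H ab).
apply: measurableI.
  rewrite -[X in measurable X]setCK setC_bigcap (_ : \bigcup_i _ =
    \bigcup_(a : rat) \bigcup_(b : rat) ~` A (a, b)); last first.
    apply/seteqP; split => c; first by move=> [[a b] _ h]; exists a => //; exists b.
    by move=> [a _ [b _ h]]; exists (a, b).
  apply: measurableC; apply: bigcupT_measurable_rat => a.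
  apply: bigcupT_measurable_rat => b; apply: measurableC; rewrite /A/=.
  have [[a0 ab b1]|nab] := pselect
      [/\ (0 <= ratr a :> R)%R, (ratr a <= ratr b :> R)%R & (ratr b <= 1 :> R)%R]; last first.
    rewrite [X in measurable X](_ : _ = setT); first exact: measurableT.
    by apply/seteqP; split => // c _ /nab.
  rewrite (_ : [set _ | _] = setT `&` [set c : borel (curve X) |
    (mdist ((c : curve X) (ratr a)) ((c : curve X) (ratr b)))%:E <=
      \int[leb]_(r in `[ratr a, ratr b]) mspeed c r]); last first.
    by rewrite setTI; apply/seteqP; split => c /=; [apply|].
  apply: emeasurable_fun_le => //.
    apply/measurable_EFinP; apply: borel_continuous_measurable_real.
    by apply: continuous_mdist; exact: continuous_eval.
  have := @measurable_line_integral_on (cst 1) (ratr a) (ratr b) (measurable_cst 1)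
    (fun=> lee01) a0 b1.
  by congr measurable_fun; apply/funext => c; under eq_integral do rewrite mul1e.
rewrite -[X in measurable X]setTI; apply: emeasurable_fun_infty_o => //.
apply: (measurable_joint_integral (f := fun z => mspeed z.1 z.2 `^ p)).
  exact: (measurableT_comp (measurable_poweR p) measurable_mspeed).
by move=> z; exact: poweR_ge0.
Qed.
End stopped_plans.

Lemma distribution_negligible d d' (T : measurableType d) (T' : measurableType d')
    (R : realType) (P : probability T R) (phi : {mfun T >-> T'}) (M : set T) (N : set T') :
  measurable N -> (forall x, N (phi x) -> M x) -> P.-negligible M ->
  (distribution P phi).-negligible N.
Proof.
move=> mN NM /(negligibleS NM) nM; apply/(negligibleP _ mN).
have := measurable_funP phi measurableT N mN; rewrite setTI => mphiN.
exact: measure_negligible mphiN nM.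
Qed.

Section stopped_plan.
Context {R : realType} {X : completeMetricType R}.
Variables (m : {measure set (borel X) -> \bar R}) (p : R).
Hypotheses (sepX : separable_space X) (p1 : 1 <= p).
Local Notation leb := (@lebesgue_measure R).
Local Notation I01 := (`[(0 : R), (1 : R)]%classic).
Variables (s t : R) (s0 : 0 <= s) (st : s <= t) (t1 : t <= 1).
Local Open Scope ereal_scope.

(** The stopped curve moves like [c] inside [s, t] and rests outside; the two end times form a null
    set. *)
Lemma stop_curve_line_integral (F : X -> \bar R) (c : curve X) :
  absolutely_continuous_curve c -> (forall x, 0 <= F x) ->
  line_integral F (stop_curve s0 st t1 c) =
  \int[leb]_(r in `[s, t]) (F (c r) * mspeed c r).
Proof.
move=> acc F0; rewrite /line_integral -line_integralE//; last exact: stop_curve_ac.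
have acE : {ae leb, forall r, I01 r -> metric_speed c r = mspeed c r}.
  have [v [_ _ _]] := metric_speed_ae sepX acc.
  by apply: ae_mono => r vr r01; have [-> ->] := vr r01.
have neq u : {ae leb, forall r : R, r != u}.
  exists [set u]; split => //; first exact: lebesgue_measure_set1.
  by move=> r /= /negP; rewrite negbK => /eqP.
have -> : \int[leb]_(r in `[s, t]) (F (c r) * mspeed c r) =
    \int[leb]_(r in I01) (((fun r => F (c r) * mspeed c r) \_ `[s, t]) r).
  rewrite -integral_mkcondr setIidr// => x /=.
  by rewrite !in_itv/= => /andP[sx xt]; rewrite (le_trans s0)//(le_trans xt).
apply: ge0_eq_integral_ae => //.
- by move=> r; rewrite mule_ge0// metric_speed_ge0.
- by move=> r; apply: erestrict_ge0 => ? _; rewrite mule_ge0// mspeed_ge0.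
- apply: ae_mono3 acE (neq s) (neq t) => r er rs rt r01; rewrite patchE.
  case: ifPn => [|].
    rewrite inE/= in_itv/= => /andP[sr rt'].
    have sr' : (s < r)%R by rewrite lt_neqAle eq_sym rs.
    have rt'' : (r < t)%R by rewrite lt_neqAle rt.
    by rewrite stop_curve_speed_in// er//= stop_time_id.
  rewrite notin_setE/= in_itv/= => /negP; rewrite negb_and -!ltNge => h.
  by rewrite stop_curve_speed_out ?mule0//; apply/orP.
Qed.

Lemma stop_curve_energy (c : curve X) :
  \int[leb]_(r in I01) (metric_speed (stop_curve s0 st t1 c) r `^ p) <=
  \int[leb]_(r in I01) (metric_speed c r `^ p).
Proof.
have neq u : {ae leb, forall r : R, r != u}.
  exists [set u]; split => //; first exact: lebesgue_measure_set1.
  by move=> r /= /negP; rewrite negbK => /eqP.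
apply: ge0_le_integral_ae => //.
- by move=> r; exact: poweR_ge0.
- by move=> r; exact: poweR_ge0.
apply: ae_mono2 (neq s) (neq t) => r rs rt r01.
have [sr|rs'] := ltP s r; last first.
  rewrite stop_curve_speed_out; last by left; rewrite lt_neqAle rs.
  by rewrite poweR0r ?poweR_ge0// gt_eqF// (lt_le_trans ltr01).
have [rt'|tr] := ltP r t; first by rewrite stop_curve_speed_in.
rewrite stop_curve_speed_out; last by right; rewrite lt_neqAle eq_sym rt.
by rewrite poweR0r ?poweR_ge0// gt_eqF// (lt_le_trans ltr01).
Qed.

Lemma stop_curve_AC (c : curve X) : Defs.AC p c -> Defs.AC p (stop_curve s0 st t1 c).
Proof.
move=> [acc cfin]; split; first exact: stop_curve_ac.
exact: le_lt_trans (stop_curve_energy c) cfin.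
Qed.

Variable pi : probability (borel (curve X)) R.
Hypothesis hpi : test_plan m p pi.

Let stop : borel (curve X) -> borel (curve X) := stop_curve s0 st t1.
Let mstop_mixin := isMeasurableFun.Build _ _ _ _ stop (measurable_stop_curve s0 st t1).
Let mstop : {mfun _ >-> _} := HB.pack stop mstop_mixin.

Definition stopped_plan : probability (borel (curve X)) R := distribution pi mstop.

Lemma ae_stopped_plan (P : curve X -> Prop) :
  {ae stopped_plan, forall c, P c} -> {ae pi, forall c, P (stop_curve s0 st t1 c)}.
Proof. by apply: ae_pushforward; exact: measurable_stop_curve. Qed.

Let stopped_plan_AC : stopped_plan.-negligible (~` Defs.AC p).
Proof.
have [nAC _ _] := hpi; apply: distribution_negligible nAC.
  by apply: measurableC; exact: measurable_AC.
by move=> c nc cAC; apply: nc; exact: stop_curve_AC.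
Qed.

(** Stopping does not increase the energy, and the marginal at time [r] is that of [pi] at time
    [stop_time s t r], so the same constant [C] serves. *)
Lemma stopped_plan_test : test_plan m p stopped_plan.
Proof.
split => //.
  apply: (@le_lt_trans _ _ (\int[stopped_plan]_c \int[leb]_(t in I01) (mspeed c t `^ p))).
    apply: ge0_le_integral_ae => //.
    - by move=> c; apply: integral_ge0 => r _; exact: poweR_ge0.
    - by move=> c; apply: integral_ge0 => r _; exact: poweR_ge0.
    by apply: ae_mono stopped_plan_AC => c [cac _] _; rewrite metric_speed_integral.
  rewrite ge0_integral_distribution//; last 2 first.
  - apply: (measurable_joint_integral (f := fun z => mspeed z.1 z.2 `^ p)).
      exact: (measurableT_comp (measurable_poweR p) measurable_mspeed).
    by move=> z; exact: poweR_ge0.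
  - by move=> c; apply: integral_ge0 => r _; exact: poweR_ge0.
  have [_ E _] := hpi; apply: le_lt_trans E; apply: ge0_le_integral_ae => //.
  - by move=> c; apply: integral_ge0 => r _; exact: poweR_ge0.
  - by move=> c; apply: integral_ge0 => r _; exact: poweR_ge0.
  apply: ae_mono (test_plan_AC hpi) => c [cac _] _.
  rewrite /= -metric_speed_integral//; last exact: stop_curve_ac.
  exact: stop_curve_energy.
have [_ _ [C HC]] := hpi; exists C => r /andP[r0 r1] B mB.
have := HC (stop_time s t r) _ B mB; apply.
by have /andP[a b] := stop_time_itv st r; rewrite (le_trans s0)// (le_trans b).
Qed.

End stopped_plan.

Section wug_characterisation.
Context {R : realType} {X : completeMetricType R}.
Variables (m : {measure set (borel X) -> \bar R}) (q : R).
Hypotheses (sepX : separable_space X) (q1 : 1 < q).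
Local Notation leb := (@lebesgue_measure R).
Local Notation I01 := (`[(0 : R), (1 : R)]%classic).
Local Notation p := (conjugate_exponent q).
Local Notation wug := (weak_upper_gradient m q).
Local Open Scope ereal_scope.

(** One exceptional set has to serve all plans; the set of all curves that violate the inequality
    does, since each plan sees it as negligible. *)
Lemma weak_upper_gradientP (f : X -> R) (g : X -> \bar R) :
  measurable_fun setT (g : borel X -> \bar R) -> (forall x, 0 <= g x) ->
  wug f g <-> forall pi, test_plan m p pi ->
    {ae pi, forall c : curve X, `|f (c 1%R) - f (c 0%R)|%:E <= line_integral g c < +oo}.
Proof.
move=> mg g0; split.
  move=> [_ _ [G nG HG]] pi hpi.
  have aeG : {ae pi, forall c : curve X, ~ G c}.
    by have [A [mA A0 GA]] := nG pi hpi; exists A; split => // c /= /contrapT; exact: GA.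
  apply: ae_mono2 aeG (test_plan_AC hpi) => c Gc [cac _].
  by have := HG c Gc; rewrite line_integralE.
move=> H; split => //.
exists [set c : curve X | ~ (`|f (c 1%R) - f (c 0%R)|%:E <=
    \int[leb]_(t in I01) (g (c t) * metric_speed c t) < +oo)]; last first.
  by move=> c /= /contrapT.
move=> pi hpi.
suff : {ae pi, forall c : curve X, `|f (c 1%R) - f (c 0%R)|%:E <=
    \int[leb]_(t in I01) (g (c t) * metric_speed c t) < +oo} by [].
apply: ae_mono2 (H pi hpi) (test_plan_AC hpi) => c Hc [cac _].
by rewrite line_integralE.
Qed.

(** The endpoint inequality is applied to the stopped plan, whose curves run from [c s] to [c t]. *)
Lemma weak_upper_gradient_segment (f : X -> R) (g : X -> \bar R) pi (s t : R) :
  wug f g -> test_plan m p pi -> (0 <= s)%R -> (s <= t)%R -> (t <= 1)%R ->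
  {ae pi, forall c : curve X, `|f (c t) - f (c s)|%:E <=
     \int[leb]_(r in `[s, t]) (g (c r) * mspeed c r)}.
Proof.
move=> gf hpi s0 st t1; have [mg g0 _] := gf.
have p1 : (1 <= p)%R by rewrite ltW// conjugate_exponent_gt1.
have := (weak_upper_gradientP f mg g0).1 gf _ (stopped_plan_test sepX p1 s0 st t1 hpi).
move=> /ae_stopped_plan; apply: ae_mono2 (test_plan_AC hpi) => c [cac _] /andP[+ _].
by rewrite stop_curve_line_integral//= stop_time_ge// stop_time_le.
Qed.

End wug_characterisation.

Section ae_exists_small.
Context d (T : measurableType d) {R : realType} (mu : {measure set T -> \bar R}).
Local Open Scope ereal_scope.

(** The pointwise infimum over [n] has an integral below every positive number, so it vanishes
    almost everywhere. *)
Lemma ae_exists_small (Z : nat -> T -> \bar R) :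
  (forall n, measurable_fun setT (Z n)) -> (forall n x, 0 <= Z n x) ->
  (forall e : R, (0 < e)%R -> exists n, \int[mu]_x Z n x <= e%:E) ->
  {ae mu, forall x, forall e : R, (0 < e)%R -> exists n, Z n x < e%:E}.
Proof.
move=> mZ Z0 Zs; pose I x := ereal_inf (range (Z ^~ x)).
have mI : measurable_fun setT I.
  have -> : I = fun x => einfs (Z ^~ x) 0%N.
    apply/funext => x; rewrite /einfs /sdrop /I; congr ereal_inf.
    by apply/seteqP; split => _ [n _ <-]; exists n.
  exact: measurable_fun_einfs.
have I0 x : 0 <= I x by apply: le_ereal_inf_tmp => _ [n _ <-].
have int0 : \int[mu]_x `|I x| = 0.
  under eq_integral do rewrite gee0_abs//.
  apply/eqP; rewrite eq_le integral_ge0// andbT.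
  apply/lee_addgt0Pr => e e0; rewrite add0e; have [n Zn] := Zs e e0.
  apply: le_trans Zn; apply: ge0_le_integral_ae => //; apply: aeW => x _.
  by apply: ereal_inf_lbound; exists n.
have := (ae_eq_integral_abs mu measurableT mI).1 int0.
apply: ae_mono => x /(_ Logic.I) Ix e e0.
have : I x < e%:E by rewrite Ix lte_fin.
by move=> /ereal_inf_lt[_ [n _ <-] ?]; exists n.
Qed.

Lemma ge0_le_integral_eq (a b : T -> \bar R) :
  measurable_fun setT a -> measurable_fun setT b ->
  (forall x, 0 <= a x) -> (forall x, a x <= b x) -> (forall x, b x \is a fin_num) ->
  \int[mu]_x b x <= \int[mu]_x a x -> \int[mu]_x a x < +oo ->
  {ae mu, forall x, a x = b x}.
Proof.
move=> ma mb a0 ab bfin ba afin.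
have afin' x : a x \is a fin_num.
  by rewrite ge0_fin_numE// (le_lt_trans (ab x))// -ge0_fin_numE// (le_trans (a0 x)).
have d0 x : 0 <= b x - a x by rewrite sube_ge0// afin'.
have md : measurable_fun setT (fun x => b x - a x) by exact: emeasurable_funB.
have : \int[mu]_x a x + \int[mu]_x (b x - a x) <= \int[mu]_x a x + 0.
  rewrite -ge0_integralD// adde0; apply: le_trans ba.
  by under eq_integral do rewrite addeC subeK//.
rewrite leeD2lE; last by rewrite ge0_fin_numE// integral_ge0.
move=> di; have di0 : \int[mu]_x `|b x - a x| = 0.
  by under eq_integral do rewrite gee0_abs//; apply/eqP; rewrite eq_le di integral_ge0.
have := (ae_eq_integral_abs mu measurableT md).1 di0.
apply: ae_mono => x /(_ I) /eqP; rewrite sube_eq ?add0e//.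
by move=> /eqP.
Qed.

End ae_exists_small.

(** * Calculus of weak upper gradients and the minimal one *)

Section wug_calculus.
Context {R : realType} {X : completeMetricType R}.
Variables (m : {measure set (borel X) -> \bar R}) (q : R).
Hypotheses (sepX : separable_space X) (q1 : 1 < q).
Local Notation leb := (@lebesgue_measure R).
Local Notation I01 := (`[(0 : R), (1 : R)]%classic).
Local Notation p := (conjugate_exponent q).
Local Notation wug := (weak_upper_gradient m q).
Local Notation mfun f := (measurable_fun setT (f : borel X -> _)).
Local Open Scope ereal_scope.

Lemma le_line_integral (F G : X -> \bar R) (c : curve X) :
  (forall x, 0 <= F x) -> (forall x, F x <= G x) -> line_integral F c <= line_integral G c.
Proof.
move=> F0 FG; apply: ge0_le_integral_ae => //.
- by move=> t; rewrite mule_ge0// mspeed_ge0.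
- by move=> t; rewrite mule_ge0 ?mspeed_ge0// (le_trans (F0 _) (FG _)).
by apply: aeW => t _; rewrite lee_wpmul2r// mspeed_ge0.
Qed.

Lemma line_integralD (F G : X -> \bar R) (c : curve X) : mfun F -> mfun G ->
  (forall x, 0 <= F x) -> (forall x, 0 <= G x) ->
  line_integral (F \+ G) c = line_integral F c + line_integral G c.
Proof.
move=> mF mG F0 G0; rewrite /line_integral -ge0_integralD//.
- by apply: eq_integral => t _; rewrite ge0_muleDl.
- by move=> t _; rewrite mule_ge0// mspeed_ge0.
- apply: measurable_funTS; apply: emeasurable_funM; last exact: measurable_mspeed_time.
  exact: measurable_curve_time.
- by move=> t _; rewrite mule_ge0// mspeed_ge0.
- apply: measurable_funTS; apply: emeasurable_funM; last exact: measurable_mspeed_time.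
  exact: measurable_curve_time.
Qed.

Lemma line_integralZ (a : R) (F : X -> \bar R) (c : curve X) : (0 <= a)%R -> mfun F ->
  (forall x, 0 <= F x) ->
  line_integral (fun x => a%:E * F x) c = a%:E * line_integral F c.
Proof.
move=> a0 mF F0; rewrite /line_integral -ge0_integralZl//.
- by apply: eq_integral => t _; rewrite muleA.
- apply: measurable_funTS; apply: emeasurable_funM; last exact: measurable_mspeed_time.
  exact: measurable_curve_time.
- by move=> t _; rewrite mule_ge0// mspeed_ge0.
Qed.

Lemma wugD f1 f2 g1 g2 : wug f1 g1 -> wug f2 g2 -> wug (f1 \+ f2)%R (g1 \+ g2).
Proof.
move=> w1 w2; have [m1 p1 _] := w1; have [m2 p2 _] := w2.
apply/(weak_upper_gradientP m q sepX) => //; first exact: emeasurable_funD.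
  by move=> x; rewrite adde_ge0.
move=> pi hpi.
have := (weak_upper_gradientP m q sepX f1 m1 p1).1 w1 pi hpi.
have := (weak_upper_gradientP m q sepX f2 m2 p2).1 w2 pi hpi.
apply: ae_mono2 => c /andP[i2 l2] /andP[i1 l1]; rewrite line_integralD// lte_add_pinfty// andbT.
apply: le_trans (leeD i1 i2); rewrite -EFinD lee_fin.
by rewrite (_ : _ - _ = (f1 (c 1) - f1 (c 0)) + (f2 (c 1) - f2 (c 0)))%R ?ler_normD//=; ring.
Qed.

Lemma wugZ a f g : wug f g -> wug (fun x => a * f x)%R (fun x => `|a|%:E * g x).
Proof.
move=> w; have [mg g0 _] := w.
apply/(weak_upper_gradientP m q sepX) => //; first exact: measurable_funeM.
  by move=> x; rewrite mule_ge0.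
move=> pi hpi; have := (weak_upper_gradientP m q sepX f mg g0).1 w pi hpi.
apply: ae_mono => c /andP[i l]; rewrite line_integralZ// lte_mul_pinfty// andbT.
by rewrite -mulrBr normrM EFinM lee_wpmul2l.
Qed.

Lemma plan_line_integral_lty pi (F : X -> \bar R) : test_plan m p pi -> mfun F ->
  (forall x, 0 <= F x) -> \int[m]_x (F x `^ q) < +oo ->
  {ae pi, forall c : curve X, line_integral F c < +oo}.
Proof.
move=> hpi mF F0 Fq.
have [C C0 HC] := plan_line_integral hpi q1 (erefl p).
have {}HC := HC F mF F0 1%R ltr01.
have fin : \int[pi]_c line_integral F c < +oo.
  apply: (le_lt_trans HC); rewrite lte_add_pinfty ?lte_mul_pinfty ?lee_fin ?powR_ge0 ?mulr_ge0 ?powR_ge0//.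
  exact: test_plan_energy sepX _ hpi.
have := @integrable_ae _ _ _ pi _ measurableT (line_integral F).
have int : pi.-integrable setT (line_integral F).
  apply/integrableP; split; first exact: measurable_line_integral.
  by under eq_integral do rewrite gee0_abs ?line_integral_ge0//.
move=> /(_ int); apply: ae_mono => c /(_ I).
by rewrite ge0_fin_numE ?line_integral_ge0.
Qed.


Lemma poweR_lt_powR (x : \bar R) (d : R) : 0 <= x -> (0 < d)%R ->
  x `^ q < (d `^ q)%:E -> x < d%:E.
Proof.
move=> x0 d0 xd; rewrite ltNge; apply/negP => dx; move: xd; apply/negP; rewrite -leNgt.
rewrite -poweR_EFin; apply: gt0_ler_poweR => //; first by rewrite ltW// (lt_trans _ q1).
  by rewrite in_itv/= leey lee_fin ltW.
by rewrite in_itv/= leey x0.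
Qed.

(* Fuglede's lemma.  Instead of extracting a fast subsequence, it is enough that
   almost every curve sees arbitrarily small errors along the sequence. *)
Lemma approx_wug (f h : X -> R) : mfun f -> mfun h ->
  \int[m]_x (`|h x|%:E `^ q) < +oo ->
  (forall e : R, (0 < e)%R -> exists v k : X -> R,
    [/\ is_lipschitz v /\ mfun k, forall x, Lip_a v x <= (k x)%:E,
      \int[m]_x (`|v x - f x|%:E `^ q) <= e%:E &
      \int[m]_x (`|k x - h x|%:E `^ q) <= e%:E]) ->
  wug f (fun x => `|h x|%:E).
Proof.
move=> mf mh hq H.
have mabs (u : X -> R) : mfun u -> mfun (fun x => `|u x|%:E).
  by move=> mu; apply/measurable_EFinP; exact: measurableT_comp.
have mpow (u : X -> R) : mfun u -> mfun (fun x => `|u x|%:E `^ q).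
  by move=> mu; exact: (measurableT_comp (measurable_poweR q) (mabs u mu)).
apply/(weak_upper_gradientP m q sepX) => //; first exact: mabs.
move=> pi hpi.
have Hn (n : nat) : exists vk : (X -> R) * (X -> R),
    [/\ is_lipschitz vk.1 /\ mfun vk.2, forall x, Lip_a vk.1 x <= (vk.2 x)%:E,
      \int[m]_x (`|vk.1 x - f x|%:E `^ q) <= (n.+1%:R^-1 : R)%:E &
      \int[m]_x (`|vk.2 x - h x|%:E `^ q) <= (n.+1%:R^-1 : R)%:E].
  by have [//|v [k ?]] := H (n.+1%:R^-1)%R; exists (v, k).
have {Hn} [vk vkP] := choice Hn.
pose v n := (vk n).1; pose k n := (vk n).2.
have lipv n : is_lipschitz (v n) by have [[]] := vkP n.
have mk n : mfun (k n) by have [[]] := vkP n.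
have mv n : mfun (v n) by exact: measurable_lipschitz.
have Lk n x : Lip_a (v n) x <= (k n x)%:E by have [] := vkP n.
have mvf n : mfun (fun x => v n x - f x)%R by exact: measurable_funB.
have mkh n : mfun (fun x => k n x - h x)%R by exact: measurable_funB.
(* All errors of the passage from [v n] to [f] on one curve: those of the function at both ends and
   that of the slope majorant along the curve. *)
pose Z n (c : borel (curve X)) : \bar R :=
  `|v n ((c : curve X) 0%R) - f ((c : curve X) 0%R)|%:E `^ q +
  `|v n ((c : curve X) 1%R) - f ((c : curve X) 1%R)|%:E `^ q +
  line_integral (fun x => `|k n x - h x|%:E) c.
have mZ n : measurable_fun setT (Z n).
  apply: emeasurable_funD; last first.
    by apply: measurable_line_integral => //; exact: mabs.
  apply: emeasurable_funD.
    exact: (measurableT_comp (mpow _ (mvf n)) (measurable_eval 0%R)).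
  exact: (measurableT_comp (mpow _ (mvf n)) (measurable_eval 1%R)).
have Z0 n c : 0 <= Z n c.
  by apply: adde_ge0; [rewrite adde_ge0// poweR_ge0|exact: line_integral_ge0].
have Zs (e : R) : (0 < e)%R -> exists n, \int[pi]_c Z n c <= e%:E.
  move=> e0; have [C C0 HC] := test_plan_eval hpi.
  have [C' C'0 HC'] := plan_line_integral hpi q1 (erefl p).
  have Efin := test_plan_energy sepX hpi.
  set E := integral _ _ _ in Efin HC'.
  have E0 : 0 <= E by apply: integral_ge0 => c _; apply: integral_ge0 => t _; exact: poweR_ge0.
  have Er : E = (fine E)%:E by rewrite fineK// ge0_fin_numE.
  have e'0 : (0 <= fine E)%R by exact: fine_ge0.
  (* The term [2 * fine E / e] brings the energy part below [e / 2]. The added 1 gives [1 <= lam],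
     so that the power of [lam^-1] is at most [lam^-1]. *)
  pose lam : R := (1 + 2 * fine E / e)%R.
  have lam1 : (1 <= lam)%R by rewrite /lam lerDl mulr_ge0// ?invr_ge0 ?mulr_ge0// ltW.
  have lam0 : (0 < lam)%R by exact: lt_le_trans lam1.
  have lamE : (lam^-1 `^ p)%:E * E <= (e / 2)%:E.
    rewrite Er -EFinM lee_fin; apply: (@le_trans _ _ (lam^-1 * fine E)%R).
      apply: ler_wpM2r => //; apply: ge1r_powR.
        by rewrite invr_gt0 lam0 invf_le1.
      by rewrite ltW// conjugate_exponent_gt1.
    rewrite mulrC ler_pdivrMr// /lam mulrDr mulr1 (_ : e / 2 * (2 * fine E / e) = fine E)%R.
      by rewrite lerDr; lra.
    by field; rewrite gt_eqF.
  (* Collects the constants in front of [n.+1%:R^-1]: two end times and one line integral. As [lam]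
     is fixed by now, [n] can be taken large. *)
  pose D : R := (2 * C + C' * lam `^ q)%R.
  have D0 : (0 <= D)%R by rewrite /D addr_ge0// mulr_ge0// powR_ge0.
  have [n Dn] : exists n : nat, (D / (e / 2) < n.+1%:R)%R.
    by exists (Num.truncn (D / (e / 2))); exact: truncnS_gt.
  have {}Dn : (D * n.+1%:R^-1 <= e / 2)%R.
    by rewrite ler_pdivrMr// mulrC -ler_pdivrMr ?ltW// divr_gt0.
  have [_ _ vn kn] := vkP n; exists n.
  have mZ1 t : measurable_fun setT (fun c : borel (curve X) =>
      `|v n ((c : curve X) t) - f ((c : curve X) t)|%:E `^ q).
    exact: (measurableT_comp (mpow _ (mvf n)) (measurable_eval t)).
  have mZ2 : measurable_fun setT (line_integral (fun x => `|k n x - h x|%:E) : borel (curve X) -> _).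
    by apply: measurable_line_integral => //; exact: mabs.
  rewrite /Z ge0_integralD; last 5 first.
  - exact: measurableT.
  - by move=> c _; rewrite adde_ge0// poweR_ge0.
  - by apply: emeasurable_funD; exact: mZ1.
  - by move=> c _; exact: line_integral_ge0.
  - exact: mZ2.
  rewrite ge0_integralD; last 5 first.
  - exact: measurableT.
  - by move=> c _; rewrite poweR_ge0.
  - exact: mZ1.
  - by move=> c _; rewrite poweR_ge0.
  - exact: mZ1.
  have ev t : (0 <= t <= 1)%R -> \int[pi]_c (`|v n ((c : curve X) t) - f ((c : curve X) t)|%:E `^ q)
      <= (C * n.+1%:R^-1)%:E.
    move=> t01; apply: (le_trans (HC t t01 _ (mpow _ (mvf n)) (fun x => poweR_ge0 _ _))).
    by rewrite EFinM lee_wpmul2l// lee_fin.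
  have li : \int[pi]_c line_integral (fun x => `|k n x - h x|%:E) c <=
      (C' * lam `^ q * n.+1%:R^-1 + e / 2)%:E.
    apply: (le_trans (HC' _ (mabs _ (mkh n)) _ _ lam0)) => //.
    rewrite EFinD; apply: leeD => //; rewrite [leRHS]EFinM lee_wpmul2l//.
    by rewrite lee_fin mulr_ge0// powR_ge0.
  apply: (le_trans (leeD (leeD (ev 0%R _) (ev 1%R _)) li)).
  - by rewrite lexx ler01.
  - by rewrite lexx ler01.
  have sumE (a b N e' : R) : (a * N + a * N + (b * N + e') = (2 * a + b) * N + e')%R by ring.
  by rewrite -!EFinD lee_fin sumE -/D [leRHS](splitr e) lerD2r.
have := ae_exists_small mZ Z0 Zs.
apply: ae_mono3 (test_plan_AC hpi) (plan_line_integral_lty hpi (mabs _ mh) _ hq) => //.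
move=> c [cac _] Lfin Zc; rewrite Lfin andbT; apply/lee_addgt0Pr => e e0.
(* One third for each end and one for the line integral. The end terms of [Z] are [q]-th powers,
   hence the minimum of [d] and its power. *)
pose d := (e / 3)%R; have d0 : (0 < d)%R by rewrite /d; lra.
have [n] := Zc (Num.min d (d `^ q))%R ltac:(by rewrite lt_min d0 powR_gt0).
move=> Znc; pose a t := `|v n (c t) - f (c t)|%:E.
have dq : Z n c < (d `^ q)%:E by rewrite (lt_le_trans Znc)// lee_fin ge_min lexx orbT.
have dd : Z n c < d%:E by rewrite (lt_le_trans Znc)// lee_fin ge_min lexx.
have a0 : (`|v n (c 0) - f (c 0)| < d)%R.
  rewrite -lte_fin; apply: poweR_lt_powR => //; apply: le_lt_trans dq.
  by rewrite /Z -addeA leeDl// adde_ge0// ?poweR_ge0// line_integral_ge0.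
have a1 : (`|v n (c 1) - f (c 1)| < d)%R.
  rewrite -lte_fin; apply: poweR_lt_powR => //; apply: le_lt_trans dq.
  by rewrite /Z [X in X + _]addeC -addeA leeDl// adde_ge0// ?poweR_ge0// line_integral_ge0.
have lk : line_integral (fun x => `|k n x - h x|%:E) c < d%:E.
  by apply: le_lt_trans dd; rewrite /Z leeDr// adde_ge0// poweR_ge0.
have vc : `|v n (c 1%R) - v n (c 0%R)|%:E <= d%:E + line_integral (fun x => `|h x|%:E) c.
  apply: le_trans (leeD (ltW lk) (lexx _)).
  rewrite -line_integralD//; [|exact: mabs|exact: mabs].
  apply: (le_trans (Lip_a_upper_gradient sepX cac (lipv n) (Lk n))).
  have k0 x : 0 <= (k n x)%:E := le_trans (Lip_a_ge0 (v n) x) (Lk n x).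
  have -> : \int[leb]_(t in I01) ((k n (c t))%:E * metric_speed c t) =
      line_integral (fun x => (k n x)%:E) c := line_integralE sepX cac k0.
  apply: le_line_integral => // x.
  rewrite /= -EFinD lee_fin; have := ler_norm (k n x - h x)%R; have := ler_norm (h x); lra.
have : `|f (c 1%R) - f (c 0%R)|%:E <= `|v n (c 1%R) - v n (c 0%R)|%:E + (d + d)%:E.
  rewrite -EFinD lee_fin; move: a0 a1; rewrite !ltr_norml => /andP[? ?] /andP[? ?].
  have := lexx `|v n (c 1%R) - v n (c 0%R)|%R; rewrite {1}ler_norml => /andP[? ?].
  by rewrite ler_norml; apply/andP; split; lra.
move=> /le_trans; apply; apply: (le_trans (leeD vc (lexx _))).
by rewrite addeAC -EFinD addeC (_ : d + (d + d) = e)%R // /d; field.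
Qed.


(** On every interval of every uniform partition both segment inequalities hold, for almost every
    curve. The increments of [f] are thus bounded by the smaller of two integrals, and
    [increment_le_integral_min] passes to the integral of the minimum. *)
Lemma wug_min f g1 g2 : wug f g1 -> wug f g2 -> wug f (fun x => mine (g1 x) (g2 x)).
Proof.
move=> w1 w2; have [m1 p1 _] := w1; have [m2 p2 _] := w2.
have p0 x : 0 <= mine (g1 x) (g2 x) by rewrite le_min p1 p2.
apply/(weak_upper_gradientP m q sepX) => //; first exact: measurable_mine.
move=> pi hpi.
have seg g : wug f g -> {ae pi, forall c : curve X, forall Ni : nat * nat, (Ni.2 <= Ni.1)%N ->
    `|f (c (Ni.2.+1%:R / Ni.1.+1%:R)%R) - f (c (Ni.2%:R / Ni.1.+1%:R)%R)|%:E <=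
    \int[leb]_(r in `[(Ni.2%:R / Ni.1.+1%:R)%R, (Ni.2.+1%:R / Ni.1.+1%:R)%R]) (g (c r) * mspeed c r)}.
  move=> wg.
  (* The partition intervals are enumerated through [unpickle] so that their null sets can be
     merged. *)
  have H (k : nat) : {ae pi, forall c : curve X, forall Ni, unpickle k = Some Ni -> (Ni.2 <= Ni.1)%N ->
    `|f (c (Ni.2.+1%:R / Ni.1.+1%:R)%R) - f (c (Ni.2%:R / Ni.1.+1%:R)%R)|%:E <=
    \int[leb]_(r in `[(Ni.2%:R / Ni.1.+1%:R)%R, (Ni.2.+1%:R / Ni.1.+1%:R)%R]) (g (c r) * mspeed c r)}.
    case E : (unpickle k) => [[N i]|]; last by apply: aeW.
    have [iN|iN] := leqP i N; last first.
      by apply: aeW => c _ [<-]/=; rewrite leqNgt iN.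
    have := weak_upper_gradient_segment sepX q1 wg hpi (s := i%:R / N.+1%:R) (t := i.+1%:R / N.+1%:R).
    move=> /(_ _ _ _)/wrap[]; [by rewrite divr_ge0| |by rewrite ler_pdivrMr// mul1r ler_nat|].
      by rewrite ler_pM2r ?ler_nat// invr_gt0.
    by apply: ae_mono => c Hc _ [<-] /=.
  have /ae_foralln : forall k, _ := H.
  by apply: ae_mono => c Hc Ni; apply: (Hc (pickle Ni)); rewrite pickleK.
have A1 := (weak_upper_gradientP m q sepX f m1 p1).1 w1 pi hpi.
have A2 := (weak_upper_gradientP m q sepX f m2 p2).1 w2 pi hpi.
have A12 : {ae pi, forall c : curve X, line_integral g1 c < +oo /\ line_integral g2 c < +oo}.
  by apply: ae_mono2 A1 A2 => c /andP[_ l1] /andP[_ l2].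
apply: ae_mono3 (seg _ w1) (seg _ w2) A12 => c s1 s2 [l1 l2].
have mg g : mfun g -> measurable_fun I01 (fun t : measurableTypeR R => g (c t) * mspeed c t).
  move=> mg; apply: measurable_funTS.
  by apply: emeasurable_funM; [exact: measurable_curve_time|exact: measurable_mspeed_time].
have intg g : mfun g -> (forall x, 0 <= g x) -> line_integral g c < +oo ->
    leb.-integrable I01 (fun t => g (c t) * mspeed c t).
  move=> mg' g0 gl; apply/integrableP; split; first exact: mg.
  by under eq_integral do rewrite gee0_abs ?mule_ge0 ?mspeed_ge0//.
have mI : measurable (I01 : set (measurableTypeR R)) by [].
have i1 := intg _ m1 p1 l1; have i2 := intg _ m2 p2 l2.
apply/andP; split; last first.
  by apply: le_lt_trans l1; apply: le_line_integral => // x; rewrite ge_min lexx.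
(* The partition lemma is about real functions; the integrands are integrable, so taking [fine]
   changes them only on a null set. *)
pose h1 t := fine (g1 (c t) * mspeed c t); pose h2 t := fine (g2 (c t) * mspeed c t).
have f1 := integrable_ae mI i1.
have f2 := integrable_ae mI i2.
have fi g : leb.-integrable I01 (fun t => g (c t) * mspeed c t) ->
    leb.-integrable I01 (EFin \o (fun t => fine (g (c t) * mspeed c t))).
  move=> ig; apply: (le_integrable _ _ _ ig) => //.
    by apply/measurable_EFinP; apply: measurableT_comp => //; exact: measurable_int ig.
  by move=> r _ /=; case: (_ * _) => [y| |]//=; rewrite ?normr0 ?leey.
have seg' g N i : (i <= N)%N -> (forall x, 0 <= g x) ->
    leb.-integrable I01 (fun t => g (c t) * mspeed c t) ->
    `|f (c (i.+1%:R / N.+1%:R)%R) - f (c (i%:R / N.+1%:R)%R)|%:E <=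
    \int[leb]_(r in `[(i%:R / N.+1%:R)%R, (i.+1%:R / N.+1%:R)%R]) (g (c r) * mspeed c r) ->
    (`|f (c (i.+1%:R / N.+1%:R)) - f (c (i%:R / N.+1%:R))| <=
    \int[leb]_(r in `[(i%:R / N.+1%:R), (i.+1%:R / N.+1%:R)]) fine (g (c r) * mspeed c r))%R.
  move=> iN g0 ig; set D := [set` _].
  have mD : measurable (D : set (measurableTypeR R)) by exact: measurable_itv.
  have DI : D `<=` I01.
    move=> r; rewrite /D/= !in_itv/= => /andP[a b]; apply/andP; split.
      by apply: le_trans a; rewrite divr_ge0.
    by apply: (le_trans b); rewrite ler_pdivrMr// mul1r ler_nat.
  rewrite -lee_fin => /le_trans; apply; rewrite /Rintegral fineK; last first.
    by apply: integrable_fin_num => //; apply: integrableS (fi _ ig).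
  apply: ge0_le_integral_ae => //.
  - by move=> r; rewrite mule_ge0// mspeed_ge0.
  - by move=> r; rewrite lee_fin fine_ge0// mule_ge0// mspeed_ge0.
  - by apply: ae_mono (integrable_ae mI ig) => r fr /DI/fr; move=> ?; rewrite fineK.
have := increment_le_integral_min (F := fun t => f (c t)) (fi _ i1) (fi _ i2).
move=> /(_ _)/wrap[].
  move=> N i iN; rewrite le_min; apply/andP; split; apply: seg' => //.
    exact: (s1 (N, i)).
  exact: (s2 (N, i)).
rewrite -lee_fin => /le_trans; apply; rewrite /Rintegral fineK; last first.
  apply: integrable_fin_num => //; apply: (le_integrable _ _ _ (fi _ i1)) => //.
    by apply/measurable_EFinP; apply: measurable_minr;
      [have /measurable_int/measurable_EFinP := fi _ i1|have /measurable_int/measurable_EFinP := fi _ i2].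
  move=> r _; rewrite /= lee_fin !ger0_norm ?ge_min ?lexx// ?le_min ?fine_ge0// ?mule_ge0// mspeed_ge0//.
apply: ge0_le_integral_ae => //.
- by move=> r; rewrite lee_fin le_min !fine_ge0// mule_ge0// mspeed_ge0.
- by move=> r; rewrite mule_ge0 ?mspeed_ge0.
- apply: ae_mono2 f1 f2 => r h1' h2' r01.
  rewrite EFin_min !fineK ?h1' ?h2'//; case: (leP (g1 (c r)) (g2 (c r))) => _.
    by rewrite ge_min lexx.
  by rewrite ge_min lexx orbT.
Qed.


(** Dominated convergence along each curve with [G 0] as majorant. The speed is finite at almost
    every time, so the limit may be multiplied by it. *)
Lemma wug_inf f (h : X -> R) (G : nat -> X -> \bar R) :
  (forall n, wug f (G n)) -> (forall n x, G n.+1 x <= G n x) ->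
  (forall x, G 0%N x <= (h x)%:E) ->
  wug f (fun x => ereal_inf (range (G ^~ x))).
Proof.
move=> wG Gnonincr Gh; have mG n : mfun (G n) by have [] := wG n.
have G0 n x : 0 <= G n x by have [] := wG n.
have I0 x : 0 <= ereal_inf (range (G ^~ x)) by apply: le_ereal_inf_tmp => _ [n _ <-].
have GI n x : ereal_inf (range (G ^~ x)) <= G n x by apply: ereal_inf_lbound; exists n.
have Gdecr x : nonincreasing_seq (G ^~ x) by apply/nonincreasing_seqP => n; exact: Gnonincr.
have mI : mfun (fun x => ereal_inf (range (G ^~ x))).
  have -> : (fun x => ereal_inf (range (G ^~ x))) = fun x => einfs (G ^~ x) 0%N.
    apply/funext => x; rewrite /einfs /sdrop; congr ereal_inf.
    by apply/seteqP; split => _ [n _ <-]; exists n.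
  exact: measurable_fun_einfs.
apply/(weak_upper_gradientP m q sepX) => // pi hpi.
have /ae_foralln : forall n, {ae pi, forall c : curve X,
    `|f (c 1%R) - f (c 0%R)|%:E <= line_integral (G n) c < +oo}.
  by move=> n; exact: (weak_upper_gradientP m q sepX f (mG n) (G0 n)).1.
apply: ae_mono2 (test_plan_AC hpi) => c [cac _] Hc; have /andP[_ l0] := Hc 0%N.
apply/andP; split; last first.
  by apply: le_lt_trans l0; apply: le_line_integral => // x; exact: GI.
have mI01 : measurable (I01 : set (measurableTypeR R)) by [].
have mGt g : mfun g -> measurable_fun I01 (fun t : measurableTypeR R => g (c t) * mspeed c t).
  move=> mg; apply: measurable_funTS.
  by apply: emeasurable_funM; [exact: measurable_curve_time|exact: measurable_mspeed_time].
have int0 : leb.-integrable I01 (fun t => G 0%N (c t) * mspeed c t).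
  apply/integrableP; split; first exact: mGt.
  by under eq_integral do rewrite gee0_abs ?mule_ge0 ?mspeed_ge0//.
have [v [_ _ _ vE]] := metric_speed_ae sepX cac.
have c1 : {ae leb, forall t, I01 t -> (fun n => G n (c t) * mspeed c t) @ \oo -->
    ereal_inf (range (G ^~ (c t))) * mspeed c t}.
  apply: ae_mono vE => t vt /vt[_ ->]; apply: cvgeZr => //.
  by apply: ereal_nonincreasing_cvgn; exact: Gdecr.
have c2 : {ae leb, forall t n, I01 t -> `|G n (c t) * mspeed c t| <= G 0%N (c t) * mspeed c t}.
  apply: aeW => t n t01; rewrite gee0_abs ?mule_ge0 ?mspeed_ge0//.
  by rewrite lee_wpmul2r ?mspeed_ge0//; exact: (Gdecr (c t) 0%N n).
have [_ _ cvl] := dominated_convergence mI01 (fun n => mGt _ (mG n)) (mGt _ mI) c1 int0 c2.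
rewrite /line_integral -(cvg_lim _ cvl)//.
apply: lime_ge; first by apply/cvg_ex; eexists; exact: cvl.
by apply: nearW => n; have /andP[] := Hc n.
Qed.

(** The integral of the [q]-th power is minimised among weak upper gradients below the modulus of
    [h]. Running minima make a minimising sequence decreasing, and its infimum [I] attains the value
    [alpha]. For any other [g'], the minimum with [I] is a competitor that cannot do better, so it
    equals [I] almost everywhere. *)
Lemma minimal_wug_exists f (h : X -> R) : mfun h ->
  \int[m]_x (`|h x|%:E `^ q) < +oo -> wug f (fun x => `|h x|%:E) ->
  exists2 g, minimal_weak_upper_gradient m q f g & forall x, g x <= `|h x|%:E.
Proof.
move=> mh hq wh.
pose below g := wug f g /\ forall x, g x <= `|h x|%:E.
pose S := [set \int[m]_x (g x `^ q) | g in below].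
pose alpha := ereal_inf S.
have alpha0 : 0 <= alpha.
  by apply: le_ereal_inf_tmp => _ [g _ <-]; apply: integral_ge0 => x _; exact: poweR_ge0.
have alphafin : alpha \is a fin_num.
  rewrite ge0_fin_numE//; apply: le_lt_trans hq.
  by apply: ereal_inf_lbound; exists (fun x => `|h x|%:E).
have /choice[g gP] n : exists g, below g /\ \int[m]_x (g x `^ q) < alpha + (n.+1%:R^-1)%:E.
  have : alpha < alpha + (n.+1%:R^-1)%:E by rewrite lteDl// lte_fin.
  by move=> /ereal_inf_lt[_ [g bg <-] ?]; exists g.
pose fix G n := if n is k.+1 then (fun x => mine (G k x) (g k.+1 x)) else g 0%N.
have wG n : wug f (G n).
  by elim: n => [|n IH] /=; [have [[]] := gP 0%N|apply: wug_min => //; have [[]] := gP n.+1].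
have Gg n x : G n x <= g n x by case: n => //= n; rewrite ge_min lexx orbT.
have Gh x : G 0%N x <= `|h x|%:E by have [[_ H] _] := gP 0%N; exact: H.
pose I x := ereal_inf (range (G ^~ x)).
have GI n x : I x <= G n x by apply: ereal_inf_lbound; exists n.
have wI : wug f I by apply: (wug_inf (h := fun x => `|h x|%R)) => // n x; rewrite /= ge_min lexx.
have [mI I0 _] := wI.
have Ih x : I x <= `|h x|%:E := le_trans (GI 0%N x) (Gh x).
have le_pow (a b : X -> \bar R) : (forall x, 0 <= a x) -> (forall x, a x <= b x) ->
    \int[m]_x (a x `^ q) <= \int[m]_x (b x `^ q).
  move=> a0 ab; apply: ge0_le_integral_ae => //.
  - by move=> x; exact: poweR_ge0.
  - by move=> x; exact: poweR_ge0.
  apply: aeW => x _; apply: gt0_ler_poweR => //; first by rewrite ltW// (lt_trans _ q1).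
    by rewrite in_itv/= leey a0.
  by rewrite in_itv/= leey (le_trans (a0 x)).
have intI : \int[m]_x (I x `^ q) <= alpha.
  apply/lee_addgt0Pr => e e0.
  have [n ne] : exists n : nat, (n.+1%:R^-1 < e)%R.
    by exists (Num.truncn e^-1); rewrite invf_plt ?posrE//; exact: truncnS_gt.
  have [_ /ltW ga] := gP n; apply: le_trans (le_trans ga _).
    by apply: le_pow => // x; exact: le_trans (Gg n x).
  by rewrite leeD2l// lee_fin ltW.
exists I => //; split => // g' wg'; have [mg' g'0 _] := wg'.
have wmin := wug_min wI wg'; have [mmin min0 _] := wmin.
have minI x : mine (I x) (g' x) <= I x by rewrite ge_min lexx.
have alphamin : alpha <= \int[m]_x (mine (I x) (g' x) `^ q).
  apply: ereal_inf_lbound; exists (fun x => mine (I x) (g' x)) => //; split => // x.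
  exact: le_trans (minI x) (Ih x).
have mpow (u : X -> \bar R) : mfun u -> mfun (fun x => u x `^ q).
  by move=> mu; exact: (measurableT_comp (measurable_poweR q) mu).
have Ifin x : I x \is a fin_num.
  by rewrite ge0_fin_numE// (le_lt_trans (Ih x))// ltry.
have q0 : (0 < q)%R by exact: lt_trans q1.
have := ge0_le_integral_eq (mpow _ mmin) (mpow _ mI) (fun x => poweR_ge0 _ _) _ _
  (le_trans intI alphamin) _.
move=> /(_ _ _ _)/wrap[].
- move=> x; apply: gt0_ler_poweR => //; first exact: ltW.
    by rewrite in_itv/= leey min0.
  by rewrite in_itv/= leey I0.
- by move=> x; exact: fin_num_poweR.
- by apply: le_lt_trans hq; apply: le_pow => // x; exact: le_trans (minI x) (Ih x).
(* Where [g'] is below [I] the minimum is [g'], and strict monotonicity of the power contradicts the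
   equality of the powers. *)
apply: ae_mono => x; rewrite leNgt => E; apply/negP => g'I; move: E.
have -> : mine (I x) (g' x) = g' x by apply/min_idPr; exact: ltW.
have g'fin : g' x \is a fin_num by rewrite ge0_fin_numE// (lt_trans g'I)// -ge0_fin_numE.
rewrite -(fineK g'fin) -(fineK (Ifin x)) !poweR_EFin => -[].
move: g'I; rewrite -(fineK g'fin) -(fineK (Ifin x)) lte_fin => g'I.
have := gt0_ltr_powR q0 _ _ g'I.
by rewrite !nnegrE !fine_ge0// => /(_ isT isT) /lt_eqF /eqP.
Qed.

Lemma min_wugP f (h : X -> R) : mfun h ->
  \int[m]_x (`|h x|%:E `^ q) < +oo -> wug f (fun x => `|h x|%:E) ->
  minimal_weak_upper_gradient m q f (min_wug m q f).
Proof.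
by move=> mh hq wh; have [g ? _] := minimal_wug_exists mh hq wh; apply: xgetPex; exists g.
Qed.

End wug_calculus.

(** * The Sobolev space *)

Section Lq_space.
Context {R : realType} {X : completeMetricType R}.
Variables (m : {measure set (borel X) -> \bar R}) (q : R).
Hypothesis (q1 : 1 < q).
Local Notation mfun f := (measurable_fun setT (f : borel X -> _)).
Local Notation Lq := (Lq m q).
Implicit Types f g : X -> R.

Definition nq (f : X -> R) : R := fine (Lq_norm m q f).

Let q0 : 0 < q. Proof. exact: lt_trans q1. Qed.
Let q_ge0 : 0 <= q. Proof. exact: ltW. Qed.
Let q_neq0 : q != 0. Proof. by rewrite gt_eqF. Qed.

Lemma LqE f : Lq f <-> mfun f /\ (Lq_norm m q f < +oo)%E.
Proof.
split; first by rewrite /Defs.Lq /= => /andP[/set_mem ? /set_mem].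
by move=> [? ?]; apply/andP; split; rewrite inE.
Qed.

Lemma Lq_measurable f : Lq f -> mfun f. Proof. by move=> /LqE[]. Qed.

Lemma Lq_norm_pow f : (Lq_norm m q f `^ q = \int[m]_x (`|f x|%:E `^ q))%E.
Proof. by rewrite /Lq_norm poweR_Lnorm. Qed.

Lemma Lq_norm_nq f : Lq f -> Lq_norm m q f = (nq f)%:E.
Proof. by move=> /LqE[_ fin]; rewrite /nq fineK// ge0_fin_numE// Lnorm_ge0. Qed.

Lemma nq_ge0 f : 0 <= nq f. Proof. by rewrite fine_ge0// Lnorm_ge0. Qed.

Lemma nq_pow f : Lq f -> (\int[m]_x (`|f x|%:E `^ q) = (nq f `^ q)%:E)%E.
Proof. by move=> Lf; rewrite -Lq_norm_pow Lq_norm_nq// poweR_EFin. Qed.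

Lemma Lq_integral f : mfun f -> (\int[m]_x (`|f x|%:E `^ q) < +oo)%E -> Lq f.
Proof.
move=> mf; rewrite -Lq_norm_pow => fin; apply/LqE; split=> //.
by rewrite ltNge leye_eq; apply/eqP => E; move: fin; rewrite E poweRyr.
Qed.

Lemma nq_le_integral f (e : R) : Lq f -> 0 <= e ->
  (\int[m]_x (`|f x|%:E `^ q) <= (e `^ q)%:E)%E -> nq f <= e.
Proof.
move=> Lf e0; rewrite nq_pow// lee_fin => fe; rewrite leNgt; apply/negP => ef.
by move: fe; apply/negP; rewrite -ltNge; apply: gt0_ltr_powR => //; rewrite nnegrE ?nq_ge0.
Qed.

Lemma Lq_subspace : linear_subspace Lq.
Proof.
have q1e : (1 <= q%:E)%E by rewrite lee_fin ltW.
by have [H0 HD] := Lfun_submod_closed m q1e; split => // a u v Lu Lv; exact: HD.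
Qed.

Lemma nqD f g : Lq f -> Lq g -> nq (f + g) <= nq f + nq g.
Proof.
move=> Lf Lg; rewrite -lee_fin EFinD -!Lq_norm_nq//; last exact: (subspaceD Lq_subspace).
by apply: minkowski_EFin; [exact: Lq_measurable|exact: Lq_measurable|exact: ltW].
Qed.

Lemma nqZ a f : Lq f -> nq (a *: f) = `|a| * nq f.
Proof.
move=> Lf; have LZ := subspaceZ Lq_subspace a Lf.
have q1e : (1 <= q%:E)%E by rewrite lee_fin ltW.
have E : Lq_norm m q (a *: f) = (`|a|%:E * Lq_norm m q f)%E := LnormZ (Lfun_Sub q1e Lf) a.
by rewrite /nq E Lq_norm_nq.
Qed.

Lemma nq_seminorm : seminorm_on Lq nq.
Proof. by split; [exact: nqD|exact: nqZ]. Qed.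

Lemma le_integral_pow f g : {ae m, forall x, `|f x| <= `|g x|} ->
  (\int[m]_x (`|f x|%:E `^ q) <= \int[m]_x (`|g x|%:E `^ q))%E.
Proof.
move=> fg; apply: ge0_le_integral_ae => //.
- by move=> x; exact: poweR_ge0.
- by move=> x; exact: poweR_ge0.
- by apply: ae_mono fg => x fgx _; rewrite !poweR_EFin lee_fin ge0_ler_powR// nnegrE.
Qed.

Lemma Lq_le f g : mfun f -> Lq g -> {ae m, forall x, `|f x| <= `|g x|} -> Lq f.
Proof.
move=> mf Lg fg; apply: Lq_integral => //; apply: le_lt_trans (le_integral_pow fg) _.
by rewrite nq_pow// ltry.
Qed.

Lemma le_nq f g : mfun f -> Lq g -> {ae m, forall x, `|f x| <= `|g x|} -> nq f <= nq g.
Proof.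
move=> mf Lg fg; apply: nq_le_integral; [exact: Lq_le fg|exact: nq_ge0|].
by rewrite -nq_pow//; exact: le_integral_pow.
Qed.

Lemma Lq_nq_lt f e : 0 < e -> Lq f -> nq f < e `^ q^-1 ->
  (\int[m]_x (`|f x|%:E `^ q) <= e%:E)%E.
Proof.
move=> e0 Lf fe; rewrite nq_pow// lee_fin -[leRHS](powRr1 (ltW e0)) -(mulVf q_neq0) powRrM.
by rewrite ge0_ler_powR ?nnegrE ?nq_ge0 ?powR_ge0// ltW.
Qed.

Lemma norm_cvg_nq (u : nat -> X -> R) f : (forall n, Lq (u n)) -> Lq f ->
  norm_cvg (Lq_norm m q) u f -> nq (u n - f) @[n --> \oo] --> 0.
Proof.
move=> Lu Lf; rewrite /norm_cvg => H.
have -> : (fun n => nq (u n - f)) = fine \o (fun n => Lq_norm m q (u n - f)) by [].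
by apply: fine_cvg.
Qed.

End Lq_space.

Section Lq_bounded.
Context {R : realType} {X : completeMetricType R}.
Variables (m : {measure set (borel X) -> \bar R}) (q : R).
Hypotheses (q1 : 1 < q) (mfin : finite_on_bounded m).
Local Notation mfun f := (measurable_fun setT (f : borel X -> _)).
Local Notation Lq := (Lq m q).
Local Notation nq := (nq m q).

Let cball (x0 : X) r : set X := [set x | mdist x0 x <= r].

Let mball x0 r : measurable (cball x0 r : set (borel X)).
Proof.
have mf : mfun (fun x : X => mdist x0 x).
  by apply: borel_continuous_measurable_real; apply: continuous_mdist;
    [move=> ?; exact: cvg_cst|move=> ?; exact: cvg_id].
have := mf measurableT _ (measurable_itv `]-oo, r]); rewrite setTI; congr measurable.
Qed.

Let bdball x0 r : metric_bounded (cball x0 r).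
Proof.
exists (r + r) => x y; rewrite /cball/= => xr yr.
by rewrite (le_trans (metric_triangle x x0 y))// lerD// metric_sym.
Qed.

Definition ball_indic (x0 : X) (r : R) : X -> R := \1_(cball x0 r).

Lemma ball_indicE x0 r x : ball_indic x0 r x = if mdist x0 x <= r then 1 else 0.
Proof. rewrite /ball_indic indicE; case: ifPn => [xr|/negP xr]; first by rewrite mem_set.
by rewrite memNset. Qed.

(** Finiteness of [m] on bounded sets enters here; multiples of these indicators dominate the
    bounded functions with bounded support and their slopes. *)
Lemma Lq_ball_indic (x0 : X) (r : R) : Lq (ball_indic x0 r).
Proof.
apply: (Lq_integral q1); first exact: measurable_indic (mball _ _).
have -> : (\int[m]_x (`|ball_indic x0 r x|%:E `^ q) = \int[m]_x (\1_(cball x0 r) x)%:E)%E.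
  apply: eq_integral => x _; rewrite poweR_EFin; congr EFin.
  rewrite -/(ball_indic x0 r) ball_indicE; case: ifP => _; rewrite ?normr1 ?powR1//.
  by rewrite normr0 powR0// gt_eqF// (lt_trans _ q1).
have -> : (\int[m]_x (\1_(cball x0 r) x)%:E = m (cball x0 r `&` setT))%E.
  exact: (integral_indic m measurableT (mball x0 r)).
by rewrite setIT; exact: mfin.
Qed.

Lemma Lq_bounded_support (f : X -> R) (x0 : X) (r M : R) : mfun f ->
  (forall x, `|f x| <= M) -> (forall x, r < mdist x0 x -> f x = 0) ->
  Lq f /\ nq f <= nq (M *: ball_indic x0 r).
Proof.
move=> mf fM f0; have L := subspaceZ (Lq_subspace m q1) M (Lq_ball_indic x0 r).
have fle : {ae m, forall x, `|f x| <= `|(M *: ball_indic x0 r) x|}.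
  apply: aeW => x; rewrite [X in _ <= `|X|](_ : _ = M * ball_indic x0 r x)// ball_indicE.
  case: (leP (mdist x0 x) r) => xr; last by rewrite f0// normr0.
  by rewrite mulr1 (le_trans (fM x))// ler_norm.
by split; [exact: Lq_le fle|exact: le_nq fle].
Qed.

End Lq_bounded.

Section bounded_lipschitz.
Context {R : realType} {X : completeMetricType R}.
Implicit Types u v : X -> R.
Local Notation bl := (@bounded_lipschitz_bs R X).

Lemma bounded_lipschitz_subspace : linear_subspace bl.
Proof.
split.
  split; first by exists 0 => x; rewrite normr0.
    by exists 0; split => // x y _ _; rewrite subr0 normr0 mul0r.
  by exists 0 => x y /=; rewrite eqxx.
move=> a u v [[M uM] [L [L0 uL]] [B uB]] [[M' vM] [L' [L'0 vL]] [B' vB]]; split.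
- exists (`|a| * M + M') => x; rewrite (le_trans (ler_normD _ _))// lerD//.
  by rewrite [X in `|X|](_ : _ = a * u x)// normrM ler_wpM2l.
- exists (`|a| * L + L'); split; first by rewrite addr_ge0// mulr_ge0.
  move=> x y _ _; rewrite [X in `|X|](_ : _ = a * (u x - u y) + (v x - v y)).
    rewrite mulrDl (le_trans (ler_normD _ _))// lerD ?vL// normrM -mulrA ler_wpM2l// uL//.
  by rewrite [LHS](_ : _ = a * u x + v x - (a * u y + v y))//; ring.
- have [[x0 ux0]|nu] := pselect (exists x, u x != 0); last first.
    have u0 x : u x = 0 by apply/eqP; apply: contrapT => /negP ?; apply: nu; exists x.
    exists B' => x y; rewrite /= => xv yv; apply: vB => /=.
      by apply: contraNneq xv => vx; rewrite [X in X == _](_ : _ = a * u x + v x)// u0 vx mulr0 addr0.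
    by apply: contraNneq yv => vx; rewrite [X in X == _](_ : _ = a * u y + v y)// u0 vx mulr0 addr0.
  have [[y0 vy0]|nv] := pselect (exists x, v x != 0); last first.
    have v0 x : v x = 0 by apply/eqP; apply: contrapT => /negP ?; apply: nv; exists x.
    exists B => x y; rewrite /= => xv yv; apply: uB => /=.
      by apply: contraNneq xv => vx; rewrite [X in X == _](_ : _ = a * u x + v x)// v0 vx mulr0 addr0.
    by apply: contraNneq yv => vx; rewrite [X in X == _](_ : _ = a * u y + v y)// v0 vx mulr0 addr0.
  (* A point of the joint support is near [x0] or near [y0]; the distance of these two base points
     links the two supports. The moduli are there because [B] and [B'] are arbitrary reals. *)
  have key x : (a *: u + v) x != 0 -> mdist x x0 <= `|B| + `|B'| + mdist y0 x0.
    move=> axv; have [ux|ux] := eqVneq (u x) 0; last first.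
      have := uB x x0 ux ux0; have := ler_norm B; have := normr_ge0 B'.
      by have := mdist_ge0 y0 x0; lra.
    have vx : v x != 0.
      by apply: contraNneq axv => vx; rewrite [X in X == _](_ : _ = a * u x + v x)// ux vx mulr0 addr0.
    have := vB x y0 vx vy0; have := ler_norm B'; have := normr_ge0 B.
    by have := metric_triangle x y0 x0; lra.
  exists (2 * (`|B| + `|B'| + mdist y0 x0)) => x y xa ya.
  have := key x xa; have := key y ya; have := metric_triangle x x0 y.
  by rewrite (metric_sym x0 y); lra.
Qed.

Lemma bounded_lipschitz_in_ball u : bl u -> exists (x0 : X) (r : R),
  0 <= r /\ forall x, r < mdist x0 x -> u x = 0.
Proof.
move=> [_ _ [B uB]]; have [[x0 ux0]|nu] := pselect (exists x, u x != 0); last first.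
  exists point, 0; split => // x _; apply/eqP; apply: contrapT => /negP ?.
  by apply: nu; exists x.
exists x0, `|B|; split => // x; apply: contraTeq => ux; rewrite -leNgt.
exact: le_trans (uB x0 x ux0 ux) (ler_norm B).
Qed.

(** Outside a closed ball containing the support, a small ball around [x] still misses it. *)
Lemma Lip_a_eq0 u x0 (r : R) : (forall x, r < mdist x0 x -> u x = 0) ->
  forall x, r < mdist x0 x -> Lip_a u x = 0%E.
Proof.
move=> ur x rx; apply/eqP; rewrite eq_le Lip_a_ge0 andbT.
apply: (@Lip_a_le _ _ _ _ (mdist x0 x - r)); first by rewrite subr_gt0.
have in_ball y : ball x (mdist x0 x - r) y -> u y = 0.
  rewrite ballEmdist /= => yr; apply: ur.
  by have := metric_triangle x0 y x; rewrite (metric_sym y x); lra.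
by split => // y z /in_ball -> /in_ball ->; rewrite subr0 normr0 mul0r.
Qed.

End bounded_lipschitz.

(** * Approximable functions and the energy norm *)

Section sobolev_approximation.
Context {R : realType} {X : completeMetricType R}.
Variables (m : {measure set (borel X) -> \bar R}) (q : R).
Hypotheses (q1 : 1 < q) (mfin : finite_on_bounded m) (sepX : separable_space X).
Local Notation mfun f := (measurable_fun setT (f : borel X -> _)).
Local Notation Lq := (Lq m q).
Local Notation nq := (nq m q).
Local Notation bl := (@bounded_lipschitz_bs R X).
Local Notation wug := (weak_upper_gradient m q).
Local Notation min_wug := (min_wug m q).
Implicit Types f g h u v k : X -> R.

Let LqS := Lq_subspace m q1.
Let sn := nq_seminorm m q1.

Lemma Lq_bounded_lipschitz u : bl u -> Lq u.
Proof.
move=> blu; have [[M uM] lu _] := blu.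
have [x0 [r [_ ur]]] := bounded_lipschitz_in_ball blu.
by have [] := Lq_bounded_support q1 mfin (measurable_lipschitz lu) uM ur.
Qed.

Lemma Lip_a_bounded_support u x0 r L : is_lipschitz u -> lipschitz_const_on setT u L ->
  (forall x, r < mdist x0 x -> u x = 0) ->
  Lq (fun x => fine (Lip_a u x)) /\
  nq (fun x => fine (Lip_a u x)) <= nq (L *: ball_indic x0 r).
Proof.
move=> lu uL ur; apply: Lq_bounded_support => //.
- apply: measurableT_comp => //; exact: measurable_Lip_a.
- move=> x; rewrite ger0_norm ?fine_ge0 ?Lip_a_ge0// -lee_fin fineK ?Lip_a_fin_num//.
  exact: Lip_a_lipschitz.
- by move=> x rx; rewrite (Lip_a_eq0 ur rx).
Qed.

Lemma Lq_Lip_a u : bl u -> Lq (fun x => fine (Lip_a u x)).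
Proof.
move=> blu; have [_ lu _] := blu; have [L uL] := lu.
have [x0 [r [_ ur]]] := bounded_lipschitz_in_ball blu.
by have [] := Lip_a_bounded_support lu uL ur.
Qed.

Lemma lipschitz_bs_bounded u : is_lipschitz u -> bounded_support u -> bl u.
Proof.
move=> lu bu; split => //; have [L [L0 uL]] := lu; have [B uB] := bu.
have [[x0 ux0]|nu] := pselect (exists x, u x != 0); last first.
  exists 0 => x; rewrite (_ : u x = 0) ?normr0//; apply/eqP.
  by apply: contrapT => /negP ?; apply: nu; exists x.
exists (`|u x0| + L * `|B|) => x; have [->|ux] := eqVneq (u x) 0.
  by rewrite normr0 addr_ge0// mulr_ge0.
have h1 := uL x x0 I I.
have h2 : L * mdist x x0 <= L * `|B|.
  by rewrite ler_wpM2l// (le_trans (uB x x0 ux ux0))// ler_norm.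
by have := ler_normD (u x - u x0) (u x0); rewrite subrK; lra.
Qed.

Lemma Lip_a_linear_le (a b : R) u v k k' : is_lipschitz u -> is_lipschitz v ->
  (forall x, Lip_a u x <= (k x)%:E)%E -> (forall x, Lip_a v x <= (k' x)%:E)%E ->
  forall x, (Lip_a (a *: u + b *: v)%R x <= ((`|a| *: k + `|b| *: k')%R x)%:E)%E.
Proof.
move=> lu lv uk vk x.
have lZ (c : R) (w : X -> R) : is_lipschitz w -> is_lipschitz (fun y => c * w y).
  move=> [L [L0 wL]]; exists (`|c| * L); split; first by rewrite mulr_ge0.
  by move=> y z _ _; rewrite -mulrBr normrM -mulrA ler_wpM2l// wL.
apply: (le_trans (Lip_aD x (lZ a u lu) (lZ b v lv))).
rewrite [leRHS](_ : _ = (`|a| * k x)%R%:E + (`|b| * k' x)%R%:E)%E//; apply: leeD.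
  by apply: (le_trans (Lip_aZ a x lu)); rewrite EFinM lee_wpmul2l.
by apply: (le_trans (Lip_aZ b x lv)); rewrite EFinM lee_wpmul2l.
Qed.

(* Approximation of [f] by Lipschitz functions whose slopes converge strongly,
   which Mazur's lemma extracts from the weak convergence of a relaxed slope. *)
Definition approximable f h := [/\ Lq f, Lq h & forall e, 0 < e -> exists v k,
  [/\ bl v, forall x, (Lip_a v x <= (k x)%:E)%E, Lq k, nq (v - f) < e & nq (k - h) < e]].

Lemma approximable_wug f h : approximable f h -> wug f (fun x => `|h x|%:E).
Proof.
move=> [Lf Lh H]; apply: (approx_wug sepX q1 (Lq_measurable Lf) (Lq_measurable Lh)).
  by rewrite (nq_pow q1 Lh) ltry.
move=> e e0; have [|v [k [blv Lvk Lk vf kh]]] := H (e `^ q^-1); first exact: powR_gt0.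
have Lv := Lq_bounded_lipschitz blv.
exists v, k; split => //.
- by split; [case: blv|exact: Lq_measurable Lk].
- exact: (Lq_nq_lt q1 e0 (subspaceB LqS Lv Lf)).
- exact: (Lq_nq_lt q1 e0 (subspaceB LqS Lk Lh)).
Qed.

Let nq0 : nq 0 = 0.
Proof. by have := nqZ q1 0 (subspace0 LqS); rewrite scale0r normr0 mul0r. Qed.

(** The zero function with zero majorant approximates [u]. Hence the slope of a null function
    vanishes, which makes the energy norm blind to the choice of a representative. *)
Lemma approximable_null u : Lq u -> nq u = 0 -> approximable u 0.
Proof.
move=> Lu u0; split => //; first exact: subspace0.
move=> e e0; exists 0, 0; split.
- exact: subspace0 bounded_lipschitz_subspace.
- by move=> x; apply: Lip_a_lipschitz; split => // y z _ _; rewrite subrr normr0 mul0r.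
- exact: subspace0.
- by rewrite sub0r (seminormN sn)// u0.
- by rewrite subrr nq0.
Qed.

Lemma approximable_bl v k : bl v -> (forall x, (Lip_a v x <= (k x)%:E)%E) -> Lq k ->
  approximable v k.
Proof.
move=> blv vk Lk; split => //; first exact: Lq_bounded_lipschitz.
by move=> e e0; exists v, k; rewrite !subrr nq0.
Qed.

Lemma approximableD a f g h h' : approximable f h -> approximable g h' ->
  approximable (a *: f + g) (`|a| *: h + h').
Proof.
move=> [Lf Lh fh] [Lg Lh' gh]; split.
- by apply: subspaceD => //; exact: subspaceZ.
- by apply: subspaceD => //; exact: subspaceZ.
(* The combined error is the modulus of [a] times [d], plus [d], which is exactly [e]. *)
move=> e e0; pose d := e / (`|a| + 1).
have a1 : 0 < `|a| + 1 by rewrite ltr_pwDr.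
have d0 : 0 < d by rewrite divr_gt0.
have [v [k [blv vk Lk vf kh]]] := fh d d0; have [v' [k' [blv' vk' Lk' vg kh']]] := gh d d0.
have key c (w w' z z' : X -> R) : Lq w -> Lq w' -> Lq z -> Lq z' -> `|c| = `|a| ->
    nq (w - z) < d -> nq (w' - z') < d -> nq (c *: w + w' - (c *: z + z')) < e.
  move=> Lw Lw' Lz Lz' ca wz wz'.
  have -> : c *: w + w' - (c *: z + z') = c *: (w - z) + (w' - z').
    by rewrite scalerBr opprD addrACA.
  have L1 := subspaceB LqS Lw Lz; have L2 := subspaceB LqS Lw' Lz'.
  apply: (le_lt_trans (nqD q1 (subspaceZ LqS c L1) L2)).
  rewrite nqZ// ca (_ : e = `|a| * d + d).
    by apply: ler_ltD => //; rewrite ler_wpM2l// ltW.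
  by rewrite /d; field; rewrite gt_eqF.
exists (a *: v + v'), (`|a| *: k + k'); split.
- exact: bounded_lipschitz_subspace.2.
- have [_ lv _] := blv; have [_ lv' _] := blv'.
  by have := Lip_a_linear_le a 1 lv lv' vk vk'; rewrite normr1 !scale1r.
- by apply: subspaceD => //; exact: subspaceZ.
- by apply: key => //; exact: Lq_bounded_lipschitz.
- by apply: key => //; rewrite normr_id.
Qed.

(** Strong approximation by pairs is visibly stable under linear combinations, unlike the existence
    of a relaxed slope, where weak limits of slopes of sums would have to be found. *)
Definition approx_space : set (X -> R) := [set f | exists h, approximable f h].

Lemma approx_space_subspace : linear_subspace approx_space.
Proof.
split; first by exists 0; apply: approximable_null => //; exact: subspace0.
by move=> a u v [h uh] [h' vh']; exists (`|a| *: h + h'); exact: approximableD.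
Qed.

Lemma bounded_lipschitz_approx_space : bl `<=` approx_space.
Proof.
move=> v blv; exists (fun x => fine (Lip_a v x)); apply: approximable_bl => //.
  by move=> x; rewrite fineK// Lip_a_fin_num//; case: blv.
exact: Lq_Lip_a.
Qed.

(** Mazur's argument without writing out convex combinations. The majorants of slopes of functions
    within [e] of [f], shifted by [g'], form a convex set [C]. If [C] stayed at distance [e] from 0,
    a separating functional would contradict the weak convergence of [Lip_a (u n)] to [g']. *)
Lemma sobolev_approx_space : sobolev m q `<=` approx_space.
Proof.
move=> f [Lf [g [_ Lg [g' [Lg' _] [u ubs [cu [_ _ wk]]]]]]].
exists g'; split => // e e0; apply: contrapT => nvk.
have blu n : bl (u n) by have [? ?] := ubs n; exact: lipschitz_bs_bounded.
pose C := [set c : X -> R | exists v k, [/\ bl v, forall x, (Lip_a v x <= (k x)%:E)%E, Lq k,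
  nq (v - f) < e & c = k - g']].
have cu' := norm_cvg_nq (fun n => Lq_bounded_lipschitz (blu n)) Lf cu.
have near_u : \forall n \near \oo, nq (u n - f) < e.
  have /cvgrPdist_lt/(_ e e0) := cu'; apply: filterS => n.
  by rewrite sub0r normrN ger0_norm// nq_ge0.
have Cu n : nq (u n - f) < e -> C ((fun x => fine (Lip_a (u n) x)) - g').
  move=> uf; exists (u n), (fun x => fine (Lip_a (u n) x)); split => //.
    by move=> x; rewrite fineK// Lip_a_fin_num//; have [] := blu n.
  exact: Lq_Lip_a.
have CW : C `<=` Lq by move=> _ [v [k [_ _ Lk _ ->]]]; exact: subspaceB.
have combE t (w w' z : X -> R) :
    t *: w + (1 - t) *: w' - z = t *: (w - z) + (1 - t) *: (w' - z).
  by rewrite !scalerBr addrACA -opprD -scalerDl (addrC t) subrK scale1r.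
have Ccvx : convex_on C.
  move=> t _ _ t0 t1 [v [k [blv vk Lk vf ->]]] [v' [k' [blv' vk' Lk' vf' ->]]].
  have s0 : 0 <= 1 - t by rewrite subr_ge0.
  exists (t *: v + (1 - t) *: v'), (t *: k + (1 - t) *: k'); split.
  - by apply: subspaceD; [exact: bounded_lipschitz_subspace| |];
      apply: subspaceZ => //; exact: bounded_lipschitz_subspace.
  - have [_ lv _] := blv; have [_ lv' _] := blv'.
    by have := Lip_a_linear_le t (1 - t) lv lv' vk vk'; rewrite !ger0_norm.
  - by apply: (subspaceD LqS); exact: (subspaceZ LqS).
  - have L1 := subspaceB LqS (Lq_bounded_lipschitz blv) Lf.
    have L2 := subspaceB LqS (Lq_bounded_lipschitz blv') Lf.
    rewrite combE; apply: (le_lt_trans (nqD q1 (subspaceZ LqS t L1) (subspaceZ LqS (1 - t) L2))).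
    rewrite !nqZ// !ger0_norm//.
    have [->|tn0] := eqVneq t 0; first by rewrite mul0r add0r subr0 mul1r.
    have tp : 0 < t by rewrite lt_neqAle eq_sym tn0.
    rewrite (_ : e = t * e + (1 - t) * e); last by ring.
    by rewrite ltr_leD ?ltr_pM2l// ler_wpM2l// ltW.
  - by rewrite combE.
have C0 : C !=set0.
  by have [n nu] := filter_ex near_u; exists ((fun x => fine (Lip_a (u n) x)) - g'); exact: Cu.
have Cd c : C c -> e <= nq c.
  move=> [v [k [blv vk Lk vf ->]]]; rewrite leNgt; apply/negP => kg.
  by apply: nvk; exists v, k.
have [l [ll ln lC]] := convex_separation LqS sn CW Ccvx C0 Cd.
have dl : dual Lq (Lq_norm m q) l.
  split => //; apply: (@le_lt_trans _ _ 1%E); last exact: ltry.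
  apply: ge_ereal_sup => _ [w [Lw Nw] <-]; apply: le_trans Nw.
  by rewrite Lq_norm_nq// lee_fin ln.
have /cvgrPdist_lt/(_ e e0) near_l := wk l dl.
have [n [nu nl]] := filter_ex (filterI near_u near_l).
have := lC _ (Cu n nu); rewrite (linear_onB ll (Lq_Lip_a (blu n)) Lg').
by move: nl; rewrite ltr_norml => /andP[? ?]; lra.
Qed.


Definition slope f : X -> R := fun x => fine (min_wug f x).
Definition slope_norm f : R := nq (slope f).

Lemma min_wug_minimal f : approx_space f -> minimal_weak_upper_gradient m q f (min_wug f).
Proof.
move=> [h fh]; have [_ Lh _] := fh.
apply: (min_wugP sepX q1 (Lq_measurable Lh)); last exact: approximable_wug.
by rewrite (nq_pow q1 Lh) ltry.
Qed.

Lemma min_wug_ge0 f x : approx_space f -> (0 <= min_wug f x)%E.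
Proof. by move=> /min_wug_minimal[[]]. Qed.

Lemma min_wug_le f h : approximable f h -> {ae m, forall x, (min_wug f x <= `|h x|%:E)%E}.
Proof.
move=> fh; have [|_ H] := @min_wug_minimal f; first by exists h.
exact: H (approximable_wug fh).
Qed.

Lemma min_wug_fin f : approx_space f -> {ae m, forall x, min_wug f x \is a fin_num}.
Proof.
move=> Wf; have [h fh] := Wf; apply: ae_mono (min_wug_le fh) => x fx.
by rewrite ge0_fin_numE ?min_wug_ge0// (le_lt_trans fx)// ltry.
Qed.

Lemma measurable_slope f : approx_space f -> mfun (slope f).
Proof. by move=> /min_wug_minimal[[mg _ _] _]; exact: measurableT_comp. Qed.

Lemma slope_le f h : approximable f h -> {ae m, forall x, `|slope f x| <= `|h x|}.
Proof.
move=> fh; have Wf : approx_space f by exists h.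
apply: ae_mono2 (min_wug_le fh) (min_wug_fin Wf) => x fx ffin.
by rewrite ger0_norm ?fine_ge0 ?min_wug_ge0// -lee_fin fineK.
Qed.

Lemma Lq_slope f : approx_space f -> Lq (slope f).
Proof.
move=> Wf; have [h fh] := Wf; have [_ Lh _] := fh.
by apply: (Lq_le _ _ Lh (slope_le fh)) => //; exact: measurable_slope.
Qed.

Lemma slope_norm_le f h : approximable f h -> slope_norm f <= nq h.
Proof.
move=> fh; have Wf : approx_space f by exists h.
have [_ Lh _] := fh; by apply: (le_nq _ _ Lh (slope_le fh)) => //; exact: measurable_slope.
Qed.

Lemma slope_norm_wug f (g : X -> \bar R) k : approx_space f -> wug f g -> Lq k ->
  {ae m, forall x, (g x <= (k x)%:E)%E} -> slope_norm f <= nq k.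
Proof.
move=> Wf wg Lk gk; have [_ H] := min_wug_minimal Wf.
have le_ae : {ae m, forall x, `|slope f x| <= `|k x|}.
  apply: ae_mono3 (H _ wg) (min_wug_fin Wf) gk => x fx ffin gkx.
  rewrite ger0_norm ?fine_ge0 ?min_wug_ge0// -lee_fin fineK// (le_trans fx)//.
  by rewrite (le_trans gkx)// lee_fin ler_norm.
by apply: (le_nq _ _ Lk le_ae) => //; exact: measurable_slope.
Qed.

Lemma slope_normD f g : approx_space f -> approx_space g ->
  slope_norm (f + g) <= slope_norm f + slope_norm g.
Proof.
move=> Wf Wg; apply: le_trans (nqD q1 (Lq_slope Wf) (Lq_slope Wg)).
have [wf _] := min_wug_minimal Wf; have [wg _] := min_wug_minimal Wg.
apply: (slope_norm_wug (subspaceD approx_space_subspace Wf Wg) (wugD sepX wf wg)).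
  by apply: subspaceD => //; exact: Lq_slope.
apply: ae_mono2 (min_wug_fin Wf) (min_wug_fin Wg) => x fx gx.
by rewrite [leRHS](_ : _ = (slope f x)%:E + (slope g x)%:E)%E// /slope !fineK.
Qed.

Let slope_normZ_le (a : R) f : approx_space f -> slope_norm (a *: f) <= `|a| * slope_norm f.
Proof.
move=> Wf; have [wf _] := min_wug_minimal Wf.
rewrite -[X in X * slope_norm f]normr_id -nqZ//; last exact: Lq_slope.
apply: (slope_norm_wug (subspaceZ approx_space_subspace a Wf) (wugZ sepX a wf)).
  by apply: (subspaceZ LqS); exact: Lq_slope.
apply: ae_mono (min_wug_fin Wf) => x fx.
by rewrite [leRHS](_ : _ = `|a|%:E * (slope f x)%:E)%E// /slope !fineK.
Qed.

Lemma slope_normZ (a : R) f : approx_space f -> slope_norm (a *: f) = `|a| * slope_norm f.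
Proof.
move=> Wf; apply/eqP; rewrite eq_le slope_normZ_le//=.
have [->|a0] := eqVneq a 0; first by rewrite normr0 mul0r nq_ge0.
have := slope_normZ_le a^-1 (subspaceZ approx_space_subspace a Wf).
rewrite scalerA mulVf// scale1r normfV mulrC => /(ler_wpM2l (normr_ge0 a)).
by rewrite mulrCA mulfV ?normr_eq0// mulr1.
Qed.

(** Comparable to the Sobolev norm up to the factor 2 in both directions; as a plain sum of
    seminorms it obeys the triangle inequality directly. *)
Definition energy_norm f : R := nq f + slope_norm f.

Lemma energy_seminorm : seminorm_on approx_space energy_norm.
Proof.
split=> [u v Wu Wv|a u Wu].
  have [h [Lu _ _]] := Wu; have [h' [Lv _ _]] := Wv.
  by rewrite /energy_norm addrACA lerD// ?nqD// slope_normD.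
have [h [Lu _ _]] := Wu.
by rewrite /energy_norm nqZ// slope_normZ// mulrDr.
Qed.

Lemma nq_approx_seminorm : seminorm_on approx_space nq.
Proof.
split=> [u v [h [Lu _ _]] [h' [Lv _ _]]|a u [h [Lu _ _]]]; first exact: nqD.
exact: nqZ.
Qed.

Lemma energy_norm_null u : approx_space u -> nq u = 0 -> energy_norm u = 0.
Proof.
move=> Wu u0; have [h [Lu _ _]] := Wu; rewrite /energy_norm u0 add0r.
apply/eqP; rewrite eq_le nq_ge0 andbT -nq0.
exact: slope_norm_le (approximable_null Lu u0).
Qed.

Lemma sobolev_normE u : approx_space u ->
  sobolev_norm m q u = ((nq u `^ q + slope_norm u `^ q) `^ q^-1)%:E.
Proof.
move=> Wu; have [h [Lu _ _]] := Wu; rewrite /sobolev_norm Lq_norm_nq// poweR_EFin.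
have -> : (\int[m]_x (min_wug u x `^ q) = (slope_norm u `^ q)%:E)%E.
  rewrite -(nq_pow q1 (Lq_slope Wu)); apply: ge0_eq_integral_ae => //.
  - by move=> x; exact: poweR_ge0.
  - by move=> x; exact: poweR_ge0.
  - apply: ae_mono (min_wug_fin Wu) => x ufin _.
    by rewrite ger0_norm ?fine_ge0 ?min_wug_ge0// fineK.
by rewrite -EFinD poweR_EFin.
Qed.

Let q0 : 0 < q. Proof. exact: lt_trans q1. Qed.
Let qi0 : 0 <= q^-1. Proof. by rewrite invr_ge0 ltW. Qed.
Let powK (a : R) : 0 <= a -> (a `^ q) `^ q^-1 = a.
Proof. by move=> a0; rewrite -powRrM mulfV ?gt_eqF// powRr1. Qed.

Lemma sobolev_norm_le u : approx_space u ->
  (sobolev_norm m q u <= (2 * energy_norm u)%:E)%E.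
Proof.
move=> Wu; rewrite sobolev_normE// lee_fin /energy_norm.
have := nq_ge0 m q u; have := nq_ge0 m q (slope u); rewrite -/(slope_norm u).
move: (nq u) (slope_norm u) => a b b0 a0; have ab0 : 0 <= a + b by rewrite addr_ge0.
rewrite -[leRHS]powK ?mulr_ge0//; apply: ge0_ler_powR => //; rewrite ?nnegrE ?addr_ge0 ?powR_ge0//.
(* The factor 2 counts the two summands, and it is at most its own [q]-th power because [1 < q]. *)
rewrite powRM//; apply: (@le_trans _ _ (2 * (a + b) `^ q)).
  rewrite mulr2n mulrDl !mul1r; apply: lerD; apply: ge0_ler_powR; rewrite ?nnegrE ?(ltW q0)//.
    by rewrite lerDl.
  by rewrite lerDr.
by rewrite ler_wpM2r ?powR_ge0// le1r_powR ?ler1n// ltW.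
Qed.

Lemma energy_norm_le u : approx_space u ->
  ((energy_norm u)%:E <= 2%:E * sobolev_norm m q u)%E.
Proof.
move=> Wu; rewrite sobolev_normE// -EFinM lee_fin /energy_norm.
have := nq_ge0 m q u; have := nq_ge0 m q (slope u); rewrite -/(slope_norm u).
move: (nq u) (slope_norm u) => a b b0 a0.
have ha : a <= (a `^ q + b `^ q) `^ q^-1.
  rewrite -[leLHS]powK//; apply: ge0_ler_powR; rewrite ?nnegrE ?addr_ge0 ?powR_ge0//.
  by rewrite lerDl powR_ge0.
have hb : b <= (a `^ q + b `^ q) `^ q^-1.
  rewrite -[leLHS]powK//; apply: ge0_ler_powR; rewrite ?nnegrE ?addr_ge0 ?powR_ge0//.
  by rewrite lerDr powR_ge0.
by lra.
Qed.

Lemma bounded_lipschitz_sobolev : bl `<=` sobolev m q.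
Proof.
move=> u blu; have Lu := Lq_bounded_lipschitz blu; split => //.
exists (fun x => fine (Lip_a u x)); split; [by []|exact: Lq_Lip_a|].
exists (fun x => fine (Lip_a u x)); first by split; [exact: Lq_Lip_a|exact: aeW].
exists (fun=> u); first by move=> n; have [] := blu.
split; last by split=> [n||l _]; [exact: Lq_Lip_a|exact: Lq_Lip_a|exact: cvg_cst].
rewrite /norm_cvg subrr Lq_norm_nq ?nq0; last exact: (subspace0 LqS).
exact: cvg_cst.
Qed.

(** Weak convergence needs the exact scaling of [Lip_a], not only an upper bound; the converse
    inequality comes from scaling back by [a^-1], with [a = 0] apart. *)
Lemma sobolevZ (a : R) f : sobolev m q f -> sobolev m q (a *: f).
Proof.
move=> [Lf [g [_ Lg [g' [Lg' g'g] [u ubs [cu [Lu _ wk]]]]]]].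
split; first exact: (subspaceZ LqS).
exists (`|a| *: g); split; [exact: (subspaceZ LqS)|exact: (subspaceZ LqS)|].
exists (`|a| *: g').
  by split; [exact: (subspaceZ LqS)|apply: ae_mono g'g => x; exact: ler_wpM2l].
have blu n : bl (u n) by have [? ?] := ubs n; exact: lipschitz_bs_bounded.
have Lun n := Lq_bounded_lipschitz (blu n).
have blau n : bl (a *: u n) by apply: subspaceZ (blu n); exact: bounded_lipschitz_subspace.
exists (fun n => a *: u n); first by move=> n; have [] := blau n.
have LaE n : (fun x => fine (Lip_a (a *: u n) x)) = `|a| *: (fun x => fine (Lip_a (u n) x)).
  apply/funext => x; have [lu _] := ubs n; have [_ lau _] := blau n.
  have h1 := Lip_aZ a x lu.
  have f1 := Lip_a_fin_num x lu; have f2 := Lip_a_fin_num x lau.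
  have g1 : fine (Lip_a (a *: u n) x) <= `|a| * fine (Lip_a (u n) x).
    by rewrite -lee_fin EFinM !fineK.
  have g0 : 0 <= fine (Lip_a (a *: u n) x) by rewrite fine_ge0 ?Lip_a_ge0.
  apply/eqP; rewrite eq_le g1 /=; have [->|a0] := eqVneq a 0.
    apply: (@le_trans _ _ (`|0| * fine (Lip_a (u n) x))); first exact: lexx.
    by rewrite normr0 mul0r; apply: fine_ge0; exact: Lip_a_ge0.
  have h2 := Lip_aZ a^-1 x lau.
  have uE : (fun y => a^-1 * (a *: u n) y) = u n.
    by apply/funext => y; rewrite [X in _ * X](_ : _ = a * u n y)// mulrA mulVf// mul1r.
  rewrite uE in h2.
  have : fine (Lip_a (u n) x) <= `|a^-1| * fine (Lip_a (a *: u n) x).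
    by rewrite -lee_fin EFinM !fineK.
  move=> /(ler_wpM2l (normr_ge0 a)); rewrite normfV mulrA mulfV ?normr_eq0// mul1r.
  by move=> /le_trans; apply.
split.
  have := norm_cvg_nq Lun Lf cu => cu'.
  rewrite /norm_cvg; have -> : (fun n => Lq_norm m q (a *: u n - a *: f)) =
      EFin \o (fun n => `|a| * nq (u n - f)).
    apply/funext => n; rewrite -scalerBr /= -nqZ//; last exact: (subspaceB LqS).
    by rewrite Lq_norm_nq//; apply: (subspaceZ LqS); exact: (subspaceB LqS).
  apply: cvg_EFin; first exact: nearW.
  by rewrite -(mulr0 `|a|); apply: cvgMr.
split.
- by move=> n; rewrite LaE; apply: (subspaceZ LqS).
- exact: (subspaceZ LqS).
- move=> l dl; have [ll _] := dl.
  have -> : (fun n => l (fun x => fine (Lip_a (a *: u n) x))) =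
      (fun n => `|a| * l (fun x => fine (Lip_a (u n) x))).
    by apply/funext => n; rewrite LaE (linear_onZ LqS).
  rewrite (linear_onZ LqS)//; apply: cvgMr; exact: wk.
Qed.

Lemma sobolev_bounded_closure (v : nat -> X -> R) f (C : set (X -> R)) (M : R) :
  is_reflexive (sobolev m q) (sobolev_norm m q) ->
  (forall n, bl (v n)) -> (forall n, energy_norm (v n) <= M) -> approx_space f ->
  nq (v n - f) @[n --> \oo] --> 0 ->
  C `<=` approx_space -> convex_on C -> (forall n, C (v n)) ->
  forall e, 0 < e -> exists2 c, C c & energy_norm (f - c) < e.
Proof.
move=> refl blv vM Wf vf CW Ccvx Cv.
apply: (reflexive_bounded_closure sobolev_approx_space approx_space_subspace energy_seminorm
  nq_approx_seminorm (ltr0n R 2) _ energy_norm_null sobolev_norm_le energy_norm_le _ refl _ vM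
  Wf vf CW Ccvx Cv).
- by move=> u _; rewrite /energy_norm lerDl nq_ge0.
- by move=> a u; exact: sobolevZ.
- by move=> k; exact: bounded_lipschitz_sobolev.
Qed.

Lemma bounded_lipschitz_dense : is_reflexive (sobolev m q) (sobolev_norm m q) ->
  forall f e, sobolev m q f -> 0 < e -> exists2 c, bl c & energy_norm (f - c) < e.
Proof.
move=> refl f e Sf e0; have Wf := sobolev_approx_space Sf.
have [h fh] := Wf; have [Lf Lh H] := fh.
have /choice[vk vkP] (k : nat) : exists vk : (X -> R) * (X -> R), [/\ bl vk.1,
    forall x, (Lip_a vk.1 x <= (vk.2 x)%:E)%E, Lq vk.2,
    nq (vk.1 - f) < k.+1%:R^-1 & nq (vk.2 - h) < k.+1%:R^-1].
  by have [|v [w ?]] := H k.+1%:R^-1; [rewrite invr_gt0|exists (v, w)].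
have blv (k : nat) : bl (vk k).1 by have [] := vkP k.
have inv1 (k : nat) : (k.+1%:R^-1 : R) <= 1 by rewrite invf_le1// ler1n.
(* The approximants are within 1 of [f], and their majorants, which control their slopes, within 1
   of [h]. *)
apply: (sobolev_bounded_closure (v := fun k : nat => (vk k).1) (M := nq f + 1 + (nq h + 1))) => //.
- move=> k; have [bk Lk Lw kf kh] := vkP k; rewrite /energy_norm; apply: lerD.
    have Lv := Lq_bounded_lipschitz bk.
    have := nqD q1 (subspaceB LqS Lv Lf) Lf; rewrite subrK => /le_trans; apply.
    by rewrite addrC lerD2l ltW// (lt_le_trans kf).
  apply: (le_trans (slope_norm_le (approximable_bl bk Lk Lw))).
  have := nqD q1 (subspaceB LqS Lw Lh) Lh; rewrite subrK => /le_trans; apply.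
  by rewrite addrC lerD2l ltW// (lt_le_trans kh).
- apply: (@squeeze_cvgr _ _ _ _ (fun=> 0) (fun k : nat => k.+1%:R^-1)).
  + by apply: nearW => k; have [_ _ _ kf _] := vkP k; rewrite nq_ge0 ltW.
  + exact: cvg_cst.
  + exact: cvg_harmonic.
- exact: bounded_lipschitz_approx_space.
- move=> t u v _ _ bu bv; have S := @bounded_lipschitz_subspace R X.
  by apply: (subspaceD S); exact: (subspaceZ S).
Qed.

End sobolev_approximation.

(** * Separability *)

Section mcshane_family.
Context {R : realType} {X : completeMetricType R}.
Variables (xs : nat -> X) (x0 : X).
Local Notation bl := (@bounded_lipschitz_bs R X).

(** McShane's extension of finitely many rational data; the starting value [N] of the minimum caps
    the function at [N]. *)
Definition mcshane (s : seq rat) (N : nat) (x : X) : R :=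
  \big[Num.min/N%:R]_(i < size s) (ratr s`_i + N%:R * mdist x (xs i)).

Definition cutoff (N : nat) (x : X) : R := Num.max 0 (Num.min 1 (N%:R + 1 - mdist x0 x)).

(** A countable family whose sup norm, Lipschitz constant and support depend on [z.2] alone, so the
    members with a fixed [z.2] are bounded in energy. *)
Definition mcshane_cutoff (z : seq rat * nat) (x : X) : R :=
  Num.max (- z.2%:R) (mcshane z.1 z.2 x) * cutoff z.2 x.

Let max_lipschitz (c a b d : R) : `|a - b| <= d -> `|Num.max c a - Num.max c b| <= d.
Proof.
move=> abd; have d0 := le_trans (normr_ge0 _) abd; move: abd.
rewrite !ler_norml => /andP[h1 h2].
by case: (leP c a) => ?; case: (leP c b) => ?; apply/andP; split; lra.
Qed.

Let min_lipschitz (c a b d : R) : `|a - b| <= d -> `|Num.min c a - Num.min c b| <= d.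
Proof.
move=> abd; have d0 := le_trans (normr_ge0 _) abd; move: abd.
rewrite !ler_norml => /andP[h1 h2].
by case: (leP c a) => ?; case: (leP c b) => ?; apply/andP; split; lra.
Qed.

Lemma mcshane_lipschitz s N x y : `|mcshane s N x - mcshane s N y| <= N%:R * mdist x y.
Proof.
apply: (big_ind2 (fun a b => `|a - b| <= N%:R * mdist x y)).
- by rewrite subrr normr0 mulr_ge0// mdist_ge0.
- move=> a b a' b'; rewrite !ler_norml => /andP[? ?] /andP[? ?].
  by case: (leP a a'); case: (leP b b') => *; apply/andP; split; lra.
- move=> i _; rewrite opprD addrACA subrr add0r -mulrBr normrM ger0_norm// ler_wpM2l//.
  exact: ler_mdistB.
Qed.

Lemma cutoff_itv N x : 0 <= cutoff N x <= 1.
Proof. by rewrite /cutoff le_max lexx/= ge_max ler01/= ge_min lexx. Qed.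

Lemma cutoff_lipschitz N x y : `|cutoff N x - cutoff N y| <= mdist x y.
Proof.
apply: max_lipschitz; apply: min_lipschitz.
have := ler_mdistB x y x0; rewrite !(metric_sym _ x0).
rewrite [X in _ -> `|X| <= _](_ : _ = - (mdist x0 x - mdist x0 y)); last by ring.
by rewrite normrN.
Qed.

Lemma cutoff1 N x : mdist x0 x <= N%:R -> cutoff N x = 1.
Proof.
move=> xN; rewrite /cutoff (_ : Num.min _ _ = 1); first by apply/max_idPr.
by apply/min_idPl; lra.
Qed.

Lemma cutoff0 N x : N%:R + 1 < mdist x0 x -> cutoff N x = 0.
Proof. by move=> xN; rewrite /cutoff; apply/max_idPl; rewrite ge_min; apply/orP; right; lra. Qed.

Let clamp_norm (z : seq rat * nat) x : `|Num.max (- z.2%:R) (mcshane z.1 z.2 x)| <= z.2%:R.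
Proof.
have h : mcshane z.1 z.2 x <= z.2%:R by exact: bigmin_le_id.
rewrite ler_norml le_max lexx/= ge_max h andbT.
by rewrite -subr_ge0 opprK addr_ge0.
Qed.

Lemma mcshane_cutoff_norm z x : `|mcshane_cutoff z x| <= z.2%:R.
Proof.
have /andP[c0 c1] := cutoff_itv z.2 x.
rewrite /mcshane_cutoff normrM (ger0_norm c0) -[leRHS]mulr1.
by apply: ler_pM => //; exact: clamp_norm.
Qed.

Lemma mcshane_cutoff_lipschitz z :
  lipschitz_const_on setT (mcshane_cutoff z) (z.2%:R + z.2%:R).
Proof.
split; first by rewrite addr_ge0.
move=> x y _ _; rewrite /mcshane_cutoff.
set a := Num.max _ (mcshane _ _ x); set b := Num.max _ (mcshane _ _ y).
have ab : `|a - b| <= z.2%:R * mdist x y.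
  by apply: max_lipschitz; exact: mcshane_lipschitz.
(* Product rule: a factor bounded by [z.2] times a 1-Lipschitz one, and a factor bounded by 1 times
   a [z.2]-Lipschitz one. *)
have -> : a * cutoff z.2 x - b * cutoff z.2 y =
    a * (cutoff z.2 x - cutoff z.2 y) + cutoff z.2 y * (a - b) by ring.
apply: (le_trans (ler_normD _ _)); rewrite mulrDl !normrM; apply: lerD.
  by apply: ler_pM => //; [exact: clamp_norm|exact: cutoff_lipschitz].
have /andP[c0 c1] := cutoff_itv z.2 y.
by rewrite (ger0_norm c0) -[leRHS]mul1r; apply: ler_pM.
Qed.

Lemma mcshane_cutoff_support z x : z.2%:R + 1 < mdist x0 x -> mcshane_cutoff z x = 0.
Proof. by move=> zx; rewrite /mcshane_cutoff cutoff0// mulr0. Qed.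

Lemma mcshane_cutoff_bl z : bl (mcshane_cutoff z).
Proof.
split; first by exists z.2%:R; exact: mcshane_cutoff_norm.
  by exists (z.2%:R + z.2%:R); exact: mcshane_cutoff_lipschitz.
exists ((z.2%:R + 1) + (z.2%:R + 1)) => x y /=.
have key w : mcshane_cutoff z w != 0 -> mdist x0 w <= z.2%:R + 1.
  by apply: contraNT; rewrite -ltNge => /mcshane_cutoff_support ->.
move=> /key xz /key yz; have := metric_triangle x x0 y.
by rewrite (metric_sym x x0); lra.
Qed.

Hypothesis xs_dense : forall x (e : R), 0 < e -> exists n, mdist x (xs n) < e.

(* By McShane, an [N]-Lipschitz [v] is the infimum of [v (xs i) + N d(x, xs i)]. *)
Lemma mcshane_cutoff_cvg v : bl v ->
  exists (N : nat) (s : nat -> seq rat), (forall x, `|v x| <= N%:R) /\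
    (forall x, N%:R < mdist x0 x -> v x = 0) /\
    forall x, mcshane_cutoff (s j, N) x - v x @[j --> \oo] --> 0.
Proof.
move=> blv; have [[M vM] [L [L0 vL]] _] := blv.
have [y0 [r [r0 vr]]] := bounded_lipschitz_in_ball blv.
(* One integer exceeds the sup bound of [v], its Lipschitz constant and the radius around [x0] of a
   ball containing its support. *)
pose N := (Num.truncn (`|M| + L + r + mdist x0 y0)%R).+1.
have d0 := @mdist_ge0 _ _ x0 y0; have M0 := normr_ge0 M.
have NB : `|M| + L + r + mdist x0 y0 < N%:R by exact: truncnS_gt.
have vN x : `|v x| <= N%:R.
  by have := vM x; have := ler_norm M; lra.
have vLN x y : `|v x - v y| <= N%:R * mdist x y.
  apply: (le_trans (vL x y I I)); apply: ler_wpM2r; first exact: mdist_ge0.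
  by lra.
have v0 x : N%:R < mdist x0 x -> v x = 0.
  move=> Nx; apply: vr; have := metric_triangle x0 y0 x; lra.
(* The data are taken above the values of [v], so the McShane functions stay above [v] and only an
   upper estimate remains. *)
have /choice[a aP] (j : nat) : exists a : nat -> rat, forall i,
    v (xs i) < ratr (a i) < v (xs i) + j.+1%:R^-1.
  have /choice[a aP] (i : nat) : exists b : rat, v (xs i) < ratr b < v (xs i) + j.+1%:R^-1.
    have [|b] := @rat_in_itvoo R (v (xs i)) (v (xs i) + j.+1%:R^-1).
      by rewrite ltrDl invr_gt0.
    by rewrite in_itv => ?; exists b.
  by exists a.
exists N, (fun j => mkseq (a j) j.+1); split => //; split => // x.
have mc_ge j : v x <= mcshane (mkseq (a j) j.+1) N x.
  apply: le_bigmin; first by have := vN x; rewrite ler_norml => /andP[].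
  move=> i _; have ij : (i < j.+1)%N.
    by apply: leq_trans (ltn_ord i) _; rewrite size_mkseq.
  rewrite nth_mkseq//.
  have /andP[? _] := aP j i; have := vLN x (xs i).
  by rewrite ler_norml => /andP[_ ?]; lra.
(* The lower truncation is inactive, as [- N <= v] and the McShane function lies above [v]; the
   cutoff factors out because [v] vanishes wherever it may differ from 1. *)
have mcE j : mcshane_cutoff (mkseq (a j) j.+1, N) x - v x =
    (mcshane (mkseq (a j) j.+1) N x - v x) * cutoff N x.
  rewrite /mcshane_cutoff/= mulrBl; congr (_ * _ - _).
    apply/max_idPr; apply: le_trans (mc_ge j).
    by have := vN x; rewrite ler_norml => /andP[].
  have [xN|Nx] := leP (mdist x0 x) N%:R; first by rewrite cutoff1// mulr1.
  by rewrite v0// mul0r.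
apply/cvgrPdist_lt => e e0.
have N1 : 0 < N%:R + 1 :> R by rewrite ltr_pwDr.
(* Three thirds: the rational error at [xs i], the variation of [v] from [x] to [xs i], and the cone
   term of slope [N]. The added 1 covers [N = 0]. *)
have [i xi] := xs_dense x (divr_gt0 (divr_gt0 e0 (ltr0n R 3)) N1).
have := @cvg_harmonic R => /cvgrPdist_lt/(_ (e / 3) (divr_gt0 e0 (ltr0n R 3))).
move=> hj; near=> j.
have ij : (i <= j)%N by near: j; exact: nbhs_infty_ge.
have je : j.+1%:R^-1 < e / 3.
  have : `|0 - harmonic j| < e / 3 by near: j; exact: hj.
  by rewrite sub0r normrN /harmonic ger0_norm// invr_ge0.
rewrite sub0r normrN mcE.
have /andP[c0 c1] := cutoff_itv N x.
have h0 : 0 <= mcshane (mkseq (a j) j.+1) N x - v x by rewrite subr_ge0.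
rewrite normrM (ger0_norm c0) (ger0_norm h0).
apply: (@le_lt_trans _ _ (mcshane (mkseq (a j) j.+1) N x - v x)).
  by rewrite -[leRHS]mulr1 ler_wpM2l.
have isz : (i < size (mkseq (a j) j.+1))%N by rewrite size_mkseq ltnS.
have : mcshane (mkseq (a j) j.+1) N x <= ratr (mkseq (a j) j.+1)`_i + N%:R * mdist x (xs i).
  by rewrite /mcshane (bigminD1 (Ordinal isz))//= ge_min lexx.
rewrite nth_mkseq ?ltnS//; have /andP[_ ai] := aP j i.
have vi := vLN x (xs i); have Nd : N%:R * mdist x (xs i) < e / 3.
  apply: (@le_lt_trans _ _ ((N%:R + 1) * mdist x (xs i))).
    by rewrite ler_wpM2r ?mdist_ge0// lerDl.
  by rewrite mulrC -ltr_pdivlMr.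
move: vi je ai; rewrite ler_norml => /andP[vi _].
by move: (j.+1%:R^-1 : R) => je ??; lra.
Unshelve. all: by end_near. Qed.

End mcshane_family.

Section separability.
Context {R : realType} {X : completeMetricType R}.
Variables (m : {measure set (borel X) -> \bar R}) (q : R).
Hypotheses (q1 : 1 < q) (mfin : finite_on_bounded m) (sepX : separable_space X).
Local Notation mfun f := (measurable_fun setT (f : borel X -> _)).
Local Notation Lq := (Lq m q).
Local Notation nq := (nq m q).
Local Notation bl := (@bounded_lipschitz_bs R X).
Local Notation energy := (energy_norm m q).
Local Notation Wa := (approx_space m q).

Lemma nq_dominated (u : nat -> X -> R) (g : X -> R) : (forall n, mfun (u n)) -> Lq g ->
  (forall n x, `|u n x| <= `|g x|) -> (forall x, u n x @[n --> \oo] --> 0) ->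
  nq (u n) @[n --> \oo] --> 0.
Proof.
move=> mu Lg ug ucvg; have q0 : 0 < q by exact: lt_trans q1.
have Lu n : Lq (u n) by apply: (Lq_le q1 (mu n) Lg); apply: aeW => x; exact: ug.
have mpow (v : X -> R) : mfun v -> mfun (fun x => (`|v x|%:E `^ q)%E).
  move=> mv; apply: (measurableT_comp (measurable_poweR q)); apply/measurable_EFinP.
  exact: measurableT_comp.
have c1 : {ae m, forall x, setT x -> (fun n => (`|u n x|%:E `^ q)%E) @ \oo --> (cst 0%E : X -> \bar R) x}.
  apply: aeW => x _; under eq_fun do rewrite poweR_EFin; apply: cvg_EFin; first exact: nearW.
  apply/cvgrPdist_lt => e e0.
  have e'0 : 0 < e `^ q^-1 by exact: powR_gt0.
  have /cvgrPdist_lt/(_ _ e'0) := ucvg x; apply: filterS => n.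
  rewrite /= !sub0r !normrN [X in _ -> X < _]ger0_norm ?powR_ge0// => ue.
  have -> : e = (e `^ q^-1) `^ q by rewrite -powRrM mulVf ?gt_eqF// powRr1// ltW.
  by apply: gt0_ltr_powR => //; rewrite nnegrE ?powR_ge0.
have ig : m.-integrable setT (fun x => (`|g x|%:E `^ q)%E).
  apply/integrableP; split; first exact: mpow (Lq_measurable Lg).
  under eq_integral do rewrite gee0_abs ?poweR_ge0//.
  by rewrite (nq_pow q1 Lg) ltry.
have c2 : {ae m, forall x n, setT x -> (`| `|u n x|%:E `^ q | <= `|g x|%:E `^ q)%E}.
  apply: aeW => x n _; rewrite gee0_abs ?poweR_ge0// !poweR_EFin lee_fin.
  by rewrite ge0_ler_powR ?nnegrE// ltW.
have [_ _] := dominated_convergence measurableT (fun n => mpow _ (mu n)) (measurable_cst 0%E) c1 ig c2.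
rewrite integral0 => H.
have {}H : (nq (u n) `^ q)%:E @[n --> \oo] --> 0%E.
  by apply: cvg_trans H; apply: near_eq_cvg; apply: nearW => n; rewrite /= (nq_pow q1 (Lu n)).
apply/cvgrPdist_lt => e e0; have eq0 : 0 < e `^ q by exact: powR_gt0.
have {}H : (nq (u n) `^ q)%R @[n --> \oo] --> (0 : R) by exact: (fine_cvg H).
have /cvgrPdist_lt/(_ _ eq0) := H; apply: filterS => n /=.
rewrite !sub0r !normrN !ger0_norm ?powR_ge0 ?nq_ge0// => ue.
rewrite ltNge; apply/negP => eu; move: ue; apply/negP; rewrite -leNgt.
by rewrite ge0_ler_powR ?nnegrE ?nq_ge0// ltW.
Qed.

Let WaS := approx_space_subspace q1 mfin.
Let en := energy_seminorm q1 mfin sepX.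

(** The McShane functions converge to [v] pointwise and in [L^q], which says nothing about their
    slopes; their boundedness in energy, with reflexivity, still puts [v] in the energy closure of
    their rational combinations. *)
Lemma sobolev_separable : is_reflexive (sobolev m q) (sobolev_norm m q) ->
  is_separable (sobolev m q) (sobolev_norm m q).
Proof.
move=> refl; have [xs xs_dense] := dense_seq sepX; pose x0 := xs 0%N.
pose phi z := mcshane_cutoff xs x0 z.
pose comb (s : seq (rat * (seq rat * nat))) : X -> R := \sum_(z <- s) (ratr z.1 : R) *: phi z.2.
have blphi z : bl (phi z) by exact: mcshane_cutoff_bl.
have bS := @bounded_lipschitz_subspace R X.
have blcomb s : bl (comb s).
  rewrite /comb; elim: s => [|z s IH]; first by rewrite big_nil; exact: subspace0.
  by rewrite big_cons; apply: subspaceD => //; exact: subspaceZ.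
pose D := range comb.
have phiD z : D (phi z).
  by exists [:: (1, z)] => //; rewrite /comb big_seq1 rmorph1 scale1r.
have blWa := bounded_lipschitz_approx_space q1 mfin.
have DWa d : D d -> Wa d by move=> [s _ <-]; exact: blWa.
(* [D] has only rational coefficients and need not be convex; its energy closure is. *)
pose C := [set f | Wa f /\ forall e, 0 < e -> exists2 d, D d & energy (f - d) < e].
have Cphi z : C (phi z).
  split; first exact: blWa.
  move=> e e0; exists (phi z) => //; rewrite subrr.
  by rewrite (_ : energy 0 = 0)//; have := en.2 0 0 (subspace0 WaS); rewrite scale0r normr0 mul0r.
have Ccvx : convex_on C.
  move=> t u v t0 t1 [Wu Cu] [Wv Cv].
  have WZ c w : Wa w -> Wa (c *: w) by exact: (subspaceZ WaS).
  split; first by apply: (subspaceD WaS); exact: WZ.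
  move=> e e0; have e2 : 0 < e / 2 by rewrite divr_gt0.
  have [d1 Dd1 ud1] := Cu _ e2; have [d2 Dd2 vd2] := Cv _ e2.
  have Wd1 := DWa _ Dd1; have Wd2 := DWa _ Dd2.
  have Wd := subspaceB WaS Wd1 Wd2.
  pose K := energy (d1 - d2) + 1.
  have K0 : 0 < K by rewrite /K ltr_wpDl// (seminorm_ge0 WaS en).
  (* Replacing the weight [t] by a rational costs its error times [energy (d1 - d2)], kept below
     [e / 2]; the added 1 in [K] allows the division. *)
  have [r] := @rat_in_itvoo R t (t + e / 2 / K) ltac:(by rewrite ltrDl divr_gt0).
  rewrite in_itv/= => /andP[tr rt].
  exists ((ratr r : R) *: d1 + (1 - ratr r) *: d2).
    have [s1 _ <-] := Dd1; have [s2 _ <-] := Dd2.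
    exists ([seq (r * z.1, z.2) | z <- s1] ++ [seq ((1 - r) * z.1, z.2) | z <- s2]) => //.
    rewrite /comb big_cat !big_map !scaler_sumr; congr (_ + _); apply: eq_bigr => z _ /=.
      by rewrite rmorphM scalerA.
    by rewrite rmorphM rmorphB rmorph1 scalerA.
  have -> : t *: u + (1 - t) *: v - ((ratr r : R) *: d1 + (1 - ratr r) *: d2) =
      (t *: (u - d1) + (1 - t) *: (v - d2)) + (t - ratr r) *: (d1 - d2).
    apply/funext => x; rewrite !fctE /=.
    rewrite /GRing.scale/=; ring.
  have W1 := subspaceB WaS Wu Wd1; have W2 := subspaceB WaS Wv Wd2.
  have s0 : 0 <= 1 - t by rewrite subr_ge0.
  have W12 := subspaceD WaS (WZ t _ W1) (WZ (1 - t) _ W2).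
  apply: (le_lt_trans (en.1 _ _ W12 (WZ _ _ Wd))).
  rewrite en.2// [ltRHS](splitr e); apply: ler_ltD.
    apply: (le_trans (en.1 _ _ (WZ _ _ W1) (WZ _ _ W2))); rewrite !en.2// !ger0_norm//.
    rewrite (_ : e / 2 = t * (e / 2) + (1 - t) * (e / 2)); last by ring.
    by apply: lerD; rewrite ler_wpM2l// ltW.
  rewrite ler0_norm ?subr_le0 ?ltW// opprB.
  apply: (@le_lt_trans _ _ ((ratr r - t) * K)).
    by rewrite ler_wpM2l ?subr_ge0 ?(ltW tr)// /K lerDl.
  by rewrite -ltr_pdivlMr// ltrBlDl.
exists D.
  apply: (@sub_countable _ _ _ setT); [exact: card_image_le|exact: countableP].
split.
  by move=> _ [s _ <-]; exact: bounded_lipschitz_sobolev.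
(* Three energy errors, from [f] to [v], to [c] and to [d], are doubled by the comparison with the
   Sobolev norm. *)
move=> f Sf e e0; have e6 : 0 < e / 6 by rewrite divr_gt0.
have Wf := sobolev_approx_space q1 mfin Sf.
have [v blv fv] := bounded_lipschitz_dense q1 mfin sepX refl Sf e6.
have Wv := blWa _ blv.
have [N [s [vN [v0 scvg]]]] := mcshane_cutoff_cvg x0 xs_dense blv.
have phib j := Lq_bounded_support q1 mfin (measurable_lipschitz (ex_intro _ _
  (mcshane_cutoff_lipschitz xs x0 (s j, N)))) (mcshane_cutoff_norm xs x0 (s j, N))
  (@mcshane_cutoff_support _ _ xs x0 (s j, N)).
(* All [phi (s j, N)] share the sup bound [N], the Lipschitz constant [N + N] and the support radius
   [N + 1], so the energy bound does not depend on [j]. *)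
have [c Cc vc] : exists2 c, C c & energy (v - c) < e / 6.
  apply: (sobolev_bounded_closure q1 mfin sepX (v := fun j => phi (s j, N))
    (M := nq (N%:R *: ball_indic x0 (N%:R + 1)) +
          nq ((N%:R + N%:R) *: ball_indic x0 (N%:R + 1)))) => //.
  - move=> j; rewrite /energy_norm; apply: lerD; first by have [] := phib j.
    have lphi := mcshane_cutoff_lipschitz xs x0 (s j, N).
    have iphi : is_lipschitz (phi (s j, N)) by exists (N%:R + N%:R).
    have [Lk Lkle] := Lip_a_bounded_support q1 mfin iphi lphi
      (@mcshane_cutoff_support _ _ xs x0 (s j, N)).
    apply: le_trans Lkle; apply: (slope_norm_le q1 mfin sepX).
    apply: (approximable_bl q1 mfin) => // x.
    by rewrite fineK// Lip_a_fin_num.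
  - have L2 := subspaceZ (Lq_subspace m q1) (N%:R + N%:R) (Lq_ball_indic q1 mfin x0 (N%:R + 1)).
    apply: (nq_dominated _ L2).
    + move=> j; apply: measurable_funB; apply: measurable_lipschitz; last by case: blv.
      by have [] := blphi (s j, N).
    + move=> j x.
      rewrite [X in _ <= `|X|](_ : _ = (N%:R + N%:R) * ball_indic x0 (N%:R + 1) x)// ball_indicE.
      rewrite [X in `|X|](_ : _ = phi (s j, N) x - v x)//.
      case: (leP (mdist x0 x) (N%:R + 1)) => xN.
        rewrite mulr1 [leRHS]ger0_norm ?addr_ge0// (le_trans (ler_normB _ _))// lerD//.
        exact: mcshane_cutoff_norm.
      rewrite /phi mcshane_cutoff_support// v0 ?subrr ?normr0//.
      by apply: lt_trans xN; rewrite ltrDl.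
    + by move=> x; exact: scvg.
  - by move=> u [].
have [Wc Hc] := Cc; have [d Dd cd] := Hc _ e6; exists d => //.
have Wd := DWa _ Dd.
apply: (le_lt_trans (sobolev_norm_le q1 mfin sepX (subspaceB WaS Wf Wd))).
rewrite lte_fin; have h1 := seminorm_sub WaS en Wf Wv Wd.
have h2 := seminorm_sub WaS en Wv Wc Wd; lra.
Qed.

End separability.

Theorem proposition7p6 (R : realType) (X : completeMetricType R) (q : R)
    (m : {measure set (borel X) -> \bar R}) :
  1 < q ->
  separable_space X ->
  finite_on_bounded m ->
  is_reflexive (sobolev m q) (sobolev_norm m q) ->
  is_separable (sobolev m q) (sobolev_norm m q) /\
  dense_subset (sobolev m q) (sobolev_norm m q) bounded_lipschitz_bs.
Proof.
move=> q1 sepX mfin refl; split; first exact: sobolev_separable.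
split; first exact: bounded_lipschitz_sobolev.
(* Passing from the energy norm to the Sobolev norm costs a factor 2, so [e / 3] is small enough. *)
move=> f Sf e e0; have e3 : 0 < e / 3 by rewrite divr_gt0.
have [v blv fv] := bounded_lipschitz_dense q1 mfin sepX refl Sf e3.
exists v => //; have Wf := sobolev_approx_space q1 mfin Sf.
have Wv := bounded_lipschitz_approx_space q1 mfin blv.
have WS := approx_space_subspace q1 mfin.
apply: (le_lt_trans (sobolev_norm_le q1 mfin sepX (subspaceB WS Wf Wv))).
by rewrite lte_fin; lra.
Qed.
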